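(* Let $\xi\in\Xi_N$ and let $k\in\{1,\dots,N-1\}$ with $\gcd(k,N)=1$. (a) If $\xi\notin\{\xi(\mathfrak N_k^+),\xi(\mathfrak N_k^-)\}$, then $\mathcal A_k(\cdot\,;2\pi)$ attains its minimum on the set of loops in $\Lambda^{D_N}_\xi$ satisfying $[z_0]=0$. (b) If $\xi=\xi(\mathfrak N_k^{+})$ or $\xi=\xi(\mathfrak N_k^{-})$, then $\mathcal A_k(\cdot\,;2\pi)$ has no minimizer on the set of loops in $\Lambda^{D_N}_\xi$ satisfying $[z_0]=0$, and the infimum of $\mathcal A_k(\cdot\,;2\pi)$ over that set is $0$. (c) Suppose $\xi=\xi(\mathfrak N_k^{\pm})$ for one of the two signs, and let $q^n\in\Lambda^{D_N}_\xi$ with $[z^n_0]=0$ and $\mathcal A_k(q^n;2\pi)\to0$. Then $|q^n_i(t)|\to\infty$ uniformly in $t\in\mathbb R$ for every $i\in\mathbf N$. Moreover, after passing to a subsequence, $q^n(t)/|q^n(t)|$ converges uniformly on $\mathbb R$ to $e^{-\mathrm ikt}\mathfrak N_k^{\pm}/|\mathfrak N_k^{\pm}|$, with the same sign as in $\xi=\xi(\mathfrak N_k^{\pm})$.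
   Context: Fix an integer $N\ge2$ and let $\mathbf N=\{0,\dots,N-1\}$. Consider unit masses with positions $q_i=(x_i,y_i,z_i)=(\zeta_i,z_i)\in\mathbb C\times\mathbb R$, where $\zeta_i=x_i+\mathrm iy_i$. - Potential: $U(q)=\sum_{i<j}1/|q_i-q_j|$. - Loop space: $\Lambda=H^1(\mathbb R/2\pi\mathbb Z,\mathbb R^{3N})$. - Rotating-frame action: $\mathcal A_\omega(q;T)=\int_0^T\big(\tfrac12\sum_i(|\dot\zeta_i+\mathrm i\omega\zeta_i|^2+\dot z_i^2)+U(q)\big)dt$. - Rotation of configurations: for a configuration $c=(\zeta_i,z_i)_i$ and $\theta\in\mathbb R$, $e^{\mathrm i\theta}c=(e^{\mathrm i\theta}\zeta_i,z_i)_i$. $|\cdot|$ denotes the Euclidean norm on $\mathbb R^{3N}$ or $\mathbb R^3$. - Mean: $[z_0]=\frac1{2\pi}\int_0^{2\pi}z_0$. - Reflection: $\mathfrak R_{xz}(x,y,z)=(x,-y,z)$. - $D_N$-symmetric loops: $\Lambda^{D_N}=\{q\in\Lambda: q_i(t)=q_0(t+2\pi i/N),\ q_0(2\pi-t)=\mathfrak R_{xz}q_0(t)\}$. - Sign data: for collision-free $q\in\Lambda^{D_N}$, $y_0(j\pi/N)\ne0$ for $j=1,\dots,N-1$. Let $\Xi_N=\{\pm1\}^{N-1}$. - Topological classes: $\Lambda^{D_N}_\xi$ is the weak $H^1$-closure in $\Lambda^{D_N}$ of the collision-free $q\in\Lambda^{D_N}$ with $\operatorname{sign}y_0(j\pi/N)=\xi_j$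 for all $j$. - Regular $N$-gons $\mathfrak N_k^{\pm}$: for $k\in\{1,\dots,N-1\}$ with $\gcd(k,N)=1$, these are the two configurations forming a regular $N$-gon in the $xy$-plane centered at the origin with the following placement. Starting from the vertex occupied by $m_i$ (counted as the first), $m_{i+1}$ occupies the $(k+1)$-th vertex in the clockwise direction. The mass $m_0$ lies on the negative $x$-axis for $\mathfrak N_k^-$ and on the positive $x$-axis for $\mathfrak N_k^+$. The size is chosen so that $e^{\mathrm it}\mathfrak N_k^{\pm}$ solves Newton's equations. - Associated sign vectors: for every $\lambda>0$, the loop $\lambda e^{-\mathrm ikt}\mathfrak N_k^\pm$ lies in $\Lambda^{D_N}$, and $\xi(\mathfrak N_k^{\pm})\in\Xi_N$ denotes the unique element with $\lambda e^{-\mathrm ikt}\mathfrak N_k^{\pm}\in\Lambda^{D_N}_{\xi(\mathfrak N_k^\pm)}$. *)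

(* Defs.v *)
From HB Require Import structures.
From mathcomp Require Import all_boot all_order all_algebra.
From mathcomp Require Import all_classical all_reals all_analysis.
Set Implicit Arguments.
Unset Strict Implicit.
Unset Printing Implicit Defensive.
Import Order.TTheory GRing.Theory Num.Theory.
Import numFieldNormedType.Exports.
Local Open Scope classical_set_scope.
Local Open Scope ring_scope.

Definition cx : 'I_3 := Ordinal (isT : (0 < 3)%N).
Definition cy : 'I_3 := Ordinal (isT : (1 < 3)%N).
Definition cz : 'I_3 := Ordinal (isT : (2 < 3)%N).

Definition config (R : realType) (N : nat) := 'I_N -> 'I_3 -> R.
Definition loop (R : realType) (N : nat) := R -> config R N.

Notation leb := (@lebesgue_measure _).

Definition twopi (R : realType) : R := 2 * pi.

(* Body number i (as a natural number), 0 if i >= N. *)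
Definition body (R : realType) (N : nat) (c : config R N) (i : nat) : 'I_3 -> R :=
  fun a => oapp (fun o : 'I_N => c o a) 0 (insub i).

Definition confnorm (R : realType) (N : nat) (c : config R N) : R :=
  Num.sqrt (\sum_(i < N) \sum_(a < 3) (c i a) ^+ 2).
Definition bdist (R : realType) (N : nat) (c : config R N) (i j : 'I_N) : R :=
  Num.sqrt (\sum_(a < 3) (c i a - c j a) ^+ 2).

Definition confscale (R : realType) (N : nat) (l : R) (c : config R N) : config R N :=
  fun i a => l * c i a.
Definition confsub (R : realType) (N : nat) (c d : config R N) : config R N :=
  fun i a => c i a - d i a.

Definition confrot (R : realType) (N : nat) (th : R) (c : config R N) : config R N :=
  fun i a =>
    if a == cx then cos th * c i cx - sin th * c i cy
    else if a == cy then sin th * c i cx + cos th * c i cy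
    else c i cz.

Definition potU (R : realType) (N : nat) (c : config R N) : \bar R :=
  (\sum_(i < N) \sum_(j < N | (i < j)%N)
      (if bdist c i j == 0%R then +oo else ((bdist c i j)^-1)%:E))%E.

(* H^1(R/2piZ, R): 2pi-periodic functions f with f(t) = f(0) + int_0^t g
   for some square-integrable g (i.e. absolutely continuous with L^2 derivative). *)
Definition H1fun (R : realType) (f : R -> R) : Prop :=
  (forall t, f (t + 2 * pi) = f t) /\
  exists g : R -> R,
    measurable_fun `[0%R, twopi R] g /\
    (\int[leb]_(x in `[0%R, twopi R]) ((g x) ^+ 2)%:E < +oo)%E /\
    forall t, 0 <= t <= 2 * pi -> f t = f 0 + \int[leb]_(x in `[0%R, t]) g x.

Definition is_loop (R : realType) (N : nat) (q : loop R N) : Prop :=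
  forall i a, H1fun (fun t => q t i a).

(* Derivative of a coordinate of a loop (defined a.e. for H^1 loops). *)
Definition dq (R : realType) (N : nat) (q : loop R N) (t : R) (i : 'I_N) (a : 'I_3) : R :=
  derive1 (fun s => q s i a) t.

Definition H1inner (R : realType) (N : nat) (q v : loop R N) : R :=
  \sum_(i < N) \sum_(a < 3)
    \int[leb]_(t in `[0%R, twopi R]) (q t i a * v t i a + dq q t i a * dq v t i a).

(* q belongs to the weak H^1-closure of S (weak topology of H^1: the
   continuous linear functionals are the p |-> <p, v>_{H^1}, v in Lambda). *)
Definition weak_closure (R : realType) (N : nat) (S : set (loop R N)) (q : loop R N) : Prop :=
  forall (vs : seq (loop R N)) (e : R), (forall v, v \in vs -> is_loop v) -> 0 < e ->
    exists s, S s /\ forall v, v \in vs -> `| H1inner (fun t => confsub (s t) (q t)) v | < e.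

Definition DN_sym (R : realType) (N : nat) (q : loop R N) : Prop :=
  (forall t (i : 'I_N) a, q t i a = body (q (t + 2 * pi * i%:R / N%:R)) 0 a) /\
  (forall t a, body (q (2 * pi - t)) 0 a =
                 if a == cy then - body (q t) 0 a else body (q t) 0 a).

Definition loopsDN (R : realType) (N : nat) : set (loop R N) :=
  [set q | is_loop q /\ DN_sym q].

Definition collision_free (R : realType) (N : nat) (q : loop R N) : Prop :=
  forall t (i j : 'I_N), i != j -> q t i <> q t j.

(* Xi_N = {+1,-1}^{N-1}; index j : 'I_(N-1) stands for j+1 in {1..N-1},
   and true stands for +1, false for -1. *)
Definition Xi (N : nat) := {ffun 'I_N.-1 -> bool}.

Definition has_signs (R : realType) (N : nat) (xi : Xi N) (q : loop R N) : Prop :=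
  forall j : 'I_N.-1,
    let y := body (q (j.+1%:R * pi / N%:R)) 0 cy in
    if xi j then 0 < y else y < 0.

Definition LambdaDN_xi (R : realType) (N : nat) (xi : Xi N) : set (loop R N) :=
  [set q | loopsDN q /\
     weak_closure [set s | loopsDN s /\ collision_free s /\ has_signs xi s] q].

Definition mean_z0 (R : realType) (N : nat) (q : loop R N) : R :=
  (2 * pi)^-1 * \int[leb]_(t in `[0%R, twopi R]) body (q t) 0 cz.

Definition action (R : realType) (N : nat) (w T : R) (q : loop R N) : \bar R :=
  (\int[leb]_(t in `[0%R, T])
     ((2^-1 * \sum_(i < N)
         ((dq q t i cx - w * q t i cy) ^+ 2 + (dq q t i cy + w * q t i cx) ^+ 2
          + (dq q t i cz) ^+ 2))%:E + potU (q t)))%E.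

Definition solves_newton (R : realType) (N : nat) (q : loop R N) : Prop :=
  forall i a,
    (forall t, derivable (fun s => q s i a) t 1) /\
    (forall t, derivable (derive1 (fun s => q s i a)) t 1) /\
    (forall t, derive1 (derive1 (fun s => q s i a)) t =
       \sum_(j < N | j != i) (q t j a - q t i a) / (bdist (q t) j i) ^+ 3).

(* Regular N-gon of radius r in the xy-plane centred at 0: m_0 on the positive
   (s = true) or negative (s = false) x-axis, and m_{i+1} on the (k+1)-th
   vertex clockwise from m_i (counting m_i's vertex as the first). *)
Definition ngon_r (R : realType) (N : nat) (r : R) (k : nat) (s : bool) : config R N :=
  fun i a =>
    let th := (if s then 0 else pi) - 2 * pi * k%:R * i%:R / N%:R in
    if a == cx then r * cos th else if a == cy then r * sin th else 0.

Definition ngon_radius (R : realType) (N : nat) (k : nat) (s : bool) : R :=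
  xget 1 [set r : R | 0 < r /\
           solves_newton (fun t => confrot t (@ngon_r R N r k s))].

Definition Ngon (R : realType) (N : nat) (k : nat) (s : bool) : config R N :=
  ngon_r (@ngon_radius R N k s) k s.

Definition ngon_loop (R : realType) (N : nat) (k : nat) (s : bool) (l : R) : loop R N :=
  fun t => confscale l (confrot (- (k%:R * t)) (@Ngon R N k s)).

(* xi(N_k^{+-}): the (unique) xi with lambda e^{-ikt} N_k^{+-} in Lambda^{D_N}_xi
   for every lambda > 0. *)
Definition xi_ngon (R : realType) (N : nat) (k : nat) (s : bool) : Xi N :=
  xget [ffun => true]
    [set xi : Xi N | forall l : R, 0 < l -> LambdaDN_xi xi (@ngon_loop R N k s l)].

Definition admissible (R : realType) (N : nat) (xi : Xi N) : set (loop R N) :=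
  [set q | LambdaDN_xi xi q /\ mean_z0 q = 0].

Definition is_minimizer (R : realType) (N : nat) (F : loop R N -> \bar R)
    (S : set (loop R N)) (q : loop R N) : Prop :=
  S q /\ forall p, S p -> (F q <= F p)%E.

(* Main.v *)
Require Import Defs.
From HB Require Import structures.
From mathcomp Require Import all_boot all_order all_algebra.
From mathcomp Require Import all_classical all_reals all_analysis.
From mathcomp Require Import measurable_realfun.
From mathcomp Require Import ring lra.
Import Order.TTheory GRing.Theory Num.Theory.
Import numFieldNormedType.Exports.
Local Open Scope classical_set_scope.
Local Open Scope ring_scope.

Set Implicit Arguments.
Unset Strict Implicit.
Unset Printing Implicit Defensive.

(* In the frame rotating with e^{ikt} the kinetic part of the action is
   1/2 int |(e^{ikt} q)'|^2, so a loop of action at most M stays, up to O(sqrt M),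
   on a rotating regular polygon of signed radius a = x_0(0); the condition
   [z_0] = 0 keeps the z-components small.  Evaluation at a point is a continuous
   functional on H^1 (represented by a hyperbolic cosine), so the signs of
   y_0(j pi / N) survive weakly in the weak closure.  If |a| is large compared to
   sqrt M these signs are those of the polygon, which gives boundedness of
   sublevels in case (a) and the sign of a in case (c).  Since the potential is at
   least a constant over |a| + O(sqrt M), small action forces |a| to be large; large
   polygons have action of order 1/|a|, hence (b) and (c).

   For (a), a minimizing sequence is bounded in H^1; a uniformly convergent
   subsequence converges weakly in H^1, the kinetic part is weakly lower
   semicontinuous, the potential part is handled by Fatou's lemma, and the weak
   closure is stable under weak limits.  The weak limit of the derivatives is
   produced by a norm-minimizing argument over nested convex sets, which replaces
   the Banach-Alaoglu theorem. *)

(** * Square-integrable functions *)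

Section L2_theory.
Context {R : realType}.
Notation mu := (@lebesgue_measure R).
Implicit Types (D E : set R) (f g h : R -> R).

(** Every H^1 function is handled through a pair [prim f g], where [g] is a square-integrable
    representative of its derivative: [derive1] agrees with [g] only almost everywhere, so each
    integral containing [derive1] is first rewritten with representatives. The two polygons of a
    given [k] are one loop [unit_ngon] with a positive or a negative coefficient [a], so that in (c)
    choosing between them means determining the sign of [a] from [xi]. The weak closure keeps only
    non-strict sign inequalities. They suffice because coprimality bounds [|sin(k j pi / N)|] below
    by some [m > 0] over the finitely many sign times, and an error below [|a| m] then decides every
    sign. In (c) the distance to the polygon is merely bounded, not small; the normalized
    configurations converge because the radius tends to infinity. In (a) a single extraction, for
    the positions, is enough: the weak limit of the derivatives is determined by the limit of the
    positions, hence the derivatives converge weakly along the same sequence. The minimizing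
    sequence itself presupposes that every [xi] is realized, which is settled by an explicit curve
    obtained from Lagrange interpolation. *)

Definition integ D f := mu.-integrable D (EFin \o f).
Definition L2 D g := measurable_fun D g /\
  (\int[mu]_(x in D) ((g x) ^+ 2)%:E < +oo)%E.

Lemma integ_meas D f : integ D f -> measurable_fun D f.
Proof. by move=> /measurable_int /measurable_EFinP. Qed.

Lemma integ_ext D f g : measurable D -> {in D, f =1 g} -> integ D f -> integ D g.
Proof.
by move=> mD fg; apply: eq_integrable => // x xD /=; rewrite fg.
Qed.

Lemma integD D f g : measurable D -> integ D f -> integ D g ->
  integ D (fun x => f x + g x).
Proof.
move=> mD fi gi; have := @integrableD _ _ _ mu D mD _ _ fi gi.
by apply: eq_integrable.
Qed.

Lemma integZ D (r : R) f : measurable D -> integ D f -> integ D (fun x => r * f x).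
Proof.
move=> mD fi; have := @integrableZl _ _ _ mu D mD r _ fi.
by apply: eq_integrable.
Qed.

Lemma integB D f g : measurable D -> integ D f -> integ D g ->
  integ D (fun x => f x - g x).
Proof.
move=> mD fi gi; have := @integrableB _ _ _ mu D mD _ _ fi gi.
by apply: eq_integrable.
Qed.

Lemma integS D E f : measurable D -> measurable E -> E `<=` D ->
  integ D f -> integ E f.
Proof. by move=> mD mE ED; apply: integrableS. Qed.

Lemma integ_abs D f : measurable D -> integ D f -> integ D (fun x => `|f x|).
Proof. by move=> mD fi; exact: integrable_norm. Qed.

Lemma integ_le D f g : measurable D -> measurable_fun D f ->
  (forall x, D x -> `|f x| <= g x) -> integ D g -> integ D f.
Proof.
move=> mD mf fg; apply: le_integrable => //; first exact/measurable_EFinP.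
move=> x Dx /=; rewrite lee_fin.
by have := fg x Dx; move=> /le_trans; apply; rewrite ler_norm.
Qed.

Lemma integ_cst D (r : R) : measurable D -> (mu D < +oo)%E -> integ D (cst r).
Proof. move=> mD Doo; apply: measurable_bounded_integrable => //.
by exists `|r|; split; [exact: normr_real|move=> x rx y _ /=; exact: ltW]. Qed.

Lemma integ_bounded D (B : R) f : measurable D -> (mu D < +oo)%E ->
  measurable_fun D f -> (forall x, D x -> `|f x| <= B) -> integ D f.
Proof.
by move=> mD Doo mf fB; apply: (integ_le mD mf fB); exact: integ_cst.
Qed.

Lemma L2_sqr D g : measurable D -> L2 D g -> integ D (fun x => g x ^+ 2).
Proof.
move=> mD [mg gi]; apply/integrableP; split.
  by apply/measurable_EFinP; exact: measurable_funX.
under eq_integral do rewrite /= ger0_norm ?sqr_ge0//.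
exact: gi.
Qed.

Lemma L2_of_sqr D g : measurable_fun D g -> integ D (fun x => g x ^+ 2) -> L2 D g.
Proof.
move=> mg /integrableP[_]; split => //.
move: b; under eq_integral do rewrite /= ger0_norm ?sqr_ge0//.
by [].
Qed.

Lemma L2_mul D f g : measurable D -> L2 D f -> L2 D g ->
  integ D (fun x => f x * g x).
Proof.
move=> mD f2 g2; have fi := L2_sqr mD f2; have gi := L2_sqr mD g2.
apply: (@integ_le _ _ (fun x => f x ^+ 2 + g x ^+ 2)) => //.
- by apply: measurable_funM; [case: f2|case: g2].
- by move=> x _; rewrite ler_norml; apply/andP; split; nra.
- exact: integD.
Qed.

Lemma L2_bounded D (B : R) f : measurable D -> (mu D < +oo)%E ->
  measurable_fun D f -> (forall x, D x -> `|f x| <= B) -> L2 D f.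
Proof.
move=> mD Doo mf fB; apply: L2_of_sqr => //.
apply: (@integ_bounded _ (B ^+ 2)) => //; first exact: measurable_funX.
by move=> x Dx; rewrite normrX lerXn2r ?nnegrE ?fB// (le_trans _ (fB x Dx)).
Qed.

Lemma L2_integ D g : measurable D -> (mu D < +oo)%E -> L2 D g -> integ D g.
Proof.
move=> mD Doo g2; apply: (@integ_ext _ (fun x => g x * cst 1 x)) => //.
  by move=> x _ /=; rewrite mulr1.
apply: L2_mul => //; apply: (@L2_bounded _ 1) => //.
by move=> x _; rewrite /= normr1.
Qed.

Lemma L2D D f g : measurable D -> L2 D f -> L2 D g -> L2 D (fun x => f x + g x).
Proof.
move=> mD f2 g2; apply: L2_of_sqr.
  by apply: measurable_funD; [case: f2|case: g2].
have fg := L2_mul mD f2 g2; have fi := L2_sqr mD f2; have gi := L2_sqr mD g2.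
have := integD mD (integD mD fi gi) (integZ 2 mD fg).
by apply: integ_ext => // x _; ring.
Qed.

Lemma L2Z D (r : R) f : measurable D -> L2 D f -> L2 D (fun x => r * f x).
Proof.
move=> mD f2; apply: L2_of_sqr.
  by apply: measurable_funM => //; case: f2.
have := integZ (r ^+ 2) mD (L2_sqr mD f2).
by apply: integ_ext => // x _; ring.
Qed.

Lemma L2_ext D f g : {in D, f =1 g} -> L2 D f -> L2 D g.
Proof.
move=> fg [mf fi]; split; first exact: eq_measurable_fun mf.
by move: fi; congr (_ < _)%E; apply: eq_integral => x xD; rewrite fg.
Qed.

Lemma L2B D f g : measurable D -> L2 D f -> L2 D g -> L2 D (fun x => f x - g x).
Proof.
move=> mD f2 g2; have := L2D mD f2 (L2Z (-1) mD g2).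
by apply: L2_ext => x _; ring.
Qed.

Lemma L2S D E f : measurable D -> measurable E -> E `<=` D -> L2 D f -> L2 E f.
Proof.
move=> mD mE ED f2; apply: L2_of_sqr.
  by apply: measurable_funS ED _ => //; case: f2.
exact: integS (L2_sqr mD f2).
Qed.

Lemma L2_mul_bounded D (B : R) f h : measurable D -> measurable_fun D h ->
  (forall x, D x -> `|h x| <= B) -> L2 D f -> L2 D (fun x => f x * h x).
Proof.
move=> mD mh hB f2; apply: L2_of_sqr.
  by apply: measurable_funM => //; case: f2.
apply: (@integ_le _ _ (fun x => B ^+ 2 * f x ^+ 2)) => //.
- by apply: measurable_funX; apply: measurable_funM => //; case: f2.
- move=> x Dx; rewrite ger0_norm ?sqr_ge0// exprMn mulrC.
  rewrite ler_wpM2r ?sqr_ge0// -[h x ^+ 2]ger0_norm ?sqr_ge0// normrX.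
  by rewrite lerXn2r ?nnegrE ?hB// (le_trans _ (hB x Dx)).
- exact: integZ (L2_sqr mD f2).
Qed.

Lemma measure_itv_lty (a b : R) (b0 b1 : bool) :
  (mu [set` Interval (BSide b0 a) (BSide b1 b)] < +oo)%E.
Proof. by rewrite lebesgue_measure_itv/=; case: ifP => //; rewrite -EFinB ltry. Qed.

Lemma Rint_cst_itv (s t r : R) : s <= t ->
  \int[mu]_(x in `[s, t]) r = r * (t - s).
Proof.
move=> st; rewrite Rintegral_cst//; have /= -> := lebesgue_measure_itv (R:=R) `[s, t].
rewrite lte_fin.
case: ltP => //= ts; have -> : t = s by apply/eqP; rewrite eq_le ts st.
by rewrite subrr.
Qed.

Lemma Rint_split (s t u : R) f : s <= t -> t <= u -> integ `[s, u] f ->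
  \int[mu]_(x in `[s, u]) f x =
  \int[mu]_(x in `[s, t]) f x + \int[mu]_(x in `[t, u]) f x.
Proof.
move=> st tu fi; have := @Rintegral_itvB R f (BLeft s) (BRight u) t fi.
rewrite !bnd_simp => /(_ st tu); rewrite Rintegral_itv_obnd_cbnd.
  by move=> <-; ring.
apply: integS fi => //; apply: subset_itvr; by rewrite bnd_simp.
Qed.

Lemma cauchy_schwarz_itv (s t : R) g : s <= t -> L2 `[s, t] g ->
  (\int[mu]_(x in `[s, t]) g x) ^+ 2 <=
  (t - s) * \int[mu]_(x in `[s, t]) (g x) ^+ 2.
Proof.
move=> st g2; set A := \int[mu]_(x in _) g x; set B := \int[mu]_(x in _) _.
have mD : measurable (`[s, t] : set R) by [].
have Doo := measure_itv_lty s t true false.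
have gi := L2_integ mD Doo g2; have g2i := L2_sqr mD g2.
have key (c : R) : 0 <= B - 2 * c * A + c ^+ 2 * (t - s).
  have : 0 <= \int[mu]_(x in `[s, t]) (g x - c) ^+ 2.
    by apply: Rintegral_ge0 => x _; exact: sqr_ge0.
  rewrite (@eq_Rintegral _ _ _ mu _ (fun x => g x ^+ 2 - (2 * c) * g x + c ^+ 2)); last first.
    by move=> x _; ring.
  rewrite RintegralD//; last 2 first.
  - by apply: integB => //; exact: integZ.
  - exact: integ_cst.
  rewrite RintegralB//; last exact: integZ.
  by rewrite RintegralZl// Rint_cst_itv.
have B0 : 0 <= B by apply: Rintegral_ge0 => x _; exact: sqr_ge0.
have [ts|ts] := eqVneq t s.
  suff -> : A = 0 by rewrite expr0n/= mulr_ge0// subr_ge0.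
  by rewrite /A ts set_itv1 Rintegral_set1.
have ts0 : 0 < t - s by rewrite subr_gt0 lt_neqAle eq_sym ts.
(* The mean value of [g] is the [c] that minimizes the quadratic in [key]. *)
have := key (A / (t - s)).
have -> : B - 2 * (A / (t - s)) * A + (A / (t - s)) ^+ 2 * (t - s) =
  B - A ^+ 2 / (t - s) by field; rewrite gt_eqF.
by rewrite subr_ge0 ler_pdivrMr// mulrC.
Qed.

End L2_theory.

(** * Primitives of square-integrable functions *)

Section null_sets.
Context d {T : measurableType d} {R : realType}.
Variable mu : {measure set T -> \bar R}.

Import HBNNSimple.

(* The integrands of the action involve [derive1], which is not known to be
   Borel measurable, so the library's [ae_eq_integral] does not apply. *)
Lemma ae_eq_integral_nomeas (D : set T) (f g : T -> \bar R) :
  {ae mu, forall x, D x -> f x = g x} ->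
  (\int[mu]_(x in D) f x = \int[mu]_(x in D) g x)%E.
Proof.
(* A simple function below [F], set to zero on the null set [A], keeps its integral and lies below
   [G], since [G] is nonnegative. The suprema that define the integrals are compared in this way in
   both directions. *)
have nn (A : set T) (F G : T -> \bar R) : measurable A -> mu A = 0%E ->
    (forall x, (0 <= G x)%E) -> (forall x, ~ A x -> F x = G x) ->
    (ereal_sup [set sintegral mu h |
       h in [set h : {nnsfun T >-> R} | forall x, ((h x)%:E <= F x)%E]] <=
     ereal_sup [set sintegral mu h |
       h in [set h : {nnsfun T >-> R} | forall x, ((h x)%:E <= G x)%E]])%E.
  move=> mA A0 G0 FG; apply: ge_ereal_sup => _ [h /= hF <-].
  have mT : measurable (setT `\` A) by exact: measurableD.
  have -> : sintegral mu h = sintegral mu (proj_nnsfun h mT).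
    transitivity (sintegral mu (h \_ (setT `\` A))); last by rewrite mrestrict.
    rewrite -(integral_nnsfun mu mT h) -integralT_nnsfun.
    apply: ge0_negligible_integral => //.
      by apply/measurable_EFinP; exact: measurable_funPT.
    by move=> x _; rewrite lee_fin fun_ge0.
  apply: ereal_sup_ubound; exists (proj_nnsfun h mT) => // x.
  rewrite -[X in (X%:E <= _)%E]/((proj_nnsfun h mT : _ -> _) x) -mrestrict patchE; case: ifPn => [|_ //].
  by rewrite inE => -[_ /FG <-]; exact: hF.
move=> [A [mA A0 AS]].
have fgA x : ~ A x -> (f \_ D) x = (g \_ D) x.
  move=> nA; rewrite !patchE; case: ifPn => //; rewrite inE => Dx.
  by apply: contrapT => fgx; apply: nA; apply: AS => /= /(_ Dx).
rewrite /integral; congr (_ - _)%E; apply/eqP; rewrite eq_le;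
  by apply/andP; split; apply: (nn A) => // x nA; rewrite ?funeposE ?funenegE fgA.
Qed.

Lemma ae_eq_Rintegral (D : set T) (f g : T -> R) :
  {ae mu, forall x, D x -> f x = g x} ->
  \int[mu]_(x in D) f x = \int[mu]_(x in D) g x.
Proof.
move=> fg; congr fine; apply: ae_eq_integral_nomeas.
have ? := ae_filter_ringOfSetsType mu.
by apply: filterS fg => x fgx Dx; rewrite fgx.
Qed.

End null_sets.

(** * Primitives on the interval from 0 to 2 pi *)

Section primitives.
Context {R : realType}.
Notation mu := (@lebesgue_measure R).
Notation II := [set` `[0%R, twopi R]].
Implicit Types (f g h : R -> R).

(** [g] is some representative of the derivative, fixed only up to null sets. Periodicity is left
    out, so that products with sines, cosines and pieces of the Green function are covered as
    well. *)
Definition prim f g := L2 II g /\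
  forall t : R, 0 <= t <= 2 * pi -> f t = f 0 + \int[mu]_(x in `[0%R, t]) g x.

Lemma H1funP f : H1fun f <->
  (forall t, f (t + 2 * pi) = f t) /\ exists g, prim f g.
Proof.
by split=> -[fp [g]]; [case=> mg [gi fg]|case=> -[mg gi] fg];
  split => //; exists g.
Qed.

Lemma twopi_gt0 : 0 < twopi R.
Proof. by rewrite /twopi mulr_gt0// pi_gt0. Qed.

Lemma mII : measurable II. Proof. by []. Qed.

Lemma IIoo : (mu II < +oo)%E. Proof. exact: measure_itv_lty. Qed.

Lemma sub_II (s t : R) : 0 <= s -> t <= twopi R -> `[s, t] `<=` II.
Proof.
move=> s0 t2 x /=; rewrite !in_itv/= => /andP[sx xt].
by rewrite (le_trans s0 sx) (le_trans xt t2).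
Qed.

Lemma L2_sub (s t : R) g : 0 <= s -> t <= twopi R -> L2 II g -> L2 `[s, t] g.
Proof. by move=> s0 t2; apply: L2S => //; exact: sub_II. Qed.

Lemma integ_sub (s t : R) g : 0 <= s -> t <= twopi R -> integ II g ->
  integ `[s, t] g.
Proof. by move=> s0 t2; apply: integS => //; exact: sub_II. Qed.

Lemma L2_integII g : L2 II g -> integ II g.
Proof. by apply: L2_integ => //; exact: IIoo. Qed.

Lemma prim_diff f g (s t : R) : prim f g -> 0 <= s -> s <= t -> t <= twopi R ->
  f t - f s = \int[mu]_(x in `[s, t]) g x.
Proof.
move=> [g2 fg] s0 st t2.
rewrite (fg t) ?(fg s) ?s0 ?(le_trans st t2) ?(le_trans s0 st)//.
rewrite (@Rint_split _ 0 s t)//; first by ring.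
by apply: integ_sub => //; exact: L2_integII.
Qed.

Lemma Rint_sqr_sub (s t : R) g : 0 <= s -> t <= twopi R -> L2 II g ->
  \int[mu]_(x in `[s, t]) g x ^+ 2 <= \int[mu]_(x in II) g x ^+ 2.
Proof.
move=> s0 t2 g2; apply: fine_le.
- by apply: integrable_fin_num => //; apply: L2_sqr => //; exact: L2_sub.
- by apply: integrable_fin_num => //; exact: L2_sqr.
- apply: ge0_subset_integral => //.
  + by apply/measurable_EFinP; case: g2 => mg _; exact: measurable_funX.
  + by move=> x _; rewrite lee_fin sqr_ge0.
  + exact: sub_II.
Qed.

(** Cauchy-Schwarz on [[s, t]]. This Hoelder bound of exponent 1/2 turns L^2 control of the
    derivative into pointwise control, both for the rigidity estimate and for equicontinuity. *)
Lemma prim_holder f g (s t : R) : prim f g -> 0 <= s -> s <= t -> t <= twopi R ->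
  (f t - f s) ^+ 2 <= (t - s) * \int[mu]_(x in II) g x ^+ 2.
Proof.
move=> pfg s0 st t2; rewrite (prim_diff pfg)//.
have g2 : L2 `[s, t] g by case: pfg => g2 _; exact: L2_sub.
apply: (le_trans (cauchy_schwarz_itv st g2)).
rewrite ler_wpM2l ?subr_ge0// Rint_sqr_sub//.
by case: pfg.
Qed.

Lemma prim_bounded f g : prim f g -> exists B, forall t, II t -> `|f t| <= B.
Proof.
move=> pfg; set G := \int[mu]_(x in II) g x ^+ 2.
have G0 : 0 <= G by apply: Rintegral_ge0 => x _; exact: sqr_ge0.
(* A square root is avoided: [y^2 <= c] implies [y <= 1 + c]. *)
exists (`|f 0| + (1 + twopi R * G)) => t /=; rewrite in_itv/= => /andP[t0 t2].
have := prim_holder pfg (lexx 0) t0 t2; rewrite -/G subr0 => H.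
have tG : t * G <= twopi R * G by rewrite ler_wpM2r.
rewrite -[f t](subrK (f 0)) addrC (le_trans (ler_normD _ _))// lerD2l.
have : `|f t - f 0| ^+ 2 <= twopi R * G.
  by rewrite -normrX ger0_norm ?sqr_ge0// (le_trans H).
have := normr_ge0 (f t - f 0); nra.
Qed.

Lemma prim_cont f g : prim f g -> {within II, continuous f}.
Proof.
move=> [g2 fg].
have c := parameterized_integral_continuous (ltW twopi_gt0) (L2_integII g2).
have cc : {within II, continuous (fun x =>
    f 0 + parameterized_integral mu 0 x g)}.
  by move=> x; apply: cvgD; [exact: cvg_cst|exact: c].
apply: subspace_eq_continuous cc => x xI.
by symmetry; apply: fg; move: xI; rewrite inE/= in_itv.
Qed.

Lemma prim_meas f g : prim f g -> measurable_fun II f.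
Proof. by move=> /prim_cont; exact: subspace_continuous_measurable_fun. Qed.

Lemma prim_L2 f g : prim f g -> L2 II f.
Proof.
move=> pfg; have [B fB] := prim_bounded pfg.
by apply: (L2_bounded mII IIoo (prim_meas pfg) fB).
Qed.

Lemma primD f1 g1 f2 g2 : prim f1 g1 -> prim f2 g2 ->
  prim (fun t => f1 t + f2 t) (fun t => g1 t + g2 t).
Proof.
move=> [g12 fg1] [g22 fg2]; split; first exact: L2D.
move=> t t2; rewrite fg1// fg2// RintegralD//; first ring.
  by case/andP: t2 => ? ?; apply: integ_sub => //; exact: L2_integII.
by case/andP: t2 => ? ?; apply: integ_sub => //; exact: L2_integII.
Qed.

Lemma primZ (r : R) f g : prim f g -> prim (fun t => r * f t) (fun t => r * g t).
Proof.
move=> [g12 fg1]; split; first exact: L2Z.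
move=> t t2; rewrite fg1// RintegralZl//; first ring.
by case/andP: t2 => ? ?; apply: integ_sub => //; exact: L2_integII.
Qed.

Lemma primB f1 g1 f2 g2 : prim f1 g1 -> prim f2 g2 ->
  prim (fun t => f1 t - f2 t) (fun t => g1 t - g2 t).
Proof.
move=> p1 p2; have := primD p1 (primZ (-1) p2).
by congr prim; apply/funext => t; ring.
Qed.

(** Lebesgue differentiation of the primitive of [g] extended by zero. The two endpoints are
    discarded, because there [f] need not coincide with this primitive on a whole neighbourhood. *)
Lemma prim_derive1_ae f g : prim f g ->
  {ae mu, forall t, II t -> derive1 f t = g t}.
Proof.
move=> [g2 fg]; have gi := L2_integII g2.
have locg : locally_integrable setT (g \_ II) by exact: integrable_locally.
have gr : mu.-integrable setT (EFin \o (g \_ II)).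
  have -> : EFin \o (g \_ II) = (EFin \o g) \_ II by rewrite restrict_EFin.
  by apply: (proj1 (@integrable_mkcond _ _ _ mu _ _ _) gi).
have gy y : mu.-integrable [set` Interval (BLeft 0) (BRight y)] (EFin \o (g \_ II)).
  exact: integrableS gr.
have := FTC1 gy locg; set F := fun x => _.
have n0 : {ae mu, forall t, t <> 0 :> R}.
  exists [set 0]; split => //; first by rewrite lebesgue_measure_set1.
  by move=> x /= /contrapT ->.
have n2 : {ae mu, forall t, t <> twopi R}.
  exists [set twopi R]; split => //; first by rewrite lebesgue_measure_set1.
  by move=> x /= /contrapT ->.
have aeF := ae_filter_ringOfSetsType mu.
move=> /= H; apply: filterS3 n0 n2 H => t t0 t2 + It.
move: (It) => /=; rewrite in_itv/= => /andP[t0' t2'].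
have {}t0 : 0 < t by rewrite lt_neqAle t0' andbT eq_sym; exact/eqP.
have {}t2 : t < twopi R by rewrite lt_neqAle t2' andbT; exact/eqP.
rewrite lte_fin => /(_ t0)[dF F'].
rewrite patchE mem_set// in F'.
have e : \forall s \near t, f s = f 0 + F s.
  near=> s; have s0 : 0 < s by near: s; exact: lt_nbhsr.
  have s2 : s < twopi R by near: s; exact: lt_nbhsl.
  rewrite fg ?(ltW s0) ?(ltW s2)//; congr (_ + _).
  apply: eq_Rintegral => x; rewrite inE/= in_itv/= => /andP[x0 xs].
  by rewrite patchE mem_set//= in_itv/= x0 (le_trans xs (ltW s2)).
rewrite derive1E (near_eq_derive _ e) deriveD//.
by rewrite derive_cst add0r -derive1E.
Unshelve. all: by end_near. Qed.

End primitives.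

(** * Product rule and the H^1 pairing *)

Section products.
Context {R : realType}.
Notation mu := (@lebesgue_measure R).
Notation II := [set` `[0%R, twopi R]].
Implicit Types (f g h : R -> R).

(** Increments of order [(t - s)^(3/2)] force constancy: bisection together with
    [(a + b)^2 <= 2 a^2 + 2 b^2] gains a factor 2 in each round, since [2 * 2 / 8 = 1 / 2]. *)
Lemma superquadratic_cst (D : R -> R) (C T : R) :
  (forall s t, 0 <= s -> s <= t -> t <= T -> (D t - D s) ^+ 2 <= C * (t - s) ^+ 3) ->
  forall t, 0 <= t -> t <= T -> D t = D 0.
Proof.
move=> DC.
have halve n : forall s t, 0 <= s -> s <= t -> t <= T ->
    (D t - D s) ^+ 2 * 2 ^+ n <= C * (t - s) ^+ 3.
  elim: n => [|n IH] s t s0 st tT; first by rewrite expr0 mulr1 DC.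
  set m := (s + t) / 2.
  have sm : s <= m by rewrite /m ler_pdivlMr//; lra.
  have mt : m <= t by rewrite /m ler_pdivrMr//; lra.
  have := IH s m s0 sm (le_trans mt tT); have := IH m t (le_trans s0 sm) mt tT.
  have -> : t - m = (t - s) / 2 by rewrite /m; field.
  have -> : m - s = (t - s) / 2 by rewrite /m; field.
  have -> : ((t - s) / 2) ^+ 3 = (t - s) ^+ 3 / 8 by field.
  have p0 : 0 < 2 ^+ n :> R by rewrite exprn_gt0.
  rewrite [2 ^+ n.+1]exprS; move: (2 ^+ n) p0 ((t - s) ^+ 3) => p p0 c H1 H2.
  have : (D t - D s) ^+ 2 <= 2 * (D t - D m) ^+ 2 + 2 * (D m - D s) ^+ 2.
    by rewrite -subr_ge0; have := sqr_ge0 (D t + D s - 2 * D m); nra.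
  by move=> /(ler_wpM2r (ltW p0)); lra.
move=> t t0 tT; apply/eqP; rewrite -subr_eq0 -sqrf_eq0; apply/eqP.
apply/le_anti; rewrite sqr_ge0 andbT leNgt; apply/negP => d0.
set d := (D t - D 0) ^+ 2 in d0; set K := C * (t - 0) ^+ 3.
have [n nK] : exists n : nat, K / d < n%:R.
  by exists (Num.bound `|K / d|); rewrite (le_lt_trans (ler_norm _))// archi_boundP.
have := halve n 0 t (lexx 0) t0 tT; rewrite -/d -/K leNgt => /negP; apply.
rewrite ltr_pdivrMr// in nK; apply: (lt_le_trans nK); rewrite mulrC ler_pM2l//.
by rewrite -natrX ler_nat ltnW// ltn_expl.
Qed.

(* For [D t = f t * h t - \int_0^t (g h + f h')] one gets
   [|D t - D s| <= C |t - s|^(3/2)]. *)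
Lemma prim_mul f g h h' (L : R) : prim f g -> prim h h' ->
  (forall t, II t -> `|h' t| <= L) ->
  prim (fun t => f t * h t) (fun t => g t * h t + f t * h' t).
Proof.
move=> pf ph hL; have [g2 fg] := pf; have [h'2 hh'] := ph.
have [Bh hB] := prim_bounded ph.
have gh2 : L2 II (fun t => g t * h t).
  by apply: L2_mul_bounded hB g2 => //; exact: prim_meas ph.
have fh2 : L2 II (fun t => f t * h' t).
  by apply: L2_mul_bounded hL (prim_L2 pf) => //; case: h'2.
have G2 := L2D mII gh2 fh2.
split => // t /andP[t0 t2].
pose D (t : R) := f t * h t - \int[mu]_(x in `[0, t]) (g x * h x + f x * h' x).
set G := \int[mu]_(x in II) g x ^+ 2.
have G0 : 0 <= G by apply: Rintegral_ge0 => x _; exact: sqr_ge0.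
suff : D t = D 0.
  rewrite /D set_itv1 Rintegral_set1 subr0 => <-; ring.
apply: (@superquadratic_cst D (4 * L ^+ 2 * G) (twopi R)) => // {t t0 t2} s t s0 st t2.
have mst : measurable [set` `[s, t]] by [].
have stoo : (mu [set` `[s, t]] < +oo)%E by exact: measure_itv_lty.
have I2 f1 : L2 II f1 -> L2 `[s, t] f1 by exact: L2_sub.
have Ii f1 : L2 II f1 -> integ `[s, t] f1.
  by move=> f12; apply: L2_integ => //; exact: I2.
have inII u : s <= u -> u <= t -> II u.
  by move=> su ut; rewrite /= in_itv/= (le_trans s0 su) (le_trans ut t2).
(* Writing [f t * h t - f s * h s] as [h t * (f t - f s) + f s * (h t - h s)] leaves two integrands
   with a small factor: [h t - h u] is of order [t - s], and [f u - f s] of order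
   [(t - s)^(1/2)]. *)
have DE : D t - D s = \int[mu]_(u in `[s, t]) (g u * (h t - h u)) -
                     \int[mu]_(u in `[s, t]) ((f u - f s) * h' u).
  rewrite /D (@Rint_split _ 0 s t)//; last first.
    by apply: integ_sub => //; exact: L2_integII.
  rewrite (@eq_Rintegral _ _ _ mu _ (fun u => h t * g u - g u * h u)
     (fun u => g u * (h t - h u))); last by move=> u _; ring.
  rewrite (@eq_Rintegral _ _ _ mu _ (fun u => f u * h' u - f s * h' u)
     (fun u => (f u - f s) * h' u)); last by move=> u _; ring.
  rewrite !RintegralB ?RintegralD ?RintegralZl//;
    try first [by apply: Ii | by apply: integZ => //; apply: Ii |
      by apply: integ_sub => //; [exact: le_trans t2|exact: L2_integII]].
  rewrite -(prim_diff pf s0 st t2) -(prim_diff ph s0 st t2); ring.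
have hlip u : s <= u -> u <= t -> (h t - h u) ^+ 2 <= L ^+ 2 * (t - s) ^+ 2.
  move=> su ut; rewrite -[leLHS]ger0_norm ?sqr_ge0// normrX -exprMn.
  have L0 : 0 <= L by apply: le_trans (hL u _); [exact: normr_ge0|exact: inII].
  apply: lerXn2r; rewrite ?nnegrE ?mulr_ge0 ?subr_ge0//.
  rewrite (prim_diff ph (le_trans s0 su) ut t2).
  have ui : integ `[u, t] h'.
    by apply: integ_sub => //; [exact: le_trans su|exact: L2_integII].
  apply: (le_trans (le_normr_Rintegral _ ui)) => //.
  apply: (@le_trans _ _ (\int[mu]_(x in `[u, t]) L)).
    apply: le_Rintegral => //; first exact: integ_abs.
      by apply: integ_cst => //; exact: measure_itv_lty.
    move=> x /=; rewrite in_itv/= => /andP[ux xt]; apply: hL.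
    by apply: inII => //; exact: le_trans ux.
  by rewrite Rint_cst_itv// ler_wpM2l// lerD2l lerN2.
have A1 : (\int[mu]_(u in `[s, t]) (g u * (h t - h u))) ^+ 2 <=
          L ^+ 2 * G * (t - s) ^+ 3.
  have w2 : L2 `[s, t] (fun u => g u * (h t - h u)).
    have : L2 `[s, t] (fun u => h t * g u - g u * h u).
      by apply: L2B => //; [apply: L2Z => //; exact: I2|exact: I2].
    by apply: L2_ext => u _; ring.
  apply: (le_trans (cauchy_schwarz_itv st w2)).
  have -> : L ^+ 2 * G * (t - s) ^+ 3 = (t - s) * ((L ^+ 2 * (t - s) ^+ 2) * G) by ring.
  rewrite ler_wpM2l ?subr_ge0//.
  apply: (@le_trans _ _ (\int[mu]_(u in `[s, t]) ((L ^+ 2 * (t - s) ^+ 2) * g u ^+ 2))).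
    apply: le_Rintegral => //; first exact: L2_sqr.
      by apply: integZ => //; apply: L2_sqr => //; exact: I2.
    move=> u /=; rewrite in_itv/= => /andP[su ut].
    by rewrite exprMn mulrC ler_wpM2r ?sqr_ge0// hlip.
  rewrite RintegralZl//; last by apply: L2_sqr => //; exact: I2.
  by apply: ler_wpM2l; [rewrite mulr_ge0 ?sqr_ge0|exact: Rint_sqr_sub].
have A2 : (\int[mu]_(u in `[s, t]) ((f u - f s) * h' u)) ^+ 2 <=
          L ^+ 2 * G * (t - s) ^+ 3.
  have w2 : L2 `[s, t] (fun u => (f u - f s) * h' u).
    have : L2 `[s, t] (fun u => f u * h' u - f s * h' u).
      by apply: L2B => //; [exact: I2|apply: L2Z => //; exact: I2].
    by apply: L2_ext => u _; ring.
  apply: (le_trans (cauchy_schwarz_itv st w2)).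
  have -> : L ^+ 2 * G * (t - s) ^+ 3 =
     (t - s) * (((t - s) * G * L ^+ 2) * (t - s)) by ring.
  rewrite ler_wpM2l ?subr_ge0// -Rint_cst_itv//.
  apply: le_Rintegral => //; [exact: L2_sqr|exact: integ_cst|].
  move=> u /=; rewrite in_itv/= => /andP[su ut]; rewrite exprMn.
  have h1 : h' u ^+ 2 <= L ^+ 2.
    have /hL := inII u su ut; rewrite -[leLHS]ger0_norm// => hu.
    rewrite -[X in X <= _]ger0_norm ?sqr_ge0// normrX.
    by apply: lerXn2r; rewrite ?nnegrE ?(le_trans _ hu)// (le_trans (ler_norm _)).
  have h2 : (f u - f s) ^+ 2 <= (t - s) * G.
    apply: (le_trans (prim_holder pf s0 su (le_trans ut t2))).
    by rewrite ler_wpM2r// lerD2r.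
  apply: ler_pM => //; exact: sqr_ge0.
rewrite DE; move: A1 A2; set a := Rintegral _ _ _; set b := Rintegral _ _ _.
have := sqr_ge0 (a + b); nra.
Qed.

Lemma Rint_FTC F f (a b : R) : a <= b ->
  (forall t : R, is_derive t (1 : R) F (f t)) -> continuous f ->
  \int[mu]_(x in `[a, b]) f x = F b - F a.
Proof.
move=> ab dF cf; have [->|ba] := eqVneq b a.
  by rewrite set_itv1 Rintegral_set1 subrr.
have {}ab : a < b by rewrite lt_neqAle eq_sym ba.
have cF (x : R) : {for x, continuous F}.
  by apply: differentiable_continuous; apply/derivable1_diffP; case: (dF x).
rewrite /Rintegral (@continuous_FTC2 _ f F)//.
- exact: continuous_subspaceT.
- split.
  + by move=> x _; case: (dF x).
  + by apply: cvg_at_right_filter; exact: cF.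
  + by apply: cvg_at_left_filter; exact: cF.
- by move=> x _; rewrite derive1E; case: (dF x).
Qed.

Lemma continuous_boundedII f : continuous f -> exists B, forall t, II t -> `|f t| <= B.
Proof.
move=> cf; have cn : {within II, continuous (fun t => `|f t|)}.
  by apply: continuous_subspaceT => x; apply: continuous_comp;
    [exact: cf|exact: norm_continuous].
have [c cII cmax] := EVT_max (ltW twopi_gt0) cn.
by exists `|f c| => t tI; exact: cmax.
Qed.

Lemma continuous_L2 f : continuous f -> L2 II f.
Proof.
move=> cf; have [B fB] := continuous_boundedII cf.
apply: (L2_bounded mII IIoo _ fB); exact: measurable_funTS (continuous_measurable_fun cf).
Qed.

Lemma prim_C1 F f : (forall t : R, is_derive t (1 : R) F (f t)) -> continuous f ->
  prim F f.
Proof.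
move=> dF cf; split; first exact: continuous_L2.
by move=> t /andP[t0 t2]; rewrite (Rint_FTC t0 dF cf); ring.
Qed.

Lemma prim_uniq f g1 g2 : prim f g1 -> prim f g2 ->
  {ae mu, forall t, II t -> g1 t = g2 t}.
Proof.
move=> /prim_derive1_ae p1 /prim_derive1_ae p2.
have ? := ae_filter_ringOfSetsType mu.
by apply: filterS2 p1 p2 => t h1 h2 It; rewrite -h1// h2.
Qed.

Lemma Rint_H1_pairing p gp v gv : prim p gp -> prim v gv ->
  \int[mu]_(t in II) (p t * v t + derive1 p t * derive1 v t) =
  \int[mu]_(t in II) (p t * v t) + \int[mu]_(t in II) (gp t * gv t).
Proof.
move=> pp pv; rewrite -RintegralD//; last 2 first.
- by apply: L2_mul => //; [exact: prim_L2 pp|exact: prim_L2 pv].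
- by apply: L2_mul => //; [case: pp|case: pv].
apply: ae_eq_Rintegral; have ? := ae_filter_ringOfSetsType mu.
apply: filterS2 (prim_derive1_ae pp) (prim_derive1_ae pv) => t h1 h2 It.
by rewrite h1// h2.
Qed.

End products.

(** * Point evaluation in H^1 of the circle *)

Section periodic_functions.
Context {R : realType}.
Notation mu := (@lebesgue_measure R).
Notation II := [set` `[0%R, twopi R]].
Implicit Types (f g h : R -> R).

Definition mod2pi (t : R) : R := t - twopi R * (Num.floor (t / twopi R))%:~R.

Lemma mod2pi_itv t : 0 <= mod2pi t < twopi R.
Proof.
rewrite /mod2pi; have T0 := @twopi_gt0 R.
have /andP[] := floor_itv (t / twopi R); rewrite ler_pdivlMr// ltr_pdivrMr//.
rewrite intrD mulrDl mul1r [twopi R * _]mulrC => h1 h2.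
by apply/andP; split; lra.
Qed.

Lemma mod2pi_II t : II (mod2pi t).
Proof. by have /andP[h1 h2] := mod2pi_itv t; rewrite /= in_itv/= h1 ltW. Qed.

Lemma periodic_int f (m : int) : (forall t, f (t + 2 * pi) = f t) ->
  forall t, f (t + twopi R * m%:~R) = f t.
Proof.
move=> fp; have fn (n : nat) t : f (t + twopi R * n%:R) = f t.
  elim: n t => [|n IH] t; first by rewrite mulr0 addr0.
  by rewrite -[RHS](IH t) -[RHS]fp; congr f; rewrite /twopi -natr1; ring.
case: m => n t; first exact: fn.
rewrite NegzE -[in RHS](subrK (twopi R * n.+1%:R) t) fn.
by congr f; rewrite mulrNz -pmulrn; ring.
Qed.

Lemma mod2piE f t : (forall t, f (t + 2 * pi) = f t) -> f (mod2pi t) = f t.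
Proof.
by move=> fp; rewrite -[RHS](periodic_int (- Num.floor (t / twopi R)) fp) /mod2pi mulrNz mulrN.
Qed.

Lemma mod2piD t : mod2pi (t + 2 * pi) = mod2pi t.
Proof.
rewrite /mod2pi -/(twopi R) mulrDl divff ?gt_eqF ?twopi_gt0//.
by rewrite floorDrz ?floor1 ?intr1// intrD; ring.
Qed.

Lemma mod2pi_id t : 0 <= t < twopi R -> mod2pi t = t.
Proof.
move=> /andP[t0 t2]; rewrite /mod2pi (@floor_def _ _ 0); first by rewrite mulr0 subr0.
by rewrite add0r divr_ge0 ?(ltW twopi_gt0)// ltr_pdivrMr ?twopi_gt0// mul1r.
Qed.

Lemma mod2pi_2pi : mod2pi (twopi R) = 0.
Proof.
have := mod2piD 0; rewrite add0r -/(twopi R) => ->.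
by apply: mod2pi_id; rewrite lexx twopi_gt0.
Qed.

(** [mod2pi] sends [2 pi] to [0], so agreement at the endpoints is what keeps the periodic extension
    a primitive of [g] on the closed interval. *)
Lemma H1fun_periodize f g : f 0 = f (twopi R) -> prim f g ->
  H1fun (f \o mod2pi) /\ prim (f \o mod2pi) g.
Proof.
move=> f02 [g2 fg].
have E t : 0 <= t <= twopi R -> f (mod2pi t) = f t.
  move=> /andP[t0]; rewrite le_eqVlt => /predU1P[->|t2].
    by rewrite mod2pi_2pi.
  by rewrite mod2pi_id ?t0.
have p : prim (f \o mod2pi) g.
  split => // t tI; rewrite /= !E//; first exact: fg.
  by rewrite lexx ltW// twopi_gt0.
split => //; apply/H1funP; split; last by exists g.
by move=> t /=; rewrite mod2piD.
Qed.

Lemma is_derive_affine F f (a b t : R) : (forall x : R, is_derive x (1 : R) F (f x)) ->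
  is_derive t (1 : R) (fun t => F (a + b * t)) (b * f (a + b * t)).
Proof.
move=> dF; have h : is_derive t (1 : R) (fun t : R => a + b * t) b.
  by apply: is_derive_eq; rewrite add0r mul1r /GRing.scale/= mulr1.
by rewrite mulrC; exact: (is_derive1_comp (dF _) h).
Qed.

Lemma is_derive_continuous F f : (forall x : R, is_derive x (1 : R) F (f x)) ->
  continuous F.
Proof.
move=> dF x; apply: differentiable_continuous; apply/derivable1_diffP.
by case: (dF x).
Qed.

Lemma continuous_affine (F : R -> R) (a b : R) :
  continuous F -> continuous (fun t => F (a + b * t)).
Proof.
move=> cF x; apply: (@continuous_comp _ _ _ (fun t => a + b * t) F); last exact: cF.
by apply: cvgD; [exact: cvg_cst|apply: cvgM; [exact: cvg_cst|exact: cvg_id]].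
Qed.

Definition ch (x : R) : R := 2^-1 * (expR x + expR (- x)).
Definition sh (x : R) : R := 2^-1 * (expR x - expR (- x)).

Lemma is_derive_expRN (x : R) : is_derive x (1 : R) (fun x => expR (- x)) (- expR (- x)).
Proof.
have := is_derive_affine 0 (-1) x (@is_derive_expR R).
rewrite add0r !mulN1r; congr (is_derive _ _ _ _).
by apply/funext => y; rewrite add0r mulN1r.
Qed.

Lemma is_derive_ch x : is_derive x (1 : R) ch (sh x).
Proof.
have h := is_derive_expRN x.
by apply: is_derive_eq; rewrite /GRing.scale/= /sh.
Qed.

Lemma is_derive_sh x : is_derive x (1 : R) sh (ch x).
Proof.
have h := is_derive_expRN x.
by apply: is_derive_eq; rewrite /GRing.scale/= /ch opprK.
Qed.

Lemma sh_pi_gt0 : 0 < sh pi.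
Proof.
rewrite /sh mulr_gt0// subr_gt0 ltr_expR; have := pi_gt0 R; lra.
Qed.

Section green.
Variable t0 : R.
Hypothesis t0I : 0 < t0 < twopi R.

(** This is [cosh(pi - |t - t0|)], a multiple of the Green function of [1 - d^2/dt^2] on the circle.
    The arguments have the shape [a + b * t] required by [is_derive_affine]. *)
Definition green_raw (t : R) : R :=
  if t <= t0 then ch (pi - t0 + 1 * t) else ch (pi + t0 + (-1) * t).
Definition green_diff (t : R) : R :=
  if t <= t0 then sh (pi - t0 + 1 * t) else - sh (pi + t0 + (-1) * t).

Let c_ch : continuous ch := is_derive_continuous is_derive_ch.
Let c_sh : continuous sh := is_derive_continuous is_derive_sh.

Let left_prim : prim (fun t => ch (pi - t0 + 1 * t)) (fun t => sh (pi - t0 + 1 * t)).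
Proof.
apply: prim_C1; last exact: continuous_affine.
by move=> t; rewrite -[sh _]mul1r; apply: is_derive_affine; exact: is_derive_ch.
Qed.

Let right_prim : prim (fun t => ch (pi + t0 + (-1) * t)) (fun t => - sh (pi + t0 + (-1) * t)).
Proof.
apply: prim_C1; last by move=> x; apply: cvgN; exact: continuous_affine.
by move=> t; rewrite -[- sh _]mulN1r; apply: is_derive_affine; exact: is_derive_ch.
Qed.

Let left_int t f1 f2 : t <= t0 ->
  \int[mu]_(x in `[0, t]) (if x <= t0 then f1 x else f2 x) =
  \int[mu]_(x in `[0, t]) f1 x.
Proof.
move=> tt0; apply: eq_Rintegral => x; rewrite inE/= in_itv/= => /andP[_ xt].
by rewrite (le_trans xt tt0).
Qed.

Let if_L2 f1 f2 : L2 II f1 -> L2 II f2 -> L2 II (fun x => if x <= t0 then f1 x else f2 x).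
Proof.
move=> [m1 f12] [m2 f22].
have mif : measurable_fun II (fun x => if x <= t0 then f1 x else f2 x).
  apply: measurable_fun_if => //.
  - by apply: measurable_fun_ler.
  - by apply: measurable_funS m1 => // x [].
  - by apply: measurable_funS m2 => // x [].
apply: L2_of_sqr => //.
apply: (@integ_le _ _ _ (fun x => f1 x ^+ 2 + f2 x ^+ 2)) => //.
- exact: measurable_funX.
- move=> x _; rewrite ger0_norm ?sqr_ge0//.
  by case: ifP => _; rewrite ?lerDl ?lerDr sqr_ge0.
- by apply: integD => //; apply: L2_sqr.
Qed.

Let right_int t f1 f2 : t0 <= t -> t <= twopi R -> L2 II f1 -> L2 II f2 ->
  \int[mu]_(x in `[t0, t]) (if x <= t0 then f1 x else f2 x) =
  \int[mu]_(x in `[t0, t]) f2 x.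
Proof.
case/andP: t0I => t00 t02 tt0 t2 h1 h2.
have i1 : integ `[t0, t] (fun x => if x <= t0 then f1 x else f2 x).
  by apply: integ_sub => //; [exact: ltW|apply: L2_integII; exact: if_L2].
have i2 : integ `[t0, t] f2.
  by apply: integ_sub => //; [exact: ltW|exact: L2_integII].
have sub : [set` `]t0, t]] `<=` [set` `[t0, t]] by apply: subset_itvr; rewrite bnd_simp.
rewrite -Rintegral_itv_obnd_cbnd; last exact: integS i1.
rewrite -[RHS]Rintegral_itv_obnd_cbnd; last exact: integS i2.
apply: eq_Rintegral => x; rewrite inE/= in_itv/= => /andP[tx _].
by rewrite leNgt tx.
Qed.

Lemma prim_green_raw : prim green_raw green_diff.
Proof.
case/andP: t0I => t00 t02.
have [lL2 lE] := left_prim; have [rL2 rE] := right_prim.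
split => [|t /andP[t0' t2]]; first exact: if_L2.
have e0 : green_raw 0 = ch (pi - t0 + 1 * 0) by rewrite /green_raw (ltW t00).
rewrite e0; have [tt0|tt0] := leP t t0.
  by rewrite left_int// /green_raw tt0 [LHS]lE ?t0'.
rewrite (@Rint_split _ 0 t0 t) ?(ltW t00) ?(ltW tt0)//; last first.
  by apply: integ_sub => //; apply: L2_integII; exact: if_L2.
rewrite left_int// right_int ?(ltW tt0)//.
rewrite addrA -lE ?(ltW t00) ?(ltW t02)//.
rewrite -(prim_diff right_prim) ?(ltW t00) ?(ltW tt0)//.
have -> : ch (pi - t0 + 1 * t0) = ch (pi + t0 + -1 * t0).
  by congr ch; ring.
by rewrite /green_raw leNgt tt0/=; ring.
Qed.

Definition green := green_raw \o mod2pi.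

Lemma green_H1 : H1fun green /\ prim green green_diff.
Proof.
apply: H1fun_periodize; last exact: prim_green_raw.
case/andP: t0I => t00 t02; rewrite /green_raw (ltW t00) leNgt t02/=.
have -> : pi + t0 + -1 * twopi R = - (pi - t0 + 1 * 0) by rewrite /twopi; ring.
by rewrite /ch opprK addrC.
Qed.

(* [green] solves [v - v'' = 2 sinh(pi) delta_t0] on the circle. *)
Lemma green_eval p gp : (forall t, p (t + 2 * pi) = p t) -> prim p gp ->
  \int[mu]_(t in II) (p t * green t + derive1 p t * derive1 green t) =
  2 * sh pi * p t0.
Proof.
move=> pper pp; have [_ pg] := green_H1; case/andP: t0I => t00 t02.
rewrite (Rint_H1_pairing pp pg).
have [gp2 _] := pp; have p2 := prim_L2 pp; have [gd2 _] := pg.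
have g2 := prim_L2 pg.
have shl : prim (fun t => sh (pi - t0 + 1 * t)) (fun t => ch (pi - t0 + 1 * t)).
  apply: prim_C1; last exact: continuous_affine.
  by move=> t; rewrite -[ch _]mul1r; apply: is_derive_affine; exact: is_derive_sh.
have shr : prim (fun t => - sh (pi + t0 + (-1) * t)) (fun t => ch (pi + t0 + (-1) * t)).
  have : prim (fun t => (-1) * sh (pi + t0 + (-1) * t))
              (fun t => (-1) * ((-1) * ch (pi + t0 + (-1) * t))).
    apply: primZ; apply: prim_C1.
      by move=> t; apply: is_derive_affine; exact: is_derive_sh.
    by move=> x; apply: cvgM; [exact: cvg_cst|exact: continuous_affine].
  by congr prim; apply/funext => t; ring.
have [Bl hBl] := continuous_boundedII (continuous_affine (a := pi - t0) (b := 1) c_ch).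
have [Br hBr] := continuous_boundedII (continuous_affine (a := pi + t0) (b := -1) c_ch).
(* On either side of [t0] one has [green'' = green], hence [p green + p' green'] is the derivative
   of [p green']. The jump of [green'] at [t0] produces [2 sinh(pi) p(t0)], and the terms at [0] and
   [2 pi] cancel by periodicity. *)
have pl := prim_mul pp shl hBl; have pr := prim_mul pp shr hBr.
rewrite -RintegralD//; last 2 first.
- exact: L2_mul.
- exact: L2_mul.
have := prim_diff pl (lexx 0) (ltW t00) (ltW t02).
have := prim_diff pr (ltW t00) (ltW t02) (lexx _).
rewrite (_ : p (twopi R) = p 0); last by rewrite -[RHS]pper add0r.
have -> : sh (pi + t0 + -1 * twopi R) = - sh (pi - t0 + 1 * 0).
  rewrite /sh; have -> : pi + t0 + -1 * twopi R = - (pi - t0 + 1 * 0).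
    by rewrite /twopi; ring.
  by rewrite opprK; ring.
have -> : sh (pi + t0 + -1 * t0) = sh pi by congr sh; ring.
have -> : sh (pi - t0 + 1 * t0) = sh pi by congr sh; ring.
move=> hr hl.
have itot : integ II (fun t => p t * green t + gp t * green_diff t).
  by apply: integD => //; exact: L2_mul.
rewrite (@Rint_split _ 0 t0 (twopi R)) ?(ltW t00) ?(ltW t02)//.
pose fl t := gp t * sh (pi - t0 + 1 * t) + p t * ch (pi - t0 + 1 * t).
pose fr t := gp t * - sh (pi + t0 + -1 * t) + p t * ch (pi + t0 + -1 * t).
have FE t : II t -> p t * green t + gp t * green_diff t = if t <= t0 then fl t else fr t.
  move=> It; have -> : green t = green_raw t.
    rewrite /green /=; move: It; rewrite /= in_itv/= => /andP[t0' t2].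
    move: t2; rewrite le_eqVlt => /predU1P[->|t2]; last by rewrite mod2pi_id ?t0'.
    rewrite mod2pi_2pi /green_raw (ltW t00) leNgt t02/=.
    have -> : pi + t0 + -1 * twopi R = - (pi - t0 + 1 * 0) by rewrite /twopi; ring.
    by rewrite /ch opprK addrC.
  rewrite /green_raw /green_diff /fl /fr; case: ifP => _; ring.
have E1 : \int[mu]_(x in `[0, t0]) (p x * green x + gp x * green_diff x) =
          \int[mu]_(x in `[0, t0]) (if x <= t0 then fl x else fr x).
  apply: eq_Rintegral => x; rewrite inE => /(sub_II (lexx 0) (ltW t02)); exact: FE.
have E2 : \int[mu]_(x in `[t0, twopi R]) (p x * green x + gp x * green_diff x) =
          \int[mu]_(x in `[t0, twopi R]) (if x <= t0 then fl x else fr x).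
  apply: eq_Rintegral => x; rewrite inE => /(sub_II (ltW t00) (lexx _)); exact: FE.
have [fl2 _] := pl; have [fr2 _] := pr.
rewrite E1 E2 left_int// right_int ?(ltW t02)// -/fl -/fr -hl -hr; ring.
Qed.

End green.

End periodic_functions.

(** * Loops and their action *)

Section loops.
Context {R : realType}.
Notation mu := (@lebesgue_measure R).
Notation II := [set` `[0%R, twopi R]].
Variable N : nat.
Implicit Types (q p v : loop R N) (g : 'I_N -> 'I_3 -> R -> R).

Lemma bodyE (c : config R N) (i : 'I_N) a : body c i a = c i a.
Proof. by rewrite /body valK. Qed.

Definition prims q g := forall i a, prim (fun t => q t i a) (g i a).

Lemma is_loop_prims q : is_loop q -> exists g, prims q g.
Proof.
move=> ql; have /choice[g gP] (ia : 'I_N * 'I_3) :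
    exists f, prim (fun t => q t ia.1 ia.2) f.
  by have /H1funP[_] := ql ia.1 ia.2.
by exists (fun i a => g (i, a)) => i a; exact: (gP (i, a)).
Qed.

Lemma loop_periodic q : is_loop q -> forall t i a, q (t + 2 * pi) i a = q t i a.
Proof. by move=> ql t i a; have /H1funP[->] := ql i a. Qed.

Lemma prims_loop q g : (forall t i a, q (t + 2 * pi) i a = q t i a) ->
  prims q g -> is_loop q.
Proof.
by move=> qp pg i a; apply/H1funP; split => [t|]; [exact: qp|exists (g i a)].
Qed.

Lemma primsB q gq p gp : prims q gq -> prims p gp ->
  prims (fun t => confsub (q t) (p t)) (fun i a t => gq i a t - gp i a t).
Proof. by move=> pq pp i a; exact: primB. Qed.

Lemma is_loopB q p : is_loop q -> is_loop p -> is_loop (fun t => confsub (q t) (p t)).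
Proof.
move=> ql pl; have [gq pq] := is_loop_prims ql; have [gp pp] := is_loop_prims pl.
apply: prims_loop (primsB pq pp) => t i a.
by rewrite /confsub !loop_periodic.
Qed.

Lemma H1innerE p gp v gv : prims p gp -> prims v gv ->
  H1inner p v = \sum_(i < N) \sum_(a < 3)
    (\int[mu]_(t in II) (p t i a * v t i a) +
     \int[mu]_(t in II) (gp i a t * gv i a t)).
Proof.
move=> pp pv; apply: eq_bigr => i _; apply: eq_bigr => a _.
exact: Rint_H1_pairing.
Qed.

(** The kinetic density of the action with the derivatives replaced by representatives; unlike the
    original it is visibly measurable and integrable. *)
Definition kin (w : R) q g (t : R) : R := 2^-1 * \sum_(i < N)
  ((g i cx t - w * q t i cy) ^+ 2 + (g i cy t + w * q t i cx) ^+ 2 + g i cz t ^+ 2).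

Lemma L2_prim q g i a : prims q g -> L2 II (g i a).
Proof. by move=> pg; case: (pg i a). Qed.

Lemma L2_coord q g i a : prims q g -> L2 II (fun t => q t i a).
Proof. by move=> pg; exact: prim_L2 (pg i a). Qed.

Lemma L2_rotx w q g i : prims q g -> L2 II (fun t => g i cx t - w * q t i cy).
Proof.
move=> pg; apply: L2B => //; first exact: L2_prim.
by apply: L2Z => //; exact: L2_coord pg.
Qed.

Lemma L2_roty w q g i : prims q g -> L2 II (fun t => g i cy t + w * q t i cx).
Proof.
move=> pg; apply: L2D => //; first exact: L2_prim.
by apply: L2Z => //; exact: L2_coord pg.
Qed.

Lemma integ_sum (I : Type) (s : seq I) (P : pred I) (F : I -> R -> R) :
  (forall i, integ II (F i)) -> integ II (fun t => \sum_(i <- s | P i) F i t).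
Proof.
move=> Fi; elim: s => [|i s IH].
  apply: (@integ_ext _ _ (cst 0)) => //; first by move=> x _; rewrite big_nil.
  by apply: integ_cst => //; exact: IIoo.
have [Pi|Pi] := boolP (P i); last first.
  by apply: integ_ext IH => // x _; rewrite big_cons (negbTE Pi).
by apply: integ_ext (integD mII (Fi i) IH) => // x _; rewrite big_cons Pi.
Qed.

Lemma Rint_sum (I : Type) (s : seq I) (P : pred I) (F : I -> R -> R) :
  (forall i, integ II (F i)) ->
  \int[mu]_(t in II) (\sum_(i <- s | P i) F i t) =
  \sum_(i <- s | P i) \int[mu]_(t in II) F i t.
Proof.
move=> Fi; elim: s => [|i s IH].
  rewrite big_nil (@eq_Rintegral _ _ _ mu _ (cst 0)).
    by rewrite Rintegral_cst// mul0r.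
  by move=> x _; rewrite big_nil.
rewrite big_cons; case: ifPn => Pi; last first.
  by rewrite -IH; apply: eq_Rintegral => x _; rewrite big_cons (negbTE Pi).
rewrite -IH -RintegralD//; [|exact: Fi|exact: integ_sum].
by apply: eq_Rintegral => x _; rewrite big_cons Pi.
Qed.

Lemma integ_kin w q g : prims q g -> integ II (kin w q g).
Proof.
move=> pg; apply: integZ => //; apply: integ_sum => i.
apply: integD => //; last by apply: L2_sqr => //; exact: L2_prim pg.
by apply: integD => //; apply: L2_sqr => //; [exact: L2_rotx|exact: L2_roty].
Qed.

Lemma Rint_kin w q g : prims q g ->
  \int[mu]_(t in II) kin w q g t = 2^-1 * \sum_(i < N)
    (\int[mu]_(t in II) (g i cx t - w * q t i cy) ^+ 2 +
     \int[mu]_(t in II) (g i cy t + w * q t i cx) ^+ 2 +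
     \int[mu]_(t in II) (g i cz t) ^+ 2).
Proof.
move=> pg.
have ix i : integ II (fun t => (g i cx t - w * q t i cy) ^+ 2).
  by apply: L2_sqr => //; exact: L2_rotx.
have iy i : integ II (fun t => (g i cy t + w * q t i cx) ^+ 2).
  by apply: L2_sqr => //; exact: L2_roty.
have iz i : integ II (fun t => (g i cz t) ^+ 2).
  by apply: L2_sqr => //; exact: L2_prim pg.
have i2 i := integD mII (ix i) (iy i).
have i3 i := integD mII (i2 i) (iz i).
rewrite RintegralZl//; last exact: integ_sum.
rewrite Rint_sum//; congr (_ * _); apply: eq_bigr => i _.
rewrite RintegralD ?RintegralD//; [exact: ix|exact: iy|exact: i2|exact: iz].
Qed.

Lemma kin_ge0 w q g t : 0 <= kin w q g t.
Proof.
rewrite mulr_ge0 ?invr_ge0// sumr_ge0// => i _.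
by rewrite !addr_ge0 ?sqr_ge0.
Qed.

Lemma measurable_invr : measurable_fun setT (@GRing.inv R).
Proof.
have m0 : measurable [set~ (0 : R)] by exact: measurableC.
have -> : [set: R] = [set 0] `|` [set~ 0] by rewrite setUv.
apply/measurable_funU => //; split; first exact: measurable_fun_set1.
apply: open_continuous_measurable_fun => //.
  by rewrite openC; exact: closed_eq.
by move=> x; rewrite inE => /= /eqP x0; exact: inv_continuous.
Qed.

(** The pair potential as an extended real function of the distance. The value [+oo] at collisions
    makes it continuous on nonnegative distances ([invd_cvg]), as needed to pass to the limit in
    [potU]. *)
Definition invd (d : R) : \bar R := if d == 0 then +oo%E else (d^-1)%:E.

Lemma measurable_invd : measurable_fun setT invd.
Proof.
apply: measurable_fun_ifT => //; first by apply: measurable_fun_eqr.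
by apply/measurable_EFinP; exact: measurable_invr.
Qed.

Lemma invd_ge0 d : 0 <= d -> (0 <= invd d)%E.
Proof. by move=> d0; rewrite /invd; case: ifP => // _; rewrite lee_fin invr_ge0. Qed.

Lemma bdist_ge0 (c : config R N) i j : 0 <= bdist c i j.
Proof. exact: sqrtr_ge0. Qed.

Lemma potUE (c : config R N) :
  (potU c = \sum_(i < N) \sum_(j < N | (i < j)%N) invd (bdist c i j))%E.
Proof. by []. Qed.

Lemma potU_ge0 (c : config R N) : (0 <= potU c)%E.
Proof.
by rewrite potUE; apply: sume_ge0 => i _; apply: sume_ge0 => j _;
  apply: invd_ge0; exact: bdist_ge0.
Qed.

Lemma measurable_bdist q i j : is_loop q ->
  measurable_fun II (fun t => bdist (q t) i j).
Proof.
move=> ql; have [g pg] := is_loop_prims ql.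
apply: (@measurableT_comp _ _ _ _ _ _ (@Num.sqrt R)).
  by apply: continuous_measurable_fun; exact: sqrt_continuous.
apply: measurable_sum => a; apply: measurable_funX; apply: measurable_funB.
  by case: (L2_coord i a pg).
by case: (L2_coord j a pg).
Qed.

Lemma measurable_potU q : is_loop q -> measurable_fun II (fun t => potU (q t)).
Proof.
move=> ql; apply: emeasurable_sum => i.
rewrite [X in measurable_fun _ X](_ : _ = fun t =>
   \sum_(j < N) (if (i < j)%N then invd (bdist (q t) i j) else 0))%E; last first.
  by apply/funext => t; rewrite big_mkcond.
apply: emeasurable_sum => j; case ij : (i < j)%N => //.
apply: (@measurableT_comp _ _ _ _ _ _ invd); first exact: measurable_invd.
exact: measurable_bdist.
Qed.

(** The kinetic part is finite because coordinates and representatives lie in L^2; it may therefore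
    be split off, and later subtracted, even when the potential part is infinite. *)
Lemma actionE w q g : is_loop q -> prims q g ->
  (action w (twopi R) q = (\int[mu]_(t in II) kin w q g t)%R%:E +
    \int[mu]_(t in II) potU (q t))%E.
Proof.
move=> ql pg; have kf : (\int[mu]_(t in II) (kin w q g t)%:E)%E \is a fin_num.
  by apply: integrable_fin_num => //; exact: integ_kin.
rewrite /Rintegral fineK//; rewrite -ge0_integralD//; last 4 first.
- by move=> t _; rewrite lee_fin kin_ge0.
- by apply/measurable_EFinP; apply: integ_meas; exact: integ_kin.
- by move=> t _; exact: potU_ge0.
- exact: measurable_potU.
apply: ae_eq_integral_nomeas; have F := ae_filter_ringOfSetsType mu.
have : {ae mu, forall t, forall ia : 'I_N * 'I_3, II t -> dq q t ia.1 ia.2 = g ia.1 ia.2 t}.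
  apply: filter_forall => ia; exact: prim_derive1_ae (pg ia.1 ia.2).
apply: filterS => t dqE It; congr (_%:E + _)%E; rewrite /kin; congr (_ * _).
apply: eq_bigr => i _.
by rewrite (dqE (i, cx))// (dqE (i, cy))// (dqE (i, cz)).
Qed.

Lemma action_ge_kin w q g : is_loop q -> prims q g ->
  ((\int[mu]_(t in II) kin w q g t)%R%:E <= action w (twopi R) q)%E.
Proof.
move=> ql pg; rewrite (actionE w ql pg) leeDl//; apply: integral_ge0 => t _.
exact: potU_ge0.
Qed.

Lemma action_ge_potU w q : is_loop q ->
  (\int[mu]_(t in II) potU (q t) <= action w (twopi R) q)%E.
Proof.
move=> ql; have [g pg] := is_loop_prims ql.
rewrite (actionE w ql pg) leeDr// lee_fin; apply: Rintegral_ge0 => t _.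
exact: kin_ge0.
Qed.

(** A single pair that stays within distance [D] contributes at least [1 / D] to the potential at
    all times. *)
Lemma action_ge_dist w q (i j : 'I_N) (D : R) : is_loop q -> (i < j)%N -> 0 < D ->
  (forall t, II t -> bdist (q t) i j <= D) ->
  ((twopi R / D)%:E <= action w (twopi R) q)%E.
Proof.
move=> ql ij D0 dD; apply: le_trans (action_ge_potU w ql).
have -> : (twopi R / D)%:E = (\int[mu]_(t in II) (D^-1)%:E)%E.
  rewrite integral_cst//=; have -> := lebesgue_measure_itv (R:=R) `[0, twopi R].
  by rewrite /= lte_fin twopi_gt0 -EFinB subr0 -EFinM mulrC.
apply: ge0_le_integral => //.
- by move=> t _; rewrite lee_fin invr_ge0 ltW.
- exact: measurable_potU.
- move=> t It; rewrite potUE (bigD1 i)//= (bigD1 j)//= -addeA.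
  apply: (@le_trans _ _ (invd (bdist (q t) i j))).
    rewrite /invd; case: eqP => [_|/eqP d0]; first by rewrite leey.
    by rewrite lee_fin lef_pV2 ?posrE// ?dD// lt_neqAle eq_sym d0 bdist_ge0.
  rewrite leeDl//; apply: adde_ge0; apply: sume_ge0 => k _.
    by apply: invd_ge0; exact: bdist_ge0.
  by apply: sume_ge0 => l _; apply: invd_ge0; exact: bdist_ge0.
Qed.

End loops.

(** * Signs in the weak closure *)

Section weak_signs.
Context {R : realType}.
Notation mu := (@lebesgue_measure R).
Notation II := [set` `[0%R, twopi R]].
Variable N : nat.
Hypothesis hN : (2 <= N)%N.

Lemma N_gt0 : (0 < N)%N. Proof. exact: ltnW. Qed.
Definition o0 : 'I_N := Ordinal N_gt0.

Lemma body0E (c : config R N) a : body c 0 a = c o0 a.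
Proof. exact: (bodyE c o0). Qed.

Lemma H1inner_eval (p : loop R N) (t0 : R) : is_loop p -> 0 < t0 < twopi R ->
  let v : loop R N := fun t i a => if (i == o0) && (a == cy) then green t0 t else 0 in
  is_loop v /\ H1inner p v = 2 * sh pi * p t0 o0 cy.
Proof.
move=> pl t0I v; have [gH gP] := green_H1 t0I; split.
  move=> i a; have -> : (fun t => v t i a) =
      if (i == o0) && (a == cy) then green t0 else cst 0.
    by apply/funext => t; rewrite /v; case: ifP.
  case: ifP => _ //.
  apply/H1funP; split => //; exists (cst 0); split; last first.
    by move=> t _; rewrite Rintegral_cst// mul0r addr0.
  by apply: continuous_L2 => x; exact: cvg_cst.
pose F i a := \int[mu]_(t in II) (p t i a * v t i a + dq p t i a * dq v t i a).
have Fe : F o0 cy = 2 * sh pi * p t0 o0 cy.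
  have [g pg] := is_loop_prims pl.
  rewrite -(green_eval t0I (fun t => loop_periodic pl t o0 cy) (pg o0 cy)).
  by apply: eq_Rintegral => t _; rewrite /dq /v !eqxx.
have F0 i a : ~~ ((i == o0) && (a == cy)) -> F i a = 0.
  move=> ia; rewrite /F (@eq_Rintegral _ _ _ mu _ (cst 0)).
    by rewrite Rintegral_cst// mul0r.
  move=> t _; have vE : (fun s => v s i a) = cst 0.
    by apply/funext => s; rewrite /v (negbTE ia).
  by rewrite /dq vE [derive1 (cst 0) t]derive1E derive_cst mulr0 addr0 /v (negbTE ia) mulr0.
rewrite -[LHS]/(\sum_(i < N) \sum_(a < 3) F i a) -{}Fe; move: (F) F0 => G G0.
have r : \sum_(i < N | i != o0) \sum_(a < 3) G i a = 0.
  by apply: big1 => i i0; apply: big1 => a _; rewrite G0// negb_and i0.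
rewrite (bigD1 o0)//= r addr0 (bigD1 cy)//= big1 ?addr0// => a a0.
by rewrite G0// negb_and a0 orbT.
Qed.

Lemma time_itv (j : 'I_N.-1) : 0 < j.+1%:R * (pi : R) / N%:R < pi.
Proof.
have N0 : 0 < N%:R :> R by rewrite ltr0n N_gt0.
have p0 := pi_gt0 R; have j0 : 0 < j.+1%:R :> R by rewrite ltr0n.
apply/andP; split; first by rewrite divr_gt0// mulr_gt0.
rewrite ltr_pdivrMr// mulrC ltr_pM2l// ltr_nat.
by have := ltn_ord j; rewrite ltn_predRL.
Qed.

(** Testing the closure against the one loop that represents [y_0(t0)] gives loops with the
    prescribed strict sign whose value at [t0] is arbitrarily close to that of [q]; only the
    non-strict inequality survives. *)
Lemma weak_signs (xi : Xi N) (q : loop R N) : LambdaDN_xi xi q ->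
  forall j : 'I_N.-1, let y := q (j.+1%:R * pi / N%:R) o0 cy in
  if xi j then 0 <= y else y <= 0.
Proof.
move=> [[ql _] qc] j /=; set t0 := j.+1%:R * pi / N%:R; set y := q t0 o0 cy.
have t0I : 0 < t0 < twopi R.
  have /andP[h1 h2] := time_itv j; rewrite h1/= (lt_trans h2)// /twopi.
  by have := pi_gt0 R; lra.
have key e : 0 < e -> exists s, has_signs xi s /\ `|s t0 o0 cy - y| < e.
  have s0 : 0 < 2 * sh pi :> R by apply: mulr_gt0 => //; exact: sh_pi_gt0.
  move=> e0; pose v : loop R N :=
    fun t i a => if (i == o0) && (a == cy) then green t0 t else 0.
  have [vl _] := H1inner_eval ql t0I.
  have [||s [[[sl _] [_ sx]] sv]] := qc [:: v] (2 * sh pi * e).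
  - by move=> u; rewrite mem_seq1 => /eqP ->.
  - exact: mulr_gt0.
  exists s; split => //; have := sv v; rewrite mem_seq1 eqxx => /(_ isT).
  have [_ ->] := H1inner_eval (is_loopB sl ql) t0I.
  by rewrite normrM gtr0_norm// ltr_pM2l.
case: ifPn => xj; rewrite leNgt; apply/negP => y0.
- have [|s [sx]] := key (- y); first by rewrite oppr_gt0.
  have := sx j; rewrite xj/= body0E -/t0 ltr_norml => s0 /andP[_]; lra.
- have [s [sx]] := key y y0.
  have := sx j; rewrite (negbTE xj)/= body0E -/t0 ltr_norml => s0 /andP[]; lra.
Qed.

End weak_signs.

(** * Rotating regular polygons *)

Section ngons.
Context {R : realType}.
Notation mu := (@lebesgue_measure R).
Notation II := [set` `[0%R, twopi R]].

Lemma I3P (a : 'I_3) : [\/ a = cx, a = cy | a = cz].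
Proof.
by case: a => [[|[|[|//]]] i]; [constructor 1|constructor 2|constructor 3];
  apply: val_inj.
Qed.

Lemma coord_eqs : ((cy == cx) = false) * ((cz == cx) = false) * ((cz == cy) = false)
  * ((cx == cy) = false) * ((cx == cz) = false) * ((cy == cz) = false).
Proof. by []. Qed.

Lemma sum3E (V : nmodType) (F : 'I_3 -> V) : \sum_(a < 3) F a = F cx + F cy + F cz.
Proof.
rewrite !big_ord_recl big_ord0 addr0 addrA.
by congr (F _ + F _ + F _); apply: val_inj.
Qed.

Lemma sin_pi_frac_neq0 (m n : nat) : (0 < n)%N -> ~~ (n %| m)%N ->
  sin (m%:R * pi / n%:R : R) != 0.
Proof.
move=> n0 nm; have n0' : n%:R != 0 :> R by rewrite pnatr_eq0 -lt0n.
have -> : m%:R * pi / n%:R = (m %% n)%:R * pi / n%:R + pi *+ (m %/ n) :> R.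
  rewrite {1}(divn_eq m n) natrD natrM -mulr_natr; field.
  by [].
rewrite (alternatingn (@sinDpi R)) mulf_neq0 ?signr_eq0//.
rewrite gt_eqF// sin_gt0_pi//.
have r0 : 0 < (m %% n)%:R :> R by rewrite ltr0n lt0n; rewrite /dvdn in nm.
have p0 := pi_gt0 R; have n0r : 0 < n%:R :> R by rewrite ltr0n.
rewrite divr_gt0 ?mulr_gt0//= ltr_pdivrMr// mulrC ltr_pM2l//.
by rewrite ltr_nat ltn_pmod.
Qed.

Lemma cosDk2pi (k : nat) (x : R) : cos (x + k%:R * (2 * pi)) = cos x.
Proof.
rewrite -[RHS](periodicn (@cosD2pi R) k x); congr cos.
by rewrite -[_ *+ k]mulr_natr mulr2n; ring.
Qed.

Lemma sinDk2pi (k : nat) (x : R) : sin (x + k%:R * (2 * pi)) = sin x.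
Proof.
rewrite -[RHS](periodicn (@sinD2pi R) k x); congr sin.
by rewrite -[_ *+ k]mulr_natr mulr2n; ring.
Qed.

Variable N : nat.
Hypothesis hN : (2 <= N)%N.
Variable k : nat.
Hypothesis hkN : coprime k N.

Definition sgb (s : bool) : R := if s then 1 else -1.

(* The regular N-gon of radius 1 rotating as [e^{-ikt}], body 0 starting at (1, 0). *)
Definition unit_ngon (t : R) : config R N := fun i a =>
  let th := k%:R * (t + 2 * pi * i%:R / N%:R) in
  if a == cx then cos th else if a == cy then - sin th else 0.

Lemma N_neq0 : N%:R != 0 :> R.
Proof. by rewrite pnatr_eq0 -lt0n N_gt0. Qed.

Lemma cos_sgb (s : bool) (x : R) : cos ((if s then 0 else pi) + x) = sgb s * cos x.
Proof. by case: s; rewrite ?add0r ?mul1r// addrC cosDpi mulN1r. Qed.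

Lemma sin_sgb (s : bool) (x : R) : sin ((if s then 0 else pi) + x) = sgb s * sin x.
Proof. by case: s; rewrite ?add0r ?mul1r// addrC sinDpi mulN1r. Qed.

(** Both polygons become multiples of [unit_ngon]: the half turn of the minus case is absorbed into
    a negative radius. *)
Lemma confrot_ngon_r r s t i a :
  confrot (- (k%:R * t)) (@ngon_r R N r k s) i a = r * sgb s * unit_ngon t i a.
Proof.
pose th : R := (if s then 0 else pi) - 2 * pi * k%:R * i%:R / N%:R.
have thE : th - k%:R * t =
    (if s then 0 else pi) + - (k%:R * (t + 2 * pi * i%:R / N%:R)).
  by rewrite /th; field; exact: N_neq0.
have c : cos (th - k%:R * t) = sgb s * cos (k%:R * (t + 2 * pi * i%:R / N%:R)).
  by rewrite thE cos_sgb cosN.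
have sE : sin (th - k%:R * t) = - (sgb s * sin (k%:R * (t + 2 * pi * i%:R / N%:R))).
  by rewrite thE sin_sgb sinN mulrN.
rewrite /confrot /ngon_r /unit_ngon -/th; clear thE; clearbody th.
have [->|->|->] := I3P a.
- by rewrite !eqxx !coord_eqs -mulrA -c cosB cosN sinN; ring.
- rewrite !eqxx !coord_eqs; transitivity (r * sin (th - k%:R * t)).
    by rewrite sinB cosN sinN; ring.
  by rewrite sE; ring.
- by rewrite !coord_eqs mulr0.
Qed.

(* No existence proof is needed: the default value of [xget] is [1]. *)
Lemma ngon_radius_gt0 s : 0 < @ngon_radius R N k s.
Proof. by rewrite /ngon_radius; case: xgetP => [y _ []|]. Qed.

Lemma ngon_loopE s l t i a : @ngon_loop R N k s l t i a =
  (l * @ngon_radius R N k s * sgb s) * unit_ngon t i a.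
Proof. by rewrite /ngon_loop /confscale confrot_ngon_r !mulrA. Qed.

Lemma unit_ngon_shift t i a : unit_ngon t i a = unit_ngon (t + 2 * pi * i%:R / N%:R) (o0 hN) a.
Proof. by rewrite /unit_ngon/= mulr0 mul0r addr0. Qed.

Lemma is_derive_sink (b t : R) : is_derive t (1 : R) (fun t => sin (b + k%:R * t))
  (k%:R * cos (b + k%:R * t)).
Proof. by apply: is_derive_affine => x; exact: is_derive_sin. Qed.

Lemma is_derive_cosk (b t : R) : is_derive t (1 : R) (fun t => cos (b + k%:R * t))
  (k%:R * - sin (b + k%:R * t)).
Proof. by apply: is_derive_affine => x; exact: is_derive_cos. Qed.

Lemma continuous_sink b : continuous (fun t : R => sin (b + k%:R * t)).
Proof. exact: is_derive_continuous (is_derive_sink b). Qed.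

Lemma continuous_cosk b : continuous (fun t : R => cos (b + k%:R * t)).
Proof. exact: is_derive_continuous (is_derive_cosk b). Qed.

Lemma prim_sink (b : R) : prim (fun t => sin (b + k%:R * t)) (fun t => k%:R * cos (b + k%:R * t)).
Proof.
apply: prim_C1; first exact: is_derive_sink.
by move=> x; apply: cvgM; [exact: cvg_cst|exact: continuous_cosk].
Qed.

Lemma prim_cosk (b : R) : prim (fun t => cos (b + k%:R * t)) (fun t => k%:R * - sin (b + k%:R * t)).
Proof.
apply: prim_C1; first exact: is_derive_cosk.
by move=> x; apply: cvgM; [exact: cvg_cst|apply: cvgN; exact: continuous_sink].
Qed.

Lemma prim0 : prim (fun=> 0 : R) (fun=> 0).
Proof.
split; first by apply: continuous_L2 => x; exact: cvg_cst.
by move=> t _; rewrite Rintegral_cst// mul0r addr0.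
Qed.

Lemma prims_unit_ngon : prims unit_ngon (fun i a t => if a == cx then k%:R * unit_ngon t i cy
  else if a == cy then - (k%:R * unit_ngon t i cx) else 0).
Proof.
move=> i a; pose b : R := k%:R * (2 * pi * i%:R / N%:R).
have bE t : k%:R * (t + 2 * pi * i%:R / N%:R) = b + k%:R * t by rewrite /b; ring.
rewrite /unit_ngon; have [->|->|->] := I3P a; rewrite ?eqxx ?coord_eqs/=.
- rewrite (_ : (fun t => cos _) = fun t => cos (b + k%:R * t)); last first.
    by apply/funext => t; rewrite bE.
  rewrite (_ : (fun t => k%:R * _) = fun t => k%:R * - sin (b + k%:R * t)).
    exact: prim_cosk.
  by apply/funext => t; rewrite bE.
- rewrite (_ : (fun t => - sin _) = fun t => (-1) * sin (b + k%:R * t)); last first.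
    by apply/funext => t; rewrite bE mulN1r.
  rewrite (_ : (fun t => - _) = fun t => (-1) * (k%:R * cos (b + k%:R * t))).
    by apply: primZ; exact: prim_sink.
  by apply/funext => t; rewrite bE mulN1r.
- exact: prim0.
Qed.

Lemma unit_ngon_periodic t i a : unit_ngon (t + 2 * pi) i a = unit_ngon t i a.
Proof.
rewrite /unit_ngon; set b := 2 * pi * i%:R / N%:R.
have -> : k%:R * (t + 2 * pi + b) = k%:R * (t + b) + k%:R * (2 * pi) by ring.
by rewrite cosDk2pi sinDk2pi.
Qed.

Section scaled.
Variable c : R.
Hypothesis c0 : c != 0.
Definition scaled_ngon : loop R N := fun t => confscale c (unit_ngon t).

Definition scaled_diff (i : 'I_N) (a : 'I_3) (t : R) : R :=
  c * (if a == cx then k%:R * unit_ngon t i cy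
       else if a == cy then - (k%:R * unit_ngon t i cx) else 0).

Lemma prims_scaled_ngon : prims scaled_ngon scaled_diff.
Proof. by move=> i a; apply: primZ; exact: prims_unit_ngon. Qed.

Lemma scaled_ngon_loop : is_loop scaled_ngon.
Proof.
apply: prims_loop prims_scaled_ngon => t i a.
by rewrite /scaled_ngon /confscale unit_ngon_periodic.
Qed.

Lemma scaled_ngon_DN : loopsDN scaled_ngon.
Proof.
split; first exact: scaled_ngon_loop.
split => t.
  by move=> i a; rewrite body0E /scaled_ngon /confscale unit_ngon_shift.
move=> a; rewrite !body0E /scaled_ngon /confscale /unit_ngon/= mulr0 mul0r !addr0.
have -> : k%:R * (2 * pi - t) = - (k%:R * t) + k%:R * (2 * pi) by ring.
by rewrite cosDk2pi sinDk2pi cosN sinN;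
  have [->|->|->] := I3P a; rewrite ?eqxx ?coord_eqs ?mulrN ?mulr0.
Qed.

(** Coinciding vertices have phases whose difference has cosine 1, hence
    [sin(k (i - j) pi / N) = 0]; since [k] is coprime to [N], this would make [N] divide [i - j],
    which lies strictly between [0] and [N]. *)
Lemma scaled_ngon_collision_free : collision_free scaled_ngon.
Proof.
move=> t; suff H (i j : 'I_N) : (j < i)%N -> scaled_ngon t i <> scaled_ngon t j.
  move=> i j; rewrite -val_eqE /= neq_ltn => /orP[ij|]; last exact: H.
  by move=> /esym; exact: H.
move=> ji e; pose th (i : 'I_N) := k%:R * (t + 2 * pi * i%:R / N%:R).
have := congr1 (fun c => c cx) e; have := congr1 (fun c => c cy) e.
rewrite /scaled_ngon /confscale /unit_ngon !eqxx !coord_eqs -!/(th _).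
move=> /(mulfI c0) /oppr_inj se /(mulfI c0) ce.
have c1 : cos (th i - th j) = 1 by rewrite cosB ce se -!expr2 cos2Dsin2.
have thE : th i - th j = ((k * (i - j))%:R * pi / N%:R) *+ 2.
  by rewrite /th natrM natrB ?(ltnW ji)// mulr2n; field; exact: N_neq0.
have : sin ((k * (i - j))%:R * pi / N%:R : R) != 0.
  apply: sin_pi_frac_neq0; first exact: N_gt0.
  rewrite Gauss_dvdr; last by rewrite coprime_sym.
  apply/negP => /dvdn_leq; rewrite subn_gt0 => /(_ ji).
  by apply/negP; rewrite -ltnNge (leq_ltn_trans (leq_subr _ _)).
move: c1; rewrite thE cos_mulr2n cos2sin2 mulr2n => c1 /eqP; apply.
by apply/eqP; rewrite -sqrf_eq0; apply/eqP; lra.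
Qed.

End scaled.

(** Closed form of [xi_ngon], see [xi_ngonE]: body 0 of the polygon of signed radius [a] has
    [y = - a sin(k t)], read here at the sign times [(j + 1) pi / N]. *)
Definition ngon_signs (s : bool) : Xi N :=
  [ffun j : 'I_N.-1 => 0 < sgb s * - sin (k%:R * (j.+1%:R * pi / N%:R) : R)].

Lemma sin_ktime_neq0 (j : 'I_N.-1) : sin (k%:R * (j.+1%:R * pi / N%:R) : R) != 0.
Proof.
have -> : k%:R * (j.+1%:R * pi / N%:R) = (k * j.+1)%:R * pi / N%:R :> R.
  by rewrite natrM; ring.
apply: sin_pi_frac_neq0; first exact: N_gt0.
rewrite Gauss_dvdr; last by rewrite coprime_sym.
apply/negP => /dvdn_leq; rewrite ltn0Sn => /(_ isT).
by apply/negP; rewrite -ltnNge -ltn_predRL.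
Qed.

Lemma scaled_ngon_signs c : c != 0 -> has_signs (ngon_signs (0 < c)) (scaled_ngon c).
Proof.
move=> c0 j; rewrite /= ffunE body0E /scaled_ngon /confscale /unit_ngon/=.
rewrite mulr0 mul0r addr0; have := sin_ktime_neq0 j.
set S := sin _; rewrite /sgb; have [cp|cn _|ce] := ltrgt0P c.
- rewrite mul1r => S0; case: ifPn => h; first by rewrite mulr_gt0.
  rewrite pmulr_rlt0// lt_neqAle oppr_eq0 S0/=; by rewrite leNgt.
- rewrite mulN1r opprK; case: ifPn => h; first by rewrite nmulr_rgt0// oppr_lt0.
  by rewrite nmulr_rlt0// oppr_gt0 lt_neqAle sin_ktime_neq0 leNgt.
- by rewrite ce eqxx in c0.
Qed.

Lemma weak_closure_self (S : set (loop R N)) q : S q -> weak_closure S q.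
Proof.
move=> Sq vs e _ e0; exists q; split => // v _; rewrite [H1inner _ _]big1 ?normr0//.
move=> i _; rewrite big1// => a _; rewrite (@eq_Rintegral _ _ _ mu _ (cst 0)).
  by rewrite Rintegral_cst// mul0r.
move=> t _; have E : (fun s => confsub (q s) (q s) i a) = cst 0.
  by apply/funext => s; rewrite /confsub subrr.
by rewrite /dq E [derive1 (cst 0) t]derive1E derive_cst mul0r addr0 /confsub subrr mul0r.
Qed.

Lemma scaled_ngon_Lambda c : c != 0 ->
  LambdaDN_xi (ngon_signs (0 < c)) (scaled_ngon c).
Proof.
move=> c0; split; first exact: scaled_ngon_DN.
apply: weak_closure_self; split; first exact: scaled_ngon_DN.
by split; [exact: scaled_ngon_collision_free|exact: scaled_ngon_signs].
Qed.

(** The error is smaller than [|a sin(k t)|], so [y_0] is nonzero with the sign of [- a sin(k t)] at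
    each sign time; the non-strict inequalities of [weak_signs] then leave one choice for [xi]. *)
Lemma signs_of_rotating (xi : Xi N) (q : loop R N) (a : R) : LambdaDN_xi xi q ->
  a != 0 ->
  (forall j : 'I_N.-1, let t := j.+1%:R * pi / N%:R in
    `|q t (o0 hN) cy + a * sin (k%:R * t)| < `|a| * `|sin (k%:R * t)|) ->
  xi = ngon_signs (0 < a).
Proof.
move=> qL a0 qa; apply/ffunP => j; rewrite ffunE.
have := weak_signs hN qL j; have := qa j => /=; have := sin_ktime_neq0 j.
set S := sin _; set y := q _ _ _ => S0; rewrite -normrM.
have -> : sgb (0 < a) * - S = (Num.sg a) * - S.
  by rewrite /sgb; case: (ltrgt0P a) a0 => [/gtr0_sg ->|/ltr0_sg ->|->]//; rewrite eqxx.
have -> : (0 < Num.sg a * - S) = (0 < - (a * S)).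
  rewrite -mulrN; case: (ltrgt0P a) a0 => [ap _|an _|//].
    by rewrite gtr0_sg// mul1r pmulr_rgt0.
  by rewrite ltr0_sg// mulN1r nmulr_rgt0// oppr_gt0.
have : a * S != 0 by rewrite mulf_neq0.
move: (a * S) => z z0; case: (xi j) => h1 h2.
  by apply/esym; move: h1; case: (ltrgt0P z) z0 => [zp|zn|->]; rewrite ?eqxx//;
    [rewrite ltr_norml => _ /andP[]; lra|rewrite oppr_gt0 zn].
by apply/esym/negbTE; move: h1; case: (ltrgt0P z) z0 => [zp|zn|->]; rewrite ?eqxx//;
  [rewrite oppr_gt0 -leNgt => *; exact: ltW|rewrite ltr_norml => _ /andP[]; lra].
Qed.

Lemma sgb_neq0 s : sgb s != 0. Proof. by case: s; rewrite /sgb ?oppr_eq0 oner_eq0. Qed.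

Lemma sgb_gt0 s : (0 < sgb s) = s.
Proof. by case: s; rewrite /sgb ?ltr01// oppr_gt0 ltr10. Qed.

Lemma ngon_loop_scaled s l : @ngon_loop R N k s l =
  scaled_ngon (l * @ngon_radius R N k s * sgb s).
Proof.
apply/funext => t; apply/funext => i; apply/funext => a.
by rewrite ngon_loopE.
Qed.

Lemma ngon_coef s l : 0 < l -> l * @ngon_radius R N k s * sgb s != 0 /\
  (0 < l * @ngon_radius R N k s * sgb s) = s.
Proof.
move=> l0; have c0 : 0 < l * @ngon_radius R N k s by rewrite mulr_gt0// ngon_radius_gt0.
by rewrite mulf_neq0 ?sgb_neq0 ?gt_eqF// pmulr_rgt0// sgb_gt0.
Qed.

Lemma xi_ngonE s : @xi_ngon R N k s = ngon_signs s.
Proof.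
apply: xget_unique => /= [l l0|xi].
  have [c0 cs] := ngon_coef s l0; rewrite ngon_loop_scaled -[in ngon_signs s]cs.
  exact: scaled_ngon_Lambda.
(* For uniqueness the scale [l = 1] is enough: the loop is exactly a polygon, so the error in
   [signs_of_rotating] is zero. *)
move=> /(_ 1 ltr01); have [c0 cs] := ngon_coef s (@ltr01 R).
rewrite ngon_loop_scaled -[in ngon_signs s]cs => H.
apply: (signs_of_rotating H c0) => j /=.
rewrite /scaled_ngon /confscale /unit_ngon/= mulr0 mul0r addr0 mulrN addNr normr0.
by apply: mulr_gt0; rewrite normr_gt0//; exact: sin_ktime_neq0.
Qed.

(** The first sign, that of [-+ sin(k pi / N)], already separates the two polygons; it exists
    because [N >= 2]. *)
Lemma ngon_signs_inj : injective ngon_signs.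
Proof.
have j0 : (0 < N.-1)%N by rewrite -subn1 subn_gt0.
move=> s1 s2 /ffunP /(_ (Ordinal j0)); rewrite !ffunE.
have := sin_ktime_neq0 (Ordinal j0); set S := sin _ => S0.
case: s1; case: s2; rewrite /sgb// ?mul1r ?mulN1r opprK oppr_gt0.
  by case: (ltrgt0P S) S0 => // ->; rewrite eqxx.
by case: (ltrgt0P S) S0 => // ->; rewrite eqxx.
Qed.

End ngons.

(** * Rigidity in the rotating frame *)

Section rotating_frame.
Context {R : realType}.
Notation mu := (@lebesgue_measure R).
Notation II := [set` `[0%R, twopi R]].
Variable N : nat.
Hypothesis hN : (2 <= N)%N.
Variable k : nat.
Hypothesis hkN : coprime k N.
Notation o0 := (o0 hN).
Notation ungon := (@unit_ngon R N k).
Notation ngon_signs := (@ngon_signs R N k).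
Implicit Types (q : loop R N).

Lemma action_ge0 q : (0 <= action k%:R (twopi R) q)%E.
Proof.
apply: integral_ge0 => t _; apply: adde_ge0; last exact: potU_ge0.
rewrite lee_fin mulr_ge0 ?invr_ge0// sumr_ge0// => i _.
by rewrite !addr_ge0 ?sqr_ge0.
Qed.

Lemma normr_le_sqrt (x y : R) : x ^+ 2 <= y -> `|x| <= Num.sqrt y.
Proof. by move=> xy; rewrite -sqrtr_sqr ler_wsqrtr. Qed.

Lemma kin_coord_le q g i (M : R) : prims q g ->
  \int[mu]_(t in II) kin k%:R q g t <= M ->
  \int[mu]_(t in II) (g i cx t - k%:R * q t i cy) ^+ 2 +
  \int[mu]_(t in II) (g i cy t + k%:R * q t i cx) ^+ 2 +
  \int[mu]_(t in II) (g i cz t) ^+ 2 <= 2 * M.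
Proof.
move=> pg; rewrite Rint_kin// => kM.
rewrite -ler_pdivrMl//; apply: le_trans kM; rewrite ler_pM2l ?invr_gt0//.
rewrite (bigD1 i)//= lerDl sumr_ge0// => j _.
by rewrite !addr_ge0// Rintegral_ge0// => t _; exact: sqr_ge0.
Qed.

(** The derivative of [e^{ikt} zeta_0] has squared L^2 norm at most [2 M], so by [prim_holder] each
    of its coordinates varies by at most [d] over a period. The remaining bodies are time shifts of
    body 0, and [unit_ngon] shifts in the same way. *)
Lemma rotating_estimate q (M : R) : loopsDN q -> mean_z0 q = 0 ->
  (action k%:R (twopi R) q <= M%:E)%E ->
  let d := Num.sqrt (twopi R * (2 * M)) in
  forall t i a, `|q t i a - q 0 o0 cx * ungon t i a| <= 2 * d.
Proof.
move=> [ql [qsh qrefl]] qz qM d; have [g pg] := is_loop_prims ql.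
have kM : \int[mu]_(t in II) kin k%:R q g t <= M.
  by rewrite -lee_fin (le_trans (action_ge_kin _ ql pg)).
have := kin_coord_le o0 pg kM.
set U := Rintegral _ _ _; set V := Rintegral _ _ _; set W := Rintegral _ _ _ => UVW.
have sq0 (h : R -> R) : 0 <= \int[mu]_(t in II) (h t) ^+ 2.
  by apply: Rintegral_ge0 => t _; exact: sqr_ge0.
have U0 : 0 <= U by exact: sq0.
have V0 : 0 <= V by exact: sq0.
have W0 : 0 <= W by exact: sq0.
have d0 : 0 <= d by exact: sqrtr_ge0.
pose c0 t := cos (0 + k%:R * t) : R; pose s0 t := sin (0 + k%:R * t) : R.
have cs t : c0 t ^+ 2 + s0 t ^+ 2 = 1 by exact: cos2Dsin2.
have pc := @prim_cosk R k 0; have ps := @prim_sink R k 0.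
have bc t : II t -> `|k%:R * - sin (0 + k%:R * t) : R| <= k%:R.
  by move=> _; rewrite normrM normrN normr_nat ler_piMr// sin_max.
have bs t : II t -> `|k%:R * cos (0 + k%:R * t) : R| <= k%:R.
  by move=> _; rewrite normrM normr_nat ler_piMr// cos_max.
have px := pg o0 cx; have py := pg o0 cy; have pz := pg o0 cz.
pose u t := g o0 cx t - k%:R * q t o0 cy; pose v t := g o0 cy t + k%:R * q t o0 cx.
have u2 : L2 II u by exact: L2_rotx.
have v2 : L2 II v by exact: L2_roty.
(* These are the real and imaginary parts of [e^{ikt} zeta_0]. Their derivatives are [u] and [v]
   turned by the same angle, so the squares still add up to [u^2 + v^2]. *)
have pX : prim (fun t => q t o0 cx * c0 t - q t o0 cy * s0 t)
               (fun t => u t * c0 t - v t * s0 t).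
  have := primB (prim_mul px pc bc) (prim_mul py ps bs).
  by congr prim; apply/funext => t; rewrite /u /v /c0 /s0; ring.
have pY : prim (fun t => q t o0 cx * s0 t + q t o0 cy * c0 t)
               (fun t => u t * s0 t + v t * c0 t).
  have := primD (prim_mul px ps bs) (prim_mul py pc bc).
  by congr prim; apply/funext => t; rewrite /u /v /c0 /s0; ring.
have uv : integ II (fun t => u t ^+ 2 + v t ^+ 2).
  by apply: integD => //; exact: L2_sqr.
have intX : \int[mu]_(t in II) (u t * c0 t - v t * s0 t) ^+ 2 <= 2 * M.
  apply: (@le_trans _ _ (U + V)); last by lra.
  rewrite -RintegralD//; last 2 first.
  - exact: L2_sqr.
  - exact: L2_sqr.
  apply: le_Rintegral => //; first by apply: L2_sqr => //; case: pX.
  move=> t _; have := sqr_ge0 (u t * s0 t + v t * c0 t); have := cs t.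
  rewrite -/(u t) -/(v t); move: (u t) (v t) (c0 t) (s0 t) => x y c s h.
  have -> : x ^+ 2 + y ^+ 2 = (x ^+ 2 + y ^+ 2) * (c ^+ 2 + s ^+ 2) by rewrite h mulr1.
  nra.
have intY : \int[mu]_(t in II) (u t * s0 t + v t * c0 t) ^+ 2 <= 2 * M.
  apply: (@le_trans _ _ (U + V)); last by lra.
  rewrite -RintegralD//; last 2 first.
  - exact: L2_sqr.
  - exact: L2_sqr.
  apply: le_Rintegral => //; first by apply: L2_sqr => //; case: pY.
  move=> t _; have := sqr_ge0 (u t * c0 t - v t * s0 t); have := cs t.
  rewrite -/(u t) -/(v t); move: (u t) (v t) (c0 t) (s0 t) => x y c s h.
  have -> : x ^+ 2 + y ^+ 2 = (x ^+ 2 + y ^+ 2) * (c ^+ 2 + s ^+ 2) by rewrite h mulr1.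
  nra.
have holder f h s t : prim f h -> \int[mu]_(t in II) h t ^+ 2 <= 2 * M ->
    II s -> II t -> s <= t -> `|f t - f s| <= d.
  move=> pf hM; rewrite /= !in_itv/= => /andP[s0' s2] /andP[t0' t2] st.
  apply: normr_le_sqrt; apply: (le_trans (prim_holder pf s0' st t2)).
  apply: ler_pM => //; [by rewrite subr_ge0|lra].
have I0 : II (0 : R) by rewrite /= in_itv/= lexx ltW// twopi_gt0.
(* At [t = 0] the reflection gives [y_0(2 pi) = - y_0(0)], while periodicity gives
   [y_0(2 pi) = y_0(0)]. *)
have y0 : q 0 o0 cy = 0.
  have := qrefl 0 cy; rewrite !body0E subr0 eqxx => e.
  have := loop_periodic ql 0 o0 cy; rewrite add0r e; lra.
have c00 : c0 0 = 1 by rewrite /c0 mulr0 addr0 cos0.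
have s00 : s0 0 = 0 by rewrite /s0 mulr0 addr0 sin0.
set a := q 0 o0 cx.
have eX t : II t -> `|q t o0 cx * c0 t - q t o0 cy * s0 t - a| <= d.
  move=> It; have t0 : 0 <= t by move: It; rewrite /= in_itv/= => /andP[].
  by have := holder _ _ _ _ pX intX I0 It t0; rewrite c00 s00 y0 mulr1 mul0r subr0.
have eY t : II t -> `|q t o0 cx * s0 t + q t o0 cy * c0 t| <= d.
  move=> It; have t0 : 0 <= t by move: It; rewrite /= in_itv/= => /andP[].
  by have := holder _ _ _ _ pY intY I0 It t0; rewrite c00 s00 y0 mulr0 mul0r addr0 subr0.
have c1 t : `|c0 t| <= 1 by exact: cos_max.
have s1 t : `|s0 t| <= 1 by exact: sin_max.
(* Rotating back combines the two errors with a cosine and a sine; this is the factor 2 in the final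
   bound. *)
have comb (x y c s : R) : `|x| <= d -> `|y| <= d -> `|c| <= 1 -> `|s| <= 1 ->
    `|x * c + y * s| <= 2 * d.
  move=> hx hy hc hs; rewrite (le_trans (ler_normD _ _))// !normrM mulr_natl mulr2n.
  by rewrite lerD// -[leRHS]mulr1 ler_pM.
have ex t : II t -> `|q t o0 cx - a * c0 t| <= 2 * d.
  move=> It; have := comb _ _ _ _ (eX t It) (eY t It) (c1 t) (s1 t).
  congr (`|_| <= _); have := cs t; move: (q t o0 cx) (q t o0 cy) (c0 t) (s0 t).
  move=> x y c s h.
  have -> : x - a * c = x * (c ^+ 2 + s ^+ 2) - a * c by rewrite h mulr1.
  ring.
have ey t : II t -> `|q t o0 cy + a * s0 t| <= 2 * d.
  move=> It; have ns1 : `|- s0 t| <= 1 by rewrite normrN.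
  have := comb _ _ _ _ (eX t It) (eY t It) ns1 (c1 t).
  congr (`|_| <= _); have := cs t; move: (q t o0 cx) (q t o0 cy) (c0 t) (s0 t).
  move=> x y c s h.
  have -> : y + a * s = y * (c ^+ 2 + s ^+ 2) + a * s by rewrite h mulr1.
  ring.
have ez t : II t -> `|q t o0 cz| <= d.
  move=> It; have zi : integ II (fun t => q t o0 cz).
    by apply: L2_integII; exact: L2_coord pg.
  have z0 : \int[mu]_(t in II) q t o0 cz = 0.
    have p0 : (2 * pi)^-1 != 0 :> R by rewrite invr_eq0 gt_eqF// twopi_gt0.
    move: qz; rewrite /mean_z0 => /eqP; rewrite mulf_eq0 (negbTE p0)/= => /eqP e.
    by rewrite -[RHS]e; apply: eq_Rintegral => s _; rewrite body0E.
  (* Zero mean turns [2 pi z(t)] into the integral over [s] of [z(t) - z(s)], whose integrand is at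
     most [d] in absolute value. *)
  have E : twopi R * q t o0 cz = \int[mu]_(s in II) (q t o0 cz - q s o0 cz).
    rewrite RintegralB//; last by apply: integ_cst => //; exact: IIoo.
    by rewrite z0 subr0 Rint_cst_itv ?subr0 1?mulrC// ltW// twopi_gt0.
  have ci : integ II (fun s => q t o0 cz - q s o0 cz).
    by apply: integB => //; apply: integ_cst => //; exact: IIoo.
  have T0 := @twopi_gt0 R.
  have : twopi R * `|q t o0 cz| <= d * twopi R.
    rewrite -[X in X * `|_|]gtr0_norm// -normrM E.
    apply: (le_trans (le_normr_Rintegral _ ci)) => //.
    rewrite -[X in d * X]subr0 -Rint_cst_itv ?(ltW T0)//.
    apply: le_Rintegral => //; first exact: integ_abs.
      by apply: integ_cst => //; exact: IIoo.
    have WM : W <= 2 * M by lra.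
    move=> s Is; have [st|/ltW ts] := leP s t; first exact: holder pz WM Is It st.
    by rewrite distrC; exact: holder pz WM It Is ts.
  by rewrite mulrC ler_pM2r.
have main t al : `|q t o0 al - a * ungon t o0 al| <= 2 * d.
  have per : forall t, q (t + 2 * pi) o0 al - a * ungon (t + 2 * pi) o0 al =
                  q t o0 al - a * ungon t o0 al.
    by move=> t'; rewrite loop_periodic// unit_ngon_periodic.
  rewrite -(mod2piE t per); have Im := @mod2pi_II R t.
  move: (mod2pi t) Im => {}t It; rewrite /unit_ngon/= mulr0 mul0r addr0.
  rewrite -[k%:R * t]add0r -/(c0 t) -/(s0 t).
  have [->|->|->] := I3P al; rewrite ?eqxx ?coord_eqs.
  - exact: ex.
  - by rewrite mulrN opprK; exact: ey.
  - by rewrite mulr0 subr0 (le_trans (ez t It))// ler_peMl// ler1n.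
move=> t i al; rewrite unit_ngon_shift (qsh t i) body0E; exact: main.
Qed.

Lemma unit_ngon_le1 t i a : `|ungon t i a| <= 1.
Proof.
rewrite /unit_ngon; have [->|->|->] := I3P a; rewrite ?eqxx ?coord_eqs.
- exact: cos_max.
- by rewrite normrN; exact: sin_max.
- by rewrite normr0.
Qed.

Lemma unit_ngon_sqr t i : \sum_(a < 3) ungon t i a ^+ 2 = 1.
Proof.
rewrite sum3E /unit_ngon ?eqxx ?coord_eqs expr0n/= addr0 sqrrN.
exact: cos2Dsin2.
Qed.

Lemma sqrt_sum3_le (F : 'I_3 -> R) (B : R) : (forall a, `|F a| <= B) ->
  Num.sqrt (\sum_(a < 3) F a ^+ 2) <= 3 * B.
Proof.
move=> FB; have B0 : 0 <= B := le_trans (normr_ge0 _) (FB cx).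
rewrite -[leRHS]ger0_norm ?mulr_ge0// -sqrtr_sqr ler_wsqrtr// sum3E.
have h a : F a ^+ 2 <= B ^+ 2.
  by rewrite -[leLHS]ger0_norm ?sqr_ge0// normrX lerXn2r ?nnegrE.
by have := (h cx, h cy, h cz) => -[[]]; nra.
Qed.

Lemma sin_ktime_lbound : exists2 m : R, 0 < m &
  forall j : 'I_N.-1, m <= `|sin (k%:R * (j.+1%:R * pi / N%:R))|.
Proof.
exists (\big[Order.min/1]_(j < N.-1) `|sin (k%:R * (j.+1%:R * pi / N%:R))|).
  by apply: lt_bigmin => // j _; rewrite normr_gt0 sin_ktime_neq0.
by move=> j; exact: bigmin_le_cond.
Qed.

(** The error [2 d] of [rotating_estimate] must stay below [|a| |sin(k t)|] at every sign time, and
    [m] bounds these sines from below uniformly. *)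
Lemma signs_of_small_action xi q (M m : R) : admissible xi q ->
  (action k%:R (twopi R) q <= M%:E)%E ->
  (forall j : 'I_N.-1, m <= `|sin (k%:R * (j.+1%:R * pi / N%:R))|) ->
  2 * Num.sqrt (twopi R * (2 * M)) < `|q 0 o0 cx| * m ->
  xi = ngon_signs (0 < q 0 o0 cx).
Proof.
move=> [qL qz] qM hm; set d := Num.sqrt _; set a := q 0 o0 cx => da.
have [a0|a0] := eqVneq a 0.
  by exfalso; move: da; rewrite a0 normr0 mul0r ltNge mulr_ge0// sqrtr_ge0.
apply: (signs_of_rotating (hN := hN) hkN qL a0) => j /=.
have [qDN _] := qL.
have := rotating_estimate qDN qz qM (j.+1%:R * pi / N%:R) o0 cy.
rewrite -/a -/d /unit_ngon/= mulr0 mul0r addr0 mulrN opprK => /le_lt_trans; apply.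
by apply: (lt_le_trans da); rewrite ler_wpM2l.
Qed.

Lemma coercive xi (M : R) : xi <> ngon_signs true -> xi <> ngon_signs false ->
  exists B : R, forall q, admissible xi q ->
    (action k%:R (twopi R) q <= M%:E)%E -> forall t i a, `|q t i a| <= B.
Proof.
move=> xt xf; have [m m0 hm] := sin_ktime_lbound.
set d := Num.sqrt (twopi R * (2 * M)).
(* A radius [|x_0(0)|] above [2 d / m] would force the signs of a polygon; the second [2 d] is the
   distance to the polygon. *)
exists (2 * d / m + 2 * d) => q qA qM t i al.
have ad : `|q 0 o0 cx| <= 2 * d / m.
  rewrite ler_pdivlMr// leNgt; apply/negP => da.
  have := signs_of_small_action qA qM hm da.
  by case: (0 < q 0 o0 cx).
have [[qDN _] qz] := qA; have := rotating_estimate qDN qz qM t i al; rewrite -/d => h.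
rewrite -[q t i al](subrK (q 0 o0 cx * ungon t i al)) addrC.
rewrite (le_trans (ler_normD _ _))// lerD// normrM -[leRHS]mulr1.
by apply: ler_pM => //; exact: unit_ngon_le1.
Qed.

Lemma hN1 : (1 < N)%N. Proof. exact: hN. Qed.
Definition o1 : 'I_N := Ordinal hN1.

(** A fixed loop is bounded, so bodies 0 and 1 remain within a finite distance. This is why the
    infimum [0] is not attained in (b). *)
Lemma action_gt0 q : is_loop q -> (0 < action k%:R (twopi R) q)%E.
Proof.
move=> ql; have [g pg] := is_loop_prims ql.
have /choice[B BP] (ia : 'I_N * 'I_3) :
    exists B : R, forall t, II t -> `|q t ia.1 ia.2| <= B.
  exact: prim_bounded (pg ia.1 ia.2).
pose C := \sum_ia `|B ia|.
have BC i a t : II t -> `|q t i a| <= C.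
  move=> /(BP (i, a)) h; apply: (le_trans h); apply: (le_trans (ler_norm _)).
  by rewrite /C (bigD1 (i, a))//= lerDl sumr_ge0.
have C0 : 0 <= C by rewrite sumr_ge0.
have D0 : 0 < 3 * (2 * C) + 1 by rewrite ltr_wpDl// !mulr_ge0.
apply: lt_le_trans (action_ge_dist (i := o0) (j := o1) _ ql _ D0 _) => //.
  by rewrite lte_fin divr_gt0// twopi_gt0.
move=> t It; apply: (@le_trans _ _ (3 * (2 * C))); last by rewrite lerDl.
apply: sqrt_sum3_le => a; rewrite (le_trans (ler_normB _ _))//.
by rewrite mulr_natl mulr2n lerD// BC.
Qed.

Lemma scaled_ngon_mean (c : R) : mean_z0 (scaled_ngon k c : loop R N) = 0.
Proof.
rewrite /mean_z0 (@eq_Rintegral _ _ _ mu _ (cst 0)).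
  by rewrite Rintegral_cst// mul0r mulr0.
move=> t _; rewrite body0E /scaled_ngon /confscale /unit_ngon.
by rewrite !coord_eqs mulr0.
Qed.

(** The polygon is at rest in the rotating frame, so the kinetic density vanishes; its mutual
    distances are constant in time and proportional to [|c|]. *)
Lemma scaled_ngon_action : exists2 K : R, 0 <= K & forall c : R, 0 < `|c| ->
  action k%:R (twopi R) (scaled_ngon k c : loop R N) = (K / `|c|)%:E.
Proof.
pose d i j := bdist (ungon 0) i j.
(* The squared distance is [2 - 2 cos] of the difference of the phases, from which [t] cancels. *)
have dE t i j : bdist (ungon t) i j = d i j.
  rewrite /d /bdist !sum3E /unit_ngon ?eqxx ?coord_eqs subrr expr0n/= !addr0.
  congr Num.sqrt; pose th t (i : 'I_N) := k%:R * (t + 2 * pi * i%:R / N%:R) : R.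
  have E s : (cos (th s i) - cos (th s j)) ^+ 2 + (- sin (th s i) - - sin (th s j)) ^+ 2
     = 2 - 2 * cos (th s i - th s j).
    have := cos2Dsin2 (th s i); have := cos2Dsin2 (th s j); rewrite cosB => h1 h2.
    transitivity ((cos (th s i) ^+ 2 + sin (th s i) ^+ 2) +
      (cos (th s j) ^+ 2 + sin (th s j) ^+ 2) -
      2 * (cos (th s i) * cos (th s j) + sin (th s i) * sin (th s j))); first by ring.
    by rewrite h1 h2.
  rewrite -!/(th _ _) (E t) (E 0); congr (_ - _ * cos _).
  by rewrite /th; ring.
have d0 i j : i != j -> d i j != 0.
  move=> ij; apply/negP => /eqP /eqP; rewrite sqrtr_eq0 => h.
  have := @scaled_ngon_collision_free R N hN k hkN 1 (oner_neq0 _) 0 i j ij; apply.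
  apply/funext => a; rewrite /scaled_ngon /confscale !mul1r; apply/eqP.
  rewrite -subr_eq0 -sqrf_eq0; apply/eqP/le_anti; rewrite sqr_ge0 andbT.
  by apply: le_trans h; rewrite (bigD1 a)//= lerDl sumr_ge0// => b _; exact: sqr_ge0.
pose K := \sum_(i < N) \sum_(j < N | (i < j)%N) (d i j)^-1.
exists (twopi R * K).
  rewrite mulr_ge0 ?(ltW twopi_gt0)// sumr_ge0// => i _; rewrite sumr_ge0// => j _.
  by rewrite invr_ge0 sqrtr_ge0.
move=> c c0; have cl : is_loop (scaled_ngon k c : loop R N) by exact: scaled_ngon_loop.
have pg : prims (scaled_ngon k c) (@scaled_diff R N k c) by exact: prims_scaled_ngon.
rewrite (actionE k%:R cl pg) (@eq_Rintegral _ _ _ mu _ (cst 0)); last first.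
  move=> t _; rewrite /kin big1 ?mulr0// => i _.
  rewrite /scaled_diff /scaled_ngon /confscale ?eqxx ?coord_eqs; ring.
rewrite Rintegral_cst// mul0r add0e.
rewrite (@eq_integral _ _ _ mu _ (cst (K / `|c|)%:E)); last first.
  move=> t _; rewrite potUE /K mulr_suml -sumEFin; apply: eq_bigr => i _.
  rewrite mulr_suml -sumEFin; apply: eq_bigr => j ij.
  have bE : bdist (scaled_ngon k c t) i j = `|c| * d i j.
    rewrite -(dE t) /bdist /scaled_ngon /confscale -sqrtr_sqr -sqrtrM ?sqr_ge0//.
    by rewrite mulr_sumr; congr Num.sqrt; apply: eq_bigr => a _; ring.
  have dij : d i j != 0 by apply: d0; rewrite -val_eqE/= ltn_eqF.
  rewrite bE /invd mulf_eq0 (gt_eqF c0) (negbTE dij)/= invfM; congr (_%:E); ring.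
rewrite integral_cst//; have /= -> := lebesgue_measure_itv (R:=R) `[0, twopi R].
by rewrite lte_fin twopi_gt0 -EFinB subr0 -EFinM; congr (_%:E); ring.
Qed.

End rotating_frame.

(** * Loops of small action *)

Section escaping.
Context {R : realType}.
Notation mu := (@lebesgue_measure R).
Notation II := [set` `[0%R, twopi R]].
Variable N : nat.
Hypothesis hN : (2 <= N)%N.
Variable k : nat.
Hypothesis hkN : coprime k N.
Notation o0 := (o0 hN).
Notation ungon := (@unit_ngon R N k).
Notation ngon_signs := (@ngon_signs R N k).
Notation act := (action k%:R (twopi R)).
Implicit Types (q : loop R N).

Lemma scaled_ngon_admissible (c : R) : c != 0 ->
  admissible (ngon_signs (0 < c)) (scaled_ngon k c).
Proof.
by move=> c0; split; [exact: scaled_ngon_Lambda|exact: (scaled_ngon_mean hN)].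
Qed.

Lemma small_action_ngon s (e : R) : 0 < e ->
  exists2 q, admissible (ngon_signs s) q & (act q <= e%:E)%E.
Proof.
move=> e0; have [K K0 HK] := @scaled_ngon_action R N hN k hkN.
(* [K / e] would be the exact scale; [K] is only known to be nonnegative, so [1] is added to make
   [l] positive. *)
pose l := K / e + 1; have l0 : 0 < l by rewrite ltr_wpDl// divr_ge0// ltW.
pose c := l * sgb s : R.
have c0 : c != 0 by rewrite mulf_neq0 ?sgb_neq0 ?gt_eqF.
have cs : (0 < c) = s by rewrite pmulr_rgt0// sgb_gt0.
have cl : `|c| = l.
  by rewrite normrM gtr0_norm// /sgb; case: (s); rewrite ?normrN normr1 mulr1.
exists (scaled_ngon k c); first by rewrite -[in ngon_signs s]cs; exact: scaled_ngon_admissible.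
rewrite HK cl// lee_fin ler_pdivrMr// /l mulrDr mulr1 mulrCA divff ?gt_eqF// mulr1.
by rewrite lerDl ltW.
Qed.

Lemma inf_action_ngon s :
  ereal_inf [set act q | q in admissible (ngon_signs s)] = 0%E.
Proof.
apply/le_anti/andP; split; last first.
  by apply: le_ereal_inf_tmp => _ [q _ <-]; exact: action_ge0.
apply/lee_addgt0Pr => e e0; rewrite add0e.
have [q qA qe] := small_action_ngon s e0.
by apply: le_trans qe; apply: ereal_inf_lbound; exists q.
Qed.

Lemma no_minimizer_ngon s :
  ~ exists q, is_minimizer act (admissible (ngon_signs s)) q.
Proof.
move=> [q [qA qmin]]; have [[[ql _] _] _] := qA.
have := action_gt0 hN k ql; rewrite ltNge => /negP; apply.
apply/lee_addgt0Pr => e e0; rewrite add0e.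
have [p pA pe] := small_action_ngon s e0.
exact: le_trans (qmin p pA) pe.
Qed.

(** Both claims of (c) follow from this: the radius exceeds any prescribed [A] with the sign given
    by [s], while the error remains at most 2 whatever [A] is. *)
Lemma small_action_rotating s (A : R) : 0 < A -> exists2 e : R, 0 < e &
  forall q, admissible (ngon_signs s) q -> (act q <= e%:E)%E ->
  exists a : R, [/\ A <= `|a|, (0 < a) = s &
    forall t i al, `|q t i al - a * ungon t i al| <= 2].
Proof.
move=> A0; have [m m0 hm] := @sin_ktime_lbound R N hN k hkN.
(* With [|a| >= B] one gets [|a| m >= A m + 3 > 2 >= 2 d], as [signs_of_small_action] demands. *)
pose B := A + 3 / m; have B0 : 0 < B by rewrite addr_gt0// divr_gt0.
have p0 := pi_gt0 R; have p2 := @pi_ge2 R.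
(* The first bound makes [d <= 1]. The second excludes [|a| < B]: all distances would be at most
   [6 (|a| + 2)], and the action would be at least [pi / (3 (|a| + 2))], which exceeds [e]. *)
pose e := Num.min (1 / (4 * pi)) (1 / (3 * (B + 2))).
have e0 : 0 < e by rewrite lt_min !divr_gt0//; nra.
exists e => // q qA qe; set a := q 0 o0 cx; exists a.
have [[qDN _] qz] := qA.
have est := rotating_estimate hN qDN qz qe.
set d := Num.sqrt (twopi R * (2 * e)) in est.
have d1 : d <= 1.
  rewrite -[leRHS]sqrtr1 ler_wsqrtr//.
  have : e <= 1 / (4 * pi) by rewrite ge_min lexx.
  by rewrite ler_pdivlMr ?mulr_gt0// /twopi; nra.
have est2 t i al : `|q t i al - a * ungon t i al| <= 2.
  by apply: (le_trans (est t i al)); rewrite -[leRHS]mulr1 ler_pM2l.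
have aB : B <= `|a|.
  have D0 : 0 < 3 * (2 * (`|a| + 2)) by rewrite !mulr_gt0// ltr_wpDl.
  have ub t i al : `|q t i al| <= `|a| + 2.
    rewrite -[q t i al](subrK (a * ungon t i al)) addrC (le_trans (ler_normD _ _))//.
    rewrite lerD// normrM -[leRHS]mulr1 ler_pM//; exact: unit_ngon_le1.
  have [ql _] := qDN.
  have : ((twopi R / (3 * (2 * (`|a| + 2))))%:E <= e%:E)%E.
    apply: le_trans qe; apply: (@action_ge_dist R N k%:R q o0 (o1 hN) _ ql) => //.
    move=> t _; apply: sqrt_sum3_le => al; rewrite (le_trans (ler_normB _ _))//.
    by rewrite [leRHS]mulr_natl mulr2n lerD.
  rewrite lee_fin ler_pdivrMr// => h.
  have : e <= 1 / (3 * (B + 2)) by rewrite ge_min lexx orbT.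
  rewrite ler_pdivlMr; last by lra.
  move=> h2.
  rewrite leNgt; apply/negP => aB; move: h; rewrite /twopi.
  have : e * (3 * (`|a| + 2)) < 1.
    apply: lt_le_trans h2; rewrite ltr_pM2l// ltr_pM2l// ltrD2r//.
  move: (normr_ge0 a); nra.
split => //.
- by apply: le_trans aB; rewrite lerDl divr_ge0// ltW.
- apply: (@ngon_signs_inj R N hN k hkN).
  apply/esym; apply: (signs_of_small_action (hN := hN) hkN qA qe hm).
  rewrite -/a -/d; apply: (@le_lt_trans _ _ 2); first by rewrite -[leRHS]mulr1 ler_pM2l.
  apply: (@lt_le_trans _ _ (B * m)); last by rewrite ler_pM2r.
  by rewrite /B mulrDl divfK ?gt_eqF//; have := mulr_gt0 A0 m0; lra.
Qed.

Lemma confnorm_le (c : config R N) (B : R) : (forall i a, `|c i a| <= B) ->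
  confnorm c <= 3 * N%:R * B.
Proof.
move=> cB; have B0 : 0 <= B := le_trans (normr_ge0 _) (cB o0 cx).
have N1 : 1 <= N%:R :> R by rewrite ler1n N_gt0.
rewrite -[leRHS]ger0_norm ?mulr_ge0// -sqrtr_sqr ler_wsqrtr//.
apply: (@le_trans _ _ (\sum_(i < N) 3 * B ^+ 2)).
  apply: ler_sum => i _; rewrite sum3E.
  have h a : c i a ^+ 2 <= B ^+ 2.
    by rewrite -[leLHS]ger0_norm ?sqr_ge0// normrX lerXn2r ?nnegrE.
  by have := (h cx, h cy, h cz) => -[[]]; lra.
rewrite sumr_const card_ord -[_ *+ N]mulr_natr !exprMn.
have := sqr_ge0 B; set b := B ^+ 2 => b0.
have : 0 <= b * N%:R by rewrite mulr_ge0.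
have : b * N%:R <= b * N%:R ^+ 2 by rewrite ler_wpM2l// expr2 ler_peMr//; lra.
lra.
Qed.

(** The squared norms differ by a sum of [3 N] terms [(c - a u) (c - a u + 2 a u)], each at most
    [2 (2 + 2 |a|) <= 8 |a|]. Dividing by the sum of the norms, which is at least [|a|], leaves a
    bound independent of [a]. *)
Lemma confnorm_rotating (c u : config R N) (a : R) :
  (forall i al, `|u i al| <= 1) -> (forall i, \sum_(al < 3) u i al ^+ 2 = 1) ->
  1 <= `|a| -> (forall i al, `|c i al - a * u i al| <= 2) ->
  `|confnorm c - `|a| * Num.sqrt N%:R| <= 24 * N%:R.
Proof.
move=> u1 uN a1 cu; have N1 : 1 <= N%:R :> R by rewrite ler1n N_gt0.
set S := confnorm c; set n := Num.sqrt N%:R : R.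
have n2 : n ^+ 2 = N%:R by rewrite sqr_sqrtr.
have n0 : 0 <= n by exact: sqrtr_ge0.
have n1 : 1 <= n by rewrite -[leLHS]sqrtr1 ler_wsqrtr.
have S0 : 0 <= S by exact: sqrtr_ge0.
have S2 : S ^+ 2 = \sum_(i < N) \sum_(al < 3) c i al ^+ 2.
  by rewrite sqr_sqrtr// sumr_ge0// => i _; rewrite sumr_ge0// => al _; exact: sqr_ge0.
have key : `|S ^+ 2 - a ^+ 2 * N%:R| <= 24 * N%:R * `|a|.
  have -> : S ^+ 2 - a ^+ 2 * N%:R =
      \sum_(i < N) \sum_(al < 3) (c i al ^+ 2 - a ^+ 2 * u i al ^+ 2).
    have NE : N%:R = \sum_(i < N) 1 :> R by rewrite sumr_const card_ord.
    rewrite S2 NE mulr_sumr -sumrB; apply: eq_bigr => i _.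
    by rewrite sumrB -mulr_sumr uN.
  apply: (le_trans (ler_norm_sum _ _ _)).
  apply: (@le_trans _ _ (\sum_(i < N) 24 * `|a|)); last first.
    by rewrite sumr_const card_ord -[_ *+ N]mulr_natr; lra.
  apply: ler_sum => i _; apply: (le_trans (ler_norm_sum _ _ _)); rewrite sum3E.
  have h al : `|c i al ^+ 2 - a ^+ 2 * u i al ^+ 2| <= 8 * `|a|.
    have -> : c i al ^+ 2 - a ^+ 2 * u i al ^+ 2 =
      (c i al - a * u i al) * ((c i al - a * u i al) + 2 * (a * u i al)) by ring.
    rewrite normrM (_ : 8 * `|a| = 2 * (4 * `|a|)); last by ring.
    apply: ler_pM => //; apply: (le_trans (ler_normD _ _)).
    have : `|2 * (a * u i al)| <= 2 * `|a|.
      by rewrite !normrM normr_nat ler_pM2l// -[leRHS]mulr1 ler_pM.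
    by have := cu i al; lra.
  by have := (h cx, h cy, h cz) => -[[]]; lra.
have aS : 0 < S + `|a| * n by rewrite ltr_wpDl// mulr_gt0; lra.
have E : S ^+ 2 - a ^+ 2 * N%:R = (S - `|a| * n) * (S + `|a| * n).
  by rewrite -n2 -[a ^+ 2]ger0_norm ?sqr_ge0// normrX; ring.
move: key; rewrite E normrM (gtr0_norm aS) => key.
have : `|S - `|a| * n| * `|a| <= `|S - `|a| * n| * (S + `|a| * n).
  apply: ler_wpM2l => //; have : `|a| * 1 <= `|a| * n by rewrite ler_wpM2l.
  lra.
by move=> h; rewrite -(@ler_pM2r _ `|a|) ?(lt_le_trans ltr01)//; lra.
Qed.

Lemma confnorm_Ngon s : confnorm (@Ngon R N k s) = @ngon_radius R N k s * Num.sqrt N%:R.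
Proof.
set r := ngon_radius R N k s; have r0 : 0 < r by exact: ngon_radius_gt0.
rewrite /confnorm -[r in RHS]gtr0_norm// -sqrtr_sqr -sqrtrM ?sqr_ge0//.
have NE : N%:R = \sum_(i < N) 1 :> R by rewrite sumr_const card_ord.
congr Num.sqrt; rewrite NE mulr_sumr; apply: eq_bigr => i _.
rewrite sum3E /Ngon /ngon_r -/r ?eqxx ?coord_eqs expr0n/= addr0 mulr1.
by rewrite !exprMn -mulrDr cos2Dsin2 mulr1.
Qed.

Lemma normalized_rotating s (e : R) : 0 < e -> exists2 A : R, 1 <= A &
  forall (c : config R N) (a t : R), A <= `|a| -> (0 < a) = s ->
  (forall i al, `|c i al - a * ungon t i al| <= 2) ->
  confnorm (confsub (confscale (confnorm c)^-1 c)
             (confscale (confnorm (@Ngon R N k s))^-1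
                (confrot (- (k%:R * t)) (@Ngon R N k s)))) < e.
Proof.
move=> e0; have N1 : 1 <= N%:R :> R by rewrite ler1n N_gt0.
(* [2] bounds [c - a u], [24 N] is the error of the norm in [confnorm_rotating], and [3 N] is the
   constant of [confnorm_le]. *)
pose D := 3 * N%:R * (2 + 24 * N%:R) : R.
have D0 : 0 < D by rewrite /D; nra.
(* This threshold makes the norm of [c] exceed [D / e], because it is at least [|a| - 24 N]. *)
exists (24 * N%:R + D / e + 1) => [|c a t].
  have : 0 <= D / e by rewrite divr_ge0// ltW.
  lra.
move=> Aa sa cu; set n := Num.sqrt N%:R : R.
have n1 : 1 <= n by rewrite -[leLHS]sqrtr1 ler_wsqrtr.
have De : 0 < D / e by rewrite divr_gt0.
have a1 : 1 <= `|a| by lra.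
have := @confnorm_rotating c (ungon t) a (unit_ngon_le1 k t) (unit_ngon_sqr k t) a1 cu.
set S := confnorm c; rewrite -/n => Sa.
have an : `|a| <= `|a| * n by rewrite ler_peMr.
have SD : D / e < S by move: Sa; rewrite ler_norml => /andP[]; lra.
have S0 : 0 < S by lra.
apply: (@le_lt_trans _ _ (3 * N%:R * ((2 + 24 * N%:R) / S))); last first.
  by rewrite mulrA ltr_pdivrMr// -ltr_pdivrMl// mulrC.
apply: confnorm_le => i al; rewrite /confsub /confscale confnorm_Ngon -/n.
rewrite confrot_ngon_r//; set r := ngon_radius R N k s.
have r0 : 0 < r by exact: ngon_radius_gt0.
set u := ungon t i al.
have aE : a = `|a| * sgb s.
  rewrite -sa /sgb; case: ifPn => [/gtr0_norm ->|]; first by rewrite mulr1.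
  by rewrite -leNgt => /ler0_norm ->; ring.
have sg2 : `|sgb s : R| = 1 by rewrite /sgb; case: (s); rewrite ?normrN normr1.
have u1 : `|u| <= 1 by exact: unit_ngon_le1.
(* The first summand is the deviation from the polygon, the second the deviation of the norm; both
   are bounded quantities divided by [S]. *)
have -> : S^-1 * c i al - (r * n)^-1 * (r * sgb s * u) =
   (c i al - a * u) / S + (sgb s * u / n) * (`|a| * n - S) / S.
  by rewrite {1}aE; field; rewrite !gt_eqF//; lra.
rewrite [leRHS]mulrDl; apply: (le_trans (ler_normD _ _)); apply: lerD.
  by rewrite normrM normfV (gtr0_norm S0) ler_pM2r ?invr_gt0//; exact: cu.
rewrite normrM normfV (gtr0_norm S0) ler_pM2r ?invr_gt0// normrM distrC.
rewrite -[leRHS]mul1r; apply: ler_pM => //.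
rewrite !normrM sg2 mul1r normfV [`|n|]gtr0_norm; last by lra.
by rewrite ler_pdivrMr ?mul1r ?(le_trans u1)//; lra.
Qed.

Lemma escape_to_infinity s (qn : nat -> loop R N) :
  (forall n, admissible (ngon_signs s) (qn n)) ->
  act (qn n) @[n --> \oo] --> 0%E ->
  (forall M : R, exists n0 : nat, forall n, (n0 <= n)%N ->
     forall (i : 'I_N) (t : R), M < Num.sqrt (\sum_(a < 3) (qn n t i a) ^+ 2)) /\
  forall e : R, 0 < e -> exists n0 : nat, forall n, (n0 <= n)%N -> forall t : R,
    confnorm (confsub (confscale (confnorm (qn n t))^-1 (qn n t))
                (confscale (confnorm (@Ngon R N k s))^-1
                  (confrot (- (k%:R * t)) (@Ngon R N k s)))) < e.
Proof.
move=> qA q0.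
have ev (e : R) : 0 < e -> exists n0, forall n, (n0 <= n)%N -> (act (qn n) <= e%:E)%E.
  move=> e0; have : \forall n \near \oo, (act (qn n) < e%:E)%E.
    apply: (q0 [set x | (x < e%:E)%E]); apply: open_nbhs_nbhs; split => /=.
      exact: open_ereal_lt_ereal.
    by rewrite lte_fin.
  by move=> [n0 _ h]; exists n0 => n nn; apply: ltW; exact: h.
split.
(* Projecting a body onto its unit direction [u] loses at most 2 for each horizontal coordinate, so
   its distance from the origin is at least [|a| - 4]; the [5] leaves room for strict inequality. *)
- move=> M; have A0 : 0 < `|M| + 5 by rewrite ltr_wpDl.
  have [e e0 eP] := small_action_rotating s A0; have [n0 n0P] := ev e e0.
  exists n0 => n /n0P /(eP _ (qA n)) [a [Aa _ qa]] i t.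
  set u := fun al => unit_ngon k t i al : R.
  have u2 : u cx ^+ 2 + u cy ^+ 2 + u cz ^+ 2 = 1.
    by have := @unit_ngon_sqr R N k t i; rewrite sum3E.
  apply: (@lt_le_trans _ _ (`|a| - 4)); first by have := ler_norm M; lra.
  have [a4|a4] := leP `|a| 4; first by apply: le_trans (sqrtr_ge0 _); lra.
  rewrite -[leLHS]ger0_norm; last lra.
  rewrite -sqrtr_sqr ler_wsqrtr// sum3E.
  have uz : u cz = 0 by rewrite /u /unit_ngon !coord_eqs.
  have b (al : 'I_3) : `|(qn n t i al - a * u al) * u al| <= 2.
    rewrite normrM -[leRHS]mulr1; apply: ler_pM => //.
    exact: unit_ngon_le1.
  set x := qn n t i cx; set y := qn n t i cy; set z := qn n t i cz.
  have := b cx; have := b cy; rewrite -/x -/y; set P := _ * _; set Q := _ * _ => hP hQ.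
  have aE : a = x * u cx + y * u cy - P - Q.
    move: u2; rewrite uz expr0n/= addr0 => u2.
    transitivity (a * (u cx ^+ 2 + u cy ^+ 2)); first by rewrite u2 mulr1.
    by rewrite /P /Q; ring.
  have h1 : `|a| - 4 <= `|x * u cx + y * u cy|.
    rewrite {1}aE; have := ler_normB (x * u cx + y * u cy - P) Q.
    have := ler_normB (x * u cx + y * u cy) P; lra.
  have : (`|a| - 4) ^+ 2 <= (x * u cx + y * u cy) ^+ 2.
    rewrite -[leRHS]ger0_norm ?sqr_ge0// normrX lerXn2r ?nnegrE//; lra.
  move: u2; rewrite uz expr0n/= addr0; move: (u cx) (u cy) => v w vw h.
  apply: (le_trans h).
  have -> : x ^+ 2 + y ^+ 2 + z ^+ 2 = (x ^+ 2 + y ^+ 2) * (v ^+ 2 + w ^+ 2) + z ^+ 2.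
    by rewrite vw mulr1.
  have := sqr_ge0 (x * w - y * v); have := sqr_ge0 z; nra.
- move=> e e0; have [A A1 AP] := normalized_rotating s e0.
  have A0 : 0 < A by lra.
  have [e' e'0 eP] := small_action_rotating s A0; have [n0 n0P] := ev e' e'0.
  exists n0 => n /n0P /(eP _ (qA n)) [a [Aa sa qa]] t.
  by apply: (AP _ a) => // i al; exact: qa.
Qed.

End escaping.

(** * Completeness and weak compactness of L^2 *)

Section completeness.
Context {R : realType}.
Notation mu := (@lebesgue_measure R).
Notation II := [set` `[0%R, twopi R]].
Implicit Types (f g h : R -> R).
Notation sqn f := (\int[mu]_(x in II) (f x) ^+ 2).

Lemma limn_einf_le_ev (u : (\bar R)^nat) (B : \bar R) (n0 : nat) :
  (forall n, (n0 <= n)%N -> (u n <= B)%E) -> (limn_einf u <= B)%E.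
Proof.
move=> uB; rewrite limn_einf_lim; apply: lime_le; first exact: is_cvg_einfs.
exists n0 => // n /= nn; apply: (le_trans _ (uB n nn)).
by apply: ereal_inf_lbound; exists n => /=.
Qed.

Lemma sqn_ge0 f : 0 <= sqn f.
Proof. by apply: Rintegral_ge0 => x _; exact: sqr_ge0. Qed.

Lemma sqn_EFin f : L2 II f -> (sqn f)%:E = (\int[mu]_(x in II) ((f x) ^+ 2)%:E)%E.
Proof.
by move=> f2; rewrite /Rintegral fineK//; apply: integrable_fin_num => //; exact: L2_sqr.
Qed.

Lemma cauchy_bound (u s : R^nat) (K : R) : (forall n, `|u n.+1 - u n| <= s n) ->
  (forall n, \sum_(i < n) s i <= K) -> cvgn u.
Proof.
move=> us sK; have s0 n : 0 <= s n := le_trans (normr_ge0 _) (us n).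
have cs : cvgn (series s).
  apply: nondecreasing_is_cvgn.
    by apply/nondecreasing_seqP => n; rewrite /series/= big_nat_recr//= lerDl.
  by exists K => _ [n _ <-]; rewrite /series/= big_mkord.
have ct : cvgn (series (fun n => u n.+1 - u n)).
  by apply: normed_cvg; apply: series_le_cvg cs => // n; exact: normr_ge0.
rewrite (_ : u = fun n => u 0%N + series (fun n => u n.+1 - u n) n).
  by apply: cvgP; apply: cvgD; [exact: cvg_cst|exact: ct].
by apply/funext => n; rewrite /series/= telescope_sumr// addrC subrK.
Qed.

(** For such a fast Cauchy sequence the increments are summable in L^1, hence summable almost
    everywhere. Fatou's lemma then transfers the L^2 bound to the pointwise limit. *)
Lemma riesz_fischer (h : nat -> R -> R) : (forall n, L2 II (h n)) ->
  (forall n m, (n <= m)%N -> sqn (fun x => h m x - h n x) <= (4 ^+ n)^-1) ->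
  exists2 g, L2 II g & forall n, sqn (fun x => g x - h n x) <= (4 ^+ n)^-1.
Proof.
move=> h2 hc.
have hd n m : L2 II (fun x => h m x - h n x) by exact: L2B.
pose dl n x := `|h n.+1 x - h n x|.
have mdl n : measurable_fun II (dl n).
  by apply: measurableT_comp => //; case: (hd n n.+1).
have dli n : integ II (dl n) by apply: integ_abs => //; exact: L2_integII.
(* Integrating [y <= (2^n y^2 + 2^-n) / 2], with [y] the size of an increment, gives the bound
   [c / 2^n]. *)
pose c := 2^-1 * (1 + twopi R); have c0 : 0 < c.
  by rewrite /c mulr_gt0// addr_gt0// twopi_gt0.
have p2 n : 0 < 2 ^+ n :> R by rewrite exprn_gt0.
have dlb n : \int[mu]_(x in II) dl n x <= c / 2 ^+ n.
  have i1 : integ II (fun x => (h n.+1 x - h n x) ^+ 2) by apply: L2_sqr.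
  have i2 : integ II (fun x => 2 ^+ n * (h n.+1 x - h n x) ^+ 2) by exact: integZ.
  have i3 : integ II (cst (2 ^+ n)^-1) by apply: integ_cst => //; exact: IIoo.
  apply: (@le_trans _ _ (\int[mu]_(x in II)
     (2^-1 * (2 ^+ n * (h n.+1 x - h n x) ^+ 2 + (2 ^+ n)^-1)))).
    apply: le_Rintegral => //; [exact: dli|by apply: integZ => //; exact: integD|].
    move=> x _; rewrite /dl -[(_ - _) ^+ 2]ger0_norm ?sqr_ge0// normrX.
    move: `|_| => y; have := p2 n; move: (2 ^+ n) => p p0.
    have : 0 <= p * (y - p^-1) ^+ 2 by rewrite mulr_ge0 ?sqr_ge0// ltW.
    have -> : p * (y - p^-1) ^+ 2 = p * y ^+ 2 - 2 * y + p^-1.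
      by field; rewrite gt_eqF.
    lra.
  rewrite RintegralZl//; last exact: integD.
  rewrite RintegralD// RintegralZl// Rint_cst_itv ?(ltW twopi_gt0)// subr0.
  rewrite /c -mulrA ler_pM2l ?invr_gt0// mulrDl mul1r [twopi R * _]mulrC lerD2r.
  have := hc n n.+1 (leqnSn n).
  have -> : (4 ^+ n)^-1 = (2 ^+ n)^-1 * (2 ^+ n)^-1 :> R.
    by rewrite -invfM -exprMn; congr ((_ ^+ _)^-1); lra.
  by move=> H; rewrite -ler_pdivlMl.
have geo n : \sum_(i < n) c / 2 ^+ i <= 2 * c.
  suff -> : \sum_(i < n) c / 2 ^+ i = 2 * c - 2 * c / 2 ^+ n.
    rewrite lerBlDr lerDl; apply: divr_ge0; last exact: ltW.
    by rewrite mulr_ge0// ltW.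
  elim: n => [|n IH]; first by rewrite big_ord0 expr0 divr1 subrr.
  by rewrite big_ord_recr/= IH exprS; field; rewrite gt_eqF.
pose F x := (\sum_(n <oo) (dl n x)%:E)%E.
have F0 x : (0 <= F x)%E by apply: nneseries_ge0 => n _ _; rewrite lee_fin normr_ge0.
have mF : measurable_fun II F.
  apply: ge0_emeasurable_sum => [n x _ _|n _]; first by rewrite lee_fin normr_ge0.
  exact/measurable_EFinP.
have intF : (\int[mu]_(x in II) F x < +oo)%E.
  rewrite integral_nneseries//; last 2 first.
  - by move=> n; apply/measurable_EFinP; exact: mdl.
  - by move=> n x _; rewrite lee_fin normr_ge0.
  apply: (@le_lt_trans _ _ (2 * c)%:E); last by rewrite ltry.
  apply: lime_le.
    by apply: is_cvg_nneseries => n _ _; apply: integral_ge0 => x _; rewrite lee_fin normr_ge0.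
  apply: nearW => n; rewrite big_mkord.
  apply: (@le_trans _ _ (\sum_(i < n) (c / 2 ^+ i)%:E)%E).
    apply: lee_sum => i _; have := dlb i; rewrite -lee_fin => /(le_trans _); apply.
    rewrite /Rintegral fineK//; apply: integrable_fin_num => //; exact: dli.
  by rewrite sumEFin lee_fin.
have Fi : mu.-integrable II F.
  by apply/integrableP; split => //; under eq_integral do rewrite gee0_abs//.
have aecv : {ae mu, forall x, II x -> cvgn (fun n => h n x)}.
  have ? := ae_filter_ringOfSetsType mu.
  have aeF : {ae mu, forall x, II x -> F x \is a fin_num} by exact: integrable_ae.
  apply: filterS aeF => x Fx /Fx Ff.
  apply: (@cauchy_bound _ (fun n => dl n x) (fine (F x))) => // n.
  rewrite -lee_fin fineK// -sumEFin -(big_mkord xpredT (fun i => (dl i x)%:E)).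
  by apply: nneseries_lim_ge => i _; rewrite lee_fin normr_ge0.
(* The upper limit is measurable everywhere and equals the limit wherever the sequence converges. *)
pose g x := fine (limn_esup (fun n => (h n x)%:E)).
have mg : measurable_fun II g.
  apply: (@measurableT_comp _ _ _ _ _ _ fine) => //.
  by apply: measurable_fun_limn_esup => n; apply/measurable_EFinP; case: (h2 n).
have aeg : {ae mu, forall x, II x -> h n x @[n --> \oo] --> g x}.
  have ? := ae_filter_ringOfSetsType mu.
  apply: filterS aecv => x cvx /cvx cv.
  have ce : (h n x)%:E @[n --> \oo] --> (limn (fun n => h n x))%:E.
    by apply: cvg_EFin => //; apply: nearW.
  have -> : g x = limn (fun n => h n x); last exact: cv.
  by rewrite /g is_cvg_limn_esupE ?(cvg_lim _ ce)//; apply/cvg_ex; eexists; exact: ce.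
have key n : (\int[mu]_(x in II) ((g x - h n x) ^+ 2)%:E <= ((4 ^+ n)^-1)%:E)%E.
  pose f m x := ((h m x - h n x) ^+ 2)%:E.
  have mf m : measurable_fun II (f m).
    by apply/measurable_EFinP; apply: measurable_funX; case: (hd n m).
  have f0 m x : II x -> (0 <= f m x)%E by move=> _; rewrite lee_fin sqr_ge0.
  have := fatou mu mII mf f0.
  rewrite (_ : (\int[mu]_(x in II) limn_einf (f^~ x) =
                \int[mu]_(x in II) ((g x - h n x) ^+ 2)%:E)%E).
    move=> /le_trans; apply; apply: (@limn_einf_le_ev _ _ n) => m nm.
    by rewrite -sqn_EFin// lee_fin hc.
  apply: ae_eq_integral_nomeas; have ? := ae_filter_ringOfSetsType mu.
  apply: filterS aeg => x cgx /cgx cg.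
  have ce : f m x @[m --> \oo] --> ((g x - h n x) ^+ 2)%:E.
    apply: cvg_EFin; first by apply: nearW.
    have cb : h m x - h n x @[m --> \oo] --> g x - h n x.
      by apply: cvgB => //; exact: cvg_cst.
    rewrite expr2; apply: cvg_trans (cvgM cb cb); apply: near_eq_cvg.
    by apply: nearW => m /=; rewrite expr2.
  by rewrite is_cvg_limn_einfE ?(cvg_lim _ ce)//; apply/cvg_ex; eexists; exact: ce.
have gh0 n : L2 II (fun x => g x - h n x).
  split; last by apply: le_lt_trans (key n) _; rewrite ltry.
  by apply: measurable_funB => //; case: (h2 n).
have g2 : L2 II g.
  by have := L2D mII (gh0 0%N) (h2 0%N); apply: L2_ext => x _; rewrite subrK.
by exists g => // n; rewrite -lee_fin sqn_EFin.
Qed.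

(* Near-minimizers of the norm over nested midpoint-convex sets form a Cauchy
   sequence, by the parallelogram identity. *)
Lemma nested_convex_limit (S : nat -> set (R -> R)) (C : R) :
  (forall n h, S n h -> L2 II h) ->
  (forall n, S n.+1 `<=` S n) ->
  (forall n h1 h2, S n h1 -> S n h2 -> S n (fun x => 2^-1 * (h1 x + h2 x))) ->
  (forall n, exists2 h, S n h & sqn h <= C) ->
  exists2 g, L2 II g & exists2 h : nat -> R -> R, (forall n, S n (h n)) &
    forall n, sqn (fun x => g x - h n x) <= (4 ^+ n)^-1.
Proof.
move=> S2 Sdec Smid SC.
have Smono n m : (n <= m)%N -> S m `<=` S n.
  move=> /subnK <-; elim: (m - n)%N => [//|j IH].
  by apply: subset_trans IH; rewrite addSn.
pose E n := [set sqn h | h in S n].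
have E0 n : has_inf (E n).
  have [h Sh _] := SC n; split; first by exists (sqn h), h.
  by exists 0 => _ [f _ <-]; exact: sqn_ge0.
pose d n := inf (E n).
have dC n : d n <= C.
  have [h Sh hC] := SC n; apply: le_trans hC; apply: ge_inf; first by case: (E0 n).
  by exists h.
have dle n h : S n h -> d n <= sqn h.
  by move=> Sh; apply: ge_inf; [case: (E0 n)|exists h].
pose ds := sup (range d).
have hs : has_sup (range d).
  by split; [exists (d 0%N), 0%N|exists C => _ [n _ <-]].
have dds n : d n <= ds by apply: sup_upper_bound => //; exists n.
have dmono n m : (n <= m)%N -> d n <= d m.
  move=> nm; apply: lb_le_inf; first by case: (E0 m).
  by move=> _ [h Sh <-]; apply: dle; exact: Smono Sh.
(* In the parallelogram identity the errors add up to at most [2 eta + 2 eta + 4 eta], and [8 eta n]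
   is [1 / 4^n]. *)
pose eta (j : nat) : R := (4 ^+ j)^-1 / 8.
have p4 j : 0 < 4 ^+ j :> R by rewrite exprn_gt0.
have eta0 j : 0 < eta j by rewrite divr_gt0// invr_gt0.
(* The index [n >= j] is taken so large that the infimum [d n] is within [eta j] of the supremum
   [ds] of all infima; [h j] is then nearly norm-minimal in [S n]. *)
have /choice[h hP] j : exists h, exists n, [/\ (j <= n)%N, S n h,
    ds - d n < eta j & sqn h < ds + eta j].
  have [_ [n0 _ <-] hn0] := sup_adherent (eta0 j) hs.
  pose n := maxn n0 j.
  have [_ [f Sf <-] hf] := inf_adherent (eta0 j) (E0 n).
  exists f, n; split => //; first exact: leq_maxr.
    by have := dmono n0 n (leq_maxl _ _); rewrite -/ds in hn0; lra.
  by apply: (lt_le_trans hf); rewrite lerD2r; exact: dds.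
have hS j : S j (h j) by have [n [jn Sn _ _]] := hP j; exact: Smono Sn.
have h2 j : L2 II (h j) by exact: S2 (hS j).
have hc n m : (n <= m)%N -> sqn (fun x => h m x - h n x) <= (4 ^+ n)^-1.
  move=> nm; have [a [na Sa da ha]] := hP n; have [b [mb Sb db hb]] := hP m.
  have em : eta m <= eta n.
    rewrite ler_pM2r ?invr_gt0// lef_pV2 ?posrE// ler_weXn2l//; lra.
  pose r := minn a b; pose w x := 2^-1 * (h m x + h n x).
  have Sw : S r w.
    apply: Smid; [apply: Smono Sb; exact: geq_minr|apply: Smono Sa; exact: geq_minl].
  have dr : ds - d r < eta n.
    by rewrite /r; case: (leqP a b) => _ //; exact: lt_le_trans em.
  have i1 : integ II (fun x => h m x ^+ 2) by apply: L2_sqr.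
  have i2 : integ II (fun x => h n x ^+ 2) by apply: L2_sqr.
  have i3 : integ II (fun x => w x ^+ 2) by apply: L2_sqr => //; exact: S2 Sw.
  have -> : sqn (fun x => h m x - h n x) = 2 * sqn (h m) + 2 * sqn (h n) - 4 * sqn w.
    rewrite -!RintegralZl// -RintegralD//; [|exact: integZ|exact: integZ].
    rewrite -RintegralB//; [|by apply: integD => //; exact: integZ|exact: integZ].
    by apply: eq_Rintegral => x _; rewrite /w; field.
  have := dle r w Sw; move: ha hb dr em; rewrite /eta; lra.
have [g g2 gh] := riesz_fischer h2 hc.
by exists g => //; exists h.
Qed.

End completeness.

(** * Weak limits of derivatives *)

Section weak_compactness.
Context {R : realType}.
Notation mu := (@lebesgue_measure R).
Notation II := [set` `[0%R, twopi R]].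
Implicit Types (f g h v : R -> R).
Notation sqn f := (\int[mu]_(x in II) (f x) ^+ 2).

(** The Archimedean property, in the form used to dispose of errors of order [1 / n]. *)
Lemma le0_of_bounded_multiples (x K : R) : (forall n : nat, x * n.+1%:R <= K) -> x <= 0.
Proof.
move=> xK; rewrite leNgt; apply/negP => x0.
pose n := Num.bound `|K / x|.
have : K / x < n.+1%:R.
  apply: (le_lt_trans (ler_norm _)); apply: (lt_trans (archi_boundP _)) => //.
  by rewrite ltr_nat.
by rewrite ltr_pdivrMr// mulrC ltNge xK.
Qed.

Lemma succ_le_exp2 n : n.+1%:R <= 2 ^+ n :> R.
Proof. by rewrite -natrX ler_nat ltn_expl. Qed.

Lemma exp4V n : (4 ^+ n)^-1 = (2 ^+ n)^-1 * (2 ^+ n)^-1 :> R.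
Proof. by rewrite -invfM -exprMn; congr ((_ ^+ _)^-1); lra. Qed.

(** The weighted inequality [2 |a b| <= 2^n a^2 + 2^-n b^2] replaces Cauchy-Schwarz, and
    [n + 1 <= 2^n] puts the result in the form needed by [le0_of_bounded_multiples]. *)
Lemma L2_pairing_le u v n : L2 II u -> L2 II v -> sqn u <= (4 ^+ n)^-1 ->
  `|\int[mu]_(x in II) (u x * v x)| * n.+1%:R <= 1 + sqn v.
Proof.
move=> u2 v2 un; have iu := L2_sqr mII u2; have iv := L2_sqr mII v2.
have p0 : 0 < 2 ^+ n :> R by rewrite exprn_gt0.
have iuv := L2_mul mII u2 v2.
have le1 : `|\int[mu]_(x in II) (u x * v x)| <= 2 ^+ n * sqn u + (2 ^+ n)^-1 * sqn v.
  apply: (le_trans (le_normr_Rintegral _ iuv)) => //.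
  rewrite -!RintegralZl// -RintegralD//; [|exact: integZ|exact: integZ].
  apply: le_Rintegral => //; [exact: integ_abs|by apply: integD => //; exact: integZ|].
  move=> x _; move: (u x) (v x) p0 => a b; move: (2 ^+ n) => p p0.
  have h1 : p * a ^+ 2 + p^-1 * b ^+ 2 - 2 * (a * b) = p * (a - p^-1 * b) ^+ 2.
    by field; rewrite gt_eqF.
  have h2 : p * a ^+ 2 + p^-1 * b ^+ 2 + 2 * (a * b) = p * (a + p^-1 * b) ^+ 2.
    by field; rewrite gt_eqF.
  have s1 : 0 <= p * (a - p^-1 * b) ^+ 2 by rewrite mulr_ge0 ?sqr_ge0// ltW.
  have s2 : 0 <= p * (a + p^-1 * b) ^+ 2 by rewrite mulr_ge0 ?sqr_ge0// ltW.
  have s3 : 0 <= p * a ^+ 2 by rewrite mulr_ge0 ?sqr_ge0// ltW.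
  have s4 : 0 <= p^-1 * b ^+ 2 by rewrite mulr_ge0 ?sqr_ge0// invr_ge0 ltW.
  by rewrite ler_norml; apply/andP; split; lra.
have v0 := sqn_ge0 v; have u0 := sqn_ge0 u.
have le2 : 2 ^+ n * sqn u <= (2 ^+ n)^-1.
  by rewrite -ler_pdivlMl//; rewrite exp4V in un.
apply: (@le_trans _ _ ((2 ^+ n)^-1 * (1 + sqn v) * n.+1%:R)).
  by rewrite ler_wpM2r// mulrDr mulr1 (le_trans le1)// lerD2r.
rewrite mulrAC ler_piMl//; first by rewrite addr_ge0.
by rewrite mulrC ler_pdivrMr// mul1r succ_le_exp2.
Qed.

Lemma prim_pairing_le u t n : L2 II u -> II t -> sqn u <= (4 ^+ n)^-1 ->
  `|\int[mu]_(x in `[0, t]) u x| * n.+1%:R <= 1 + twopi R.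
Proof.
move=> u2 It un; move: (It); rewrite /= in_itv/= => /andP[t0 t2].
have T0 := @twopi_gt0 R.
have : (\int[mu]_(x in `[0, t]) u x) ^+ 2 <= twopi R * (4 ^+ n)^-1.
  have u2' : L2 `[0, t] u by exact: L2_sub.
  apply: (le_trans (cauchy_schwarz_itv t0 u2')); rewrite subr0.
  apply: ler_pM => //; first by apply: Rintegral_ge0 => x _; exact: sqr_ge0.
  by apply: le_trans un; exact: Rint_sqr_sub.
set y := Rintegral _ _ _; rewrite -ler_pdivrMr ?invr_gt0 ?exprn_gt0// invrK => h.
have : (`|y| * n.+1%:R) ^+ 2 <= twopi R.
  apply: le_trans h; rewrite exprMn -normrX ger0_norm ?sqr_ge0// ler_wpM2l ?sqr_ge0//.
  have -> : 4 ^+ n = (2 ^+ n) ^+ 2 :> R by rewrite -exprM mulnC exprM; congr (_ ^+ _); lra.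
  by rewrite lerXn2r ?nnegrE// ?exprn_ge0// succ_le_exp2.
have : 0 <= `|y| * n.+1%:R by rewrite mulr_ge0.
move: (`|y| * n.+1%:R) => z; nra.
Qed.

Section limit.
Variables (fn gn : nat -> R -> R) (f : R -> R) (C : R).
Hypothesis pn : forall n, prim (fn n) (gn n).
Hypothesis gC : forall n, sqn (gn n) <= C.
Hypothesis fnf : forall e : R, 0 < e -> exists n0, forall n, (n0 <= n)%N ->
  forall t, II t -> `|fn n t - f t| <= e.

(** The nested midpoint-convex sets for the norm-minimizing argument; each contains [gn m] for all
    large [m]. The constant 2 covers the error of [fn] at [t] and at [0]. *)
Definition almost_primitive n h := L2 II h /\
  forall t : R, II t -> `|f 0 + \int[mu]_(x in `[0, t]) h x - f t| <= 2 / n.+1%:R.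

Let n0 n : 0 < n.+1%:R :> R. Proof. by rewrite ltr0n. Qed.

(** The defect of [h n] and the difference between the primitives of [g] and [h n] are both of order
    [1 / n]. *)
Lemma almost_primitive_limit (h : nat -> R -> R) g : L2 II g -> (forall n, almost_primitive n (h n)) ->
  (forall n, sqn (fun x => g x - h n x) <= (4 ^+ n)^-1) -> prim f g.
Proof.
move=> g2 hS gh; split => // t tI.
have It : II t by rewrite /= in_itv.
case/andP: (tI) => t0 t2.
apply/eqP; rewrite eq_sym -subr_eq0 -normr_le0.
apply: (@le0_of_bounded_multiples _ (2 + (1 + twopi R))) => n.
have [h2 hn] := hS n.
have gh2 : L2 II (fun x => g x - h n x) by exact: L2B.
have := prim_pairing_le gh2 It (gh n).
rewrite RintegralB//; [|by apply: integ_sub => //; exact: L2_integII..].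
have := hn t It; rewrite ler_pdivlMr//.
move: (\int[mu]_(x in `[0, t]) g x) (\int[mu]_(x in `[0, t]) h n x) => G H h1 h3.
have -> : f 0 + G - f t = (f 0 + H - f t) + (G - H) by ring.
apply: le_trans (lerD h1 h3); rewrite -mulrDl ler_wpM2r//.
exact: ler_normD.
Qed.

Lemma almost_primitive_mid n h1 h2 : almost_primitive n h1 -> almost_primitive n h2 ->
  almost_primitive n (fun x => 2^-1 * (h1 x + h2 x)).
Proof.
move=> [h12 H1] [h22 H2]; split; first by apply: L2Z => //; exact: L2D.
move=> t It; have := H1 t It; have := H2 t It.
move: (It); rewrite /= in_itv/= => /andP[t0 t2].
have i1 : integ `[0, t] h1 by apply: integ_sub => //; exact: L2_integII.
have i2 : integ `[0, t] h2 by apply: integ_sub => //; exact: L2_integII.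
rewrite RintegralZl//; last exact: integD.
rewrite RintegralD//; set a := \int[mu]_(x in `[0, t]) h1 x.
set b := \int[mu]_(x in `[0, t]) h2 x.
move: (2 / n.+1%:R) a b => z a b.
by rewrite !ler_norml => /andP[? ?] /andP[? ?]; apply/andP; split; lra.
Qed.

Lemma almost_primitive_dec n : almost_primitive n.+1 `<=` almost_primitive n.
Proof.
move=> h [h2 H]; split => // t It; apply: (le_trans (H t It)).
by rewrite ler_pM2l// lef_pV2 ?posrE// ler_nat.
Qed.

Lemma almost_primitive_ev n : exists m0, forall m, (m0 <= m)%N -> almost_primitive n (gn m).
Proof.
have e0 : 0 < n.+1%:R^-1 :> R by rewrite invr_gt0.
have [m0 hm0] := fnf e0; exists m0 => m mm; have [g2 fg] := pn m; split => // t It.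
have I0 : II (0 : R) by rewrite /= in_itv/= lexx ltW// twopi_gt0.
have := hm0 m mm t It; have := hm0 m mm 0 I0; rewrite (fg t); last first.
  by move: It; rewrite /= in_itv.
move: (Rintegral _ _ _) (n.+1%:R^-1) => G z; rewrite !ler_norml => /andP[? ?] /andP[? ?].
by apply/andP; split; lra.
Qed.

Lemma weak_limit : exists2 g, prim f g & forall v, L2 II v ->
  forall e : R, 0 < e -> exists n0, forall n, (n0 <= n)%N ->
  `|\int[mu]_(x in II) (gn n x * v x) - \int[mu]_(x in II) (g x * v x)| < e.
Proof.
have [g g2 [h hS gh]] := @nested_convex_limit R almost_primitive C
  (fun n h => @proj1 _ _) almost_primitive_dec almost_primitive_mid
  (fun n => let: ex_intro m0 hm := almost_primitive_ev n in
            ex_intro2 _ _ (gn m0) (hm m0 (leqnn _)) (gC m0)).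
have pg := almost_primitive_limit g2 hS gh.
exists g => //.
have one v : L2 II v -> forall e : R, 0 < e -> exists n0, forall n, (n0 <= n)%N ->
    \int[mu]_(x in II) (gn n x * v x) - \int[mu]_(x in II) (g x * v x) < e.
  move=> v2 e e0; apply: contrapT => /forallNP nex.
  have ex m : exists2 n, (m <= n)%N &
      e <= \int[mu]_(x in II) (gn n x * v x) - \int[mu]_(x in II) (g x * v x).
    have /existsNP[n /not_implyP[mn /negP]] := nex m.
    by rewrite -leNgt => h1; exists n.
  (* If the pairing with [v] exceeded its expected value by [e] infinitely often, the sets could be
     cut with a half-space and would still be nonempty and midpoint-convex. The new limit [g'] would
     violate [g' = g] almost everywhere. *)
  pose S n h := almost_primitive n h /\
     e <= \int[mu]_(x in II) (h x * v x) - \int[mu]_(x in II) (g x * v x).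
  have Smid n h1 h2 : S n h1 -> S n h2 -> S n (fun x => 2^-1 * (h1 x + h2 x)).
    move=> [a1 b1] [a2 b2]; split; first exact: almost_primitive_mid.
    have i1 : integ II (fun x => h1 x * v x) by apply: L2_mul => //; case: a1.
    have i2 : integ II (fun x => h2 x * v x) by apply: L2_mul => //; case: a2.
    have -> : \int[mu]_(x in II) (2^-1 * (h1 x + h2 x) * v x) =
        2^-1 * (\int[mu]_(x in II) (h1 x * v x) + \int[mu]_(x in II) (h2 x * v x)).
      rewrite -RintegralD// -RintegralZl//; last exact: integD.
      by apply: eq_Rintegral => x _; ring.
    lra.
  have Sne n : exists2 h, S n h & sqn h <= C.
    have [m0 hm0] := almost_primitive_ev n; have [m mm em] := ex m0.
    by exists (gn m); [split => //; exact: hm0|exact: gC].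
  have [g' g'2 [h' hS' gh']] := @nested_convex_limit R S C
    (fun n h (H : S n h) => proj1 (proj1 H))
    (fun n h (H : S n.+1 h) => conj (almost_primitive_dec (proj1 H)) (proj2 H))
    Smid Sne.
  have pg' := almost_primitive_limit g'2 (fun n => proj1 (hS' n)) gh'.
  have E : \int[mu]_(x in II) (g' x * v x) = \int[mu]_(x in II) (g x * v x).
    apply: ae_eq_Rintegral; have ? := ae_filter_ringOfSetsType mu.
    by apply: filterS (prim_uniq pg' pg) => x H /H ->.
  have : e <= 0; last by rewrite leNgt e0.
  apply: (@le0_of_bounded_multiples _ (1 + sqn v)) => n.
  have [[h'2 _] he] := hS' n.
  have d2 : L2 II (fun x => g' x - h' n x) by exact: L2B.
  have := L2_pairing_le d2 v2 (gh' n).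
  rewrite (@eq_Rintegral _ _ _ mu _ (fun x => g' x * v x - h' n x * v x)); last first.
    by move=> x _; ring.
  rewrite RintegralB//; [|exact: L2_mul|exact: L2_mul].
  rewrite E distrC => H; apply: le_trans H; rewrite ler_wpM2r//.
  exact: le_trans (ler_norm _).
move=> v v2 e e0; have [n1 h1] := one v v2 e e0.
(* The opposite inequality is the same statement for [- v]. *)
have [n2 h2] := one (fun x => (-1) * v x) (L2Z (-1) mII v2) e e0.
exists (maxn n1 n2) => n; rewrite geq_max => /andP[/h1 a1 /h2 a2].
have N' w : L2 II w -> \int[mu]_(x in II) (w x * ((-1) * v x)) =
    - \int[mu]_(x in II) (w x * v x).
  move=> w2; rewrite -[RHS]mulN1r -RintegralZl//; last exact: L2_mul.
  by apply: eq_Rintegral => x _; ring.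
have gn2 : L2 II (gn n) by case: (pn n).
by rewrite !N'// in a2; rewrite ltr_norml; apply/andP; split; lra.
Qed.

End limit.

End weak_compactness.

(** * A collision-free loop with prescribed signs, and uniform extraction *)

Section admissible_nonempty.
Context {R : realType}.
Notation mu := (@lebesgue_measure R).
Notation II := [set` `[0%R, twopi R]].

Definition C1 (f : R -> R) := exists2 f' : R -> R,
  forall t : R, is_derive t (1 : R) f (f' t) & continuous f'.

Lemma C1_cst (c : R) : C1 (fun=> c).
Proof. by exists (fun=> 0) => [t|x]; [exact: is_derive_cst|exact: cvg_cst]. Qed.

Lemma C1_continuous f : C1 f -> continuous f.
Proof. by move=> [f' df _]; exact: is_derive_continuous df. Qed.

Lemma C1D f g : C1 f -> C1 g -> C1 (fun t => f t + g t).
Proof.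
move=> [f' df cf] [g' dg cg]; exists (fun t => f' t + g' t).
  by move=> t; have h1 := df t; have h2 := dg t; exact: is_deriveD.
by move=> x; apply: cvgD; [exact: cf|exact: cg].
Qed.

Lemma C1M f g : C1 f -> C1 g -> C1 (fun t => f t * g t).
Proof.
move=> Cf Cg; have cf' := C1_continuous Cf; have cg' := C1_continuous Cg.
move: Cf Cg => [f' df cf] [g' dg cg]; exists (fun t => f t * g' t + g t * f' t).
  by move=> t; have h1 := df t; have h2 := dg t; exact: is_deriveM.
move=> x; apply: cvgD; apply: cvgM; by [exact: cf'|exact: cg|exact: cg'|exact: cf].
Qed.

Lemma C1_cos : C1 cos.
Proof.
exists (fun t => - sin t) => [t|x]; first exact: is_derive_cos.
by apply: cvgN; exact: continuous_sin.
Qed.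

Lemma C1_sin : C1 sin.
Proof. by exists cos => [t|x]; [exact: is_derive_sin|exact: continuous_cos]. Qed.

Lemma C1_sum (I : Type) (s : seq I) (P : pred I) (F : I -> R -> R) :
  (forall i, C1 (F i)) -> C1 (fun t => \sum_(i <- s | P i) F i t).
Proof.
move=> CF; elim: s => [|i s IH].
  by under eq_fun do rewrite big_nil; exact: C1_cst.
under eq_fun do rewrite big_cons; case: (P i) => //; exact: C1D.
Qed.

Lemma C1_prod (I : Type) (s : seq I) (P : pred I) (F : I -> R -> R) :
  (forall i, C1 (F i)) -> C1 (fun t => \prod_(i <- s | P i) F i t).
Proof.
move=> CF; elim: s => [|i s IH].
  by under eq_fun do rewrite big_nil; exact: C1_cst.
under eq_fun do rewrite big_cons; case: (P i) => //; exact: C1M.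
Qed.

Lemma C1_H1fun f (s : R) : (forall t, f (t + 2 * pi) = f t) -> C1 f ->
  H1fun (fun t => f (t + s)).
Proof.
move=> fp [f' df cf]; apply/H1funP; split.
  by move=> t; rewrite -[RHS]fp; congr f; ring.
exists (fun t => 1 * f' (s + 1 * t)).
have -> : (fun t => f (t + s)) = fun t => f (s + 1 * t).
  by apply/funext => t; congr f; ring.
apply: prim_C1; first by move=> t; exact: is_derive_affine.
have cc := continuous_affine (a := s) (b := 1) cf.
by move=> x; apply: cvgM; [exact: cvg_cst|exact: cc].
Qed.

Variable N : nat.
Hypothesis hN : (2 <= N)%N.
Variable xi : Xi N.
Notation o0 := (o0 hN).

Definition stime (j : 'I_N.-1) : R := j.+1%:R * pi / N%:R.

Lemma stime_itv j : 0 < stime j < pi. Proof. exact: time_itv. Qed.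

Lemma cos_stime_inj : injective (fun j => cos (stime j)).
Proof.
move=> i j; have /andP[i0 i1] := stime_itv i; have /andP[j0 j1] := stime_itv j.
move=> /cos_inj; rewrite !in_itv/= !ltW// => /(_ isT isT).
have N0 := @N_neq0 R N hN; have p0 : pi != 0 :> R by rewrite gt_eqF ?pi_gt0.
rewrite /stime => /(mulIf (invr_neq0 N0)) /(mulIf p0).
by move=> /eqP; rewrite eqr_nat eqSS => /eqP; exact: val_inj.
Qed.

(** The unnormalized Lagrange basis polynomial for the nodes [cos(stime j)], which are distinct
    because cosine is injective on [[0, pi]]. *)
Definition lagr (j : 'I_N.-1) (c : R) : R :=
  \prod_(m < N.-1 | m != j) (c - cos (stime m)).

Definition interp (c : R) : R :=
  \sum_(j < N.-1) sgb (xi j) / lagr j (cos (stime j)) * lagr j c.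

Lemma lagr_neq0 j : lagr j (cos (stime j)) != 0.
Proof.
rewrite /lagr; apply/prodf_neq0 => m mj; rewrite subr_eq0.
by apply: contra mj => /eqP /cos_stime_inj ->.
Qed.

Lemma interpE j : interp (cos (stime j)) = sgb (xi j).
Proof.
rewrite /interp (bigD1 j)//= mulfVK ?lagr_neq0// big1 ?addr0// => m mj.
by rewrite [X in _ * X](bigD1 j) 1?eq_sym//= subrr mul0r mulr0.
Qed.

(** The factor [sin t] makes the function odd, as the reflection requires, and is positive at the
    sign times; the polynomial in [cos t] is even and takes the values [xi] there. *)
Definition base_y (t : R) : R := sin t * interp (cos t).

Lemma C1_base_y : C1 base_y.
Proof.
apply: C1M; first exact: C1_sin.
apply: C1_sum => j; apply: C1M; first exact: C1_cst.
apply: C1_prod => m; apply: C1D; [exact: C1_cos|exact: C1_cst].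
Qed.

Lemma cos_add2pi (t : R) : cos (t + 2 * pi) = cos t.
Proof. by rewrite -[in RHS](cosDk2pi 1 t) mul1r. Qed.

Lemma sin_add2pi (t : R) : sin (t + 2 * pi) = sin t.
Proof. by rewrite -[in RHS](sinDk2pi 1 t) mul1r. Qed.

Definition base_loop : loop R N := fun t i a =>
  let s := t + 2 * pi * i%:R / N%:R in
  if a == cx then cos s else if a == cy then base_y s else 0.

Lemma base_loop_loop : is_loop base_loop.
Proof.
move=> i a; rewrite /base_loop; have [->|->|->] := I3P a; rewrite ?eqxx ?coord_eqs.
- by apply: C1_H1fun; [exact: cos_add2pi|exact: C1_cos].
- apply: C1_H1fun; last exact: C1_base_y.
  by move=> t; rewrite /base_y cos_add2pi sin_add2pi.
- by apply: (@C1_H1fun (fun=> 0) 0) => //; exact: C1_cst.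
Qed.

Lemma base_loop_DN : loopsDN base_loop.
Proof.
split; first exact: base_loop_loop.
split => t.
  by move=> i a; rewrite body0E /base_loop/= mulr0 mul0r addr0.
move=> a; rewrite !body0E /base_loop/= mulr0 mul0r !addr0.
have -> : 2 * pi - t = - t + 2 * pi by ring.
rewrite /base_y cos_add2pi sin_add2pi cosN sinN mulNr.
by have [->|->|->] := I3P a; rewrite ?eqxx ?coord_eqs.
Qed.

Lemma interp_neq0 m : (0 < m < N)%N -> interp (cos (m%:R * pi / N%:R)) != 0.
Proof.
case: m => // m /= mN; have mN1 : (m < N.-1)%N by rewrite ltn_predRL.
by have := interpE (Ordinal mN1); rewrite /stime/= => ->; exact: sgb_neq0.
Qed.

(* If [cos s = cos s'] at distinct bodies then [s' = - s] mod [2 pi] and [s] is one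
   of the times [m pi / N], where [base_y] is odd and nonzero. *)
Lemma base_loop_collision_free : collision_free base_loop.
Proof.
move=> t; suff H (i j : 'I_N) : (j < i)%N -> base_loop t i <> base_loop t j.
  move=> i j; rewrite -val_eqE /= neq_ltn => /orP[ij|]; last exact: H.
  by move=> /esym; exact: H.
move=> ji e; have := congr1 (fun c => c cx) e; have := congr1 (fun c => c cy) e.
rewrite /base_loop !eqxx !coord_eqs; set A := t + _; set B := t + _ => ye ce.
have N0 := @N_neq0 R N hN.
pose m := (i - j)%N; have m0 : (0 < m)%N by rewrite subn_gt0.
have mN : (m < N)%N by rewrite (leq_ltn_trans (leq_subr _ _)).
pose S := (A + B) / 2; pose D := m%:R * pi / N%:R : R.
have DE : D = (A - B) / 2.
  by rewrite /D /A /B /m natrB ?(ltnW ji)//; field.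
have AE : A = S + D by rewrite DE /S; field.
have BE : B = S - D by rewrite DE /S; field.
have sD : sin D != 0.
  apply: sin_pi_frac_neq0; first exact: N_gt0.
  by apply/negP => /dvdn_leq; rewrite m0 => /(_ isT); rewrite leqNgt mN.
(* [cos A - cos B = - 2 sin S sin D], and [D] is a multiple of [pi / N] strictly between [0] and
   [pi]. *)
have sS : sin S = 0.
  have : sin S * sin D = 0 by move: ce; rewrite AE BE cosD cosB; lra.
  by move=> /eqP; rewrite mulf_eq0 (negbTE sD) orbF => /eqP.
have c1 : cos S ^+ 2 = 1 by have := cos2Dsin2 S; rewrite sS expr0n/= addr0.
have cA : cos A = cos S * cos D by rewrite AE cosD sS mul0r subr0.
have cB : cos B = cos S * cos D by rewrite BE cosB sS mul0r addr0.
have sA : sin A = cos S * sin D by rewrite AE sinD sS mul0r add0r.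
have sB : sin B = - (cos S * sin D) by rewrite BE sinB sS mul0r sub0r.
have cS0 : cos S != 0 by rewrite -sqrf_eq0 c1 oner_eq0.
have : cos S * sin D * interp (cos S * cos D) = 0.
  by move: ye; rewrite /base_y cA cB sA sB; lra.
move=> /eqP; rewrite !mulf_eq0 (negbTE cS0) (negbTE sD)/=; apply/negP.
(* For [cos S = 1] the polynomial is evaluated at the node of index [m], for [cos S = -1] at that of
   index [N - m]; it vanishes at neither. *)
move/eqP: c1; rewrite sqrf_eq1 => /orP[/eqP ->|/eqP ->].
  by rewrite mul1r; apply: interp_neq0; rewrite m0.
rewrite mulN1r.
have -> : - cos D = cos ((N - m)%:R * pi / N%:R).
  have -> : (N - m)%:R * pi / N%:R = - D + pi :> R.
    by rewrite /D natrB ?(ltnW mN)//; field.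
  by rewrite cosDpi cosN.
by apply: interp_neq0; rewrite subn_gt0 mN ltn_subrL m0 N_gt0.
Qed.

Lemma base_loop_signs : has_signs xi base_loop.
Proof.
move=> j /=; rewrite body0E /base_loop !coord_eqs eqxx/= mulr0 mul0r addr0.
rewrite -/(stime j) /base_y interpE.
have s0 : 0 < sin (stime j) by apply: sin_gt0_pi; exact: stime_itv.
by rewrite /sgb; case: (xi j); rewrite ?mulr1// mulrN1 oppr_lt0.
Qed.

(** The curve is collision-free and lies in the horizontal plane, so it has the prescribed signs and
    mean zero; it starts the minimization for every [xi]. *)
Lemma admissible_neq0 : exists q : loop R N, admissible xi q.
Proof.
exists base_loop; split.
  split; first exact: base_loop_DN.
  apply: weak_closure_self; split; first exact: base_loop_DN.
  by split; [exact: base_loop_collision_free|exact: base_loop_signs].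
rewrite /mean_z0 (@eq_Rintegral _ _ _ mu _ (cst 0)).
  by rewrite Rintegral_cst// mul0r mulr0.
by move=> t _; rewrite body0E /base_loop !coord_eqs.
Qed.

End admissible_nonempty.

(** * Uniformly convergent subsequences *)

Section extraction.
Context {R : realType}.
Notation II := [set` `[0%R, twopi R]].
Variable N : nat.

Lemma ultra_bounded_cvg (G : set_system nat) (u : nat -> R) (B : R) : UltraFilter G ->
  (forall n, `|u n| <= B) ->
  exists l : R, forall e, 0 < e -> G [set n | `|u n - l| < e].
Proof.
move=> GU uB; have GP : ProperFilter G by exact: ultra_proper.
have FA : (u @ G) [set` `[- B, B]].
  suff : G [set n | [set` `[- B, B]] (u n)] by [].
  apply: (@filterS _ G _ setT); last exact: filterT.
  by move=> n _; rewrite /= in_itv/= -ler_norml; exact: uB.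
have [l [_ cl]] := @segment_compact R (- B) B _ (fmap_proper_filter u GP) FA.
exists l => e e0; have [//|Gn] := in_ultra_setVsetC [set n | `|u n - l| < e] GU.
have nl : nbhs l (ball l e) by exact: nbhsx_ballx.
have Fc : (u @ G) (~` ball l e).
  suff : G [set n | ~ ball l e (u n)] by [].
  apply: (@filterS _ G _ _ _ _ Gn) => n /= h; rewrite /ball/= /ball_/= => h2.
  by apply: h; rewrite distrC.
by have [y []] := cl _ _ Fc nl.
Qed.

(** An Arzela-Ascoli argument: one ultrafilter gives limits at all times simultaneously, without a
    diagonal sequence, and the Hoelder bound makes the convergence uniform through a finite grid. *)
Lemma uniform_extraction (qn : nat -> loop R N) (B C : R) :
  (forall n t i a, qn n (t + 2 * pi) i a = qn n t i a) ->
  (forall n t i a, `|qn n t i a| <= B) ->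
  (forall n s t i a, 0 <= s -> s <= t -> t <= twopi R ->
     (qn n t i a - qn n s i a) ^+ 2 <= (t - s) * C) ->
  exists (q : loop R N) (phi : nat -> nat),
    [/\ forall n, (n <= phi n)%N, forall t i a, q (t + 2 * pi) i a = q t i a &
     forall n t i a, `|qn (phi n) t i a - q t i a| <= n.+1%:R^-1].
Proof.
move=> qper qB qH.
have [G [GU subG]] := @ultraFilterLemma _ (nbhs \oo) _.
have GP : ProperFilter G by exact: ultra_proper.
have /choice[ql qlP] (x : R * 'I_N * 'I_3) : exists l : R, forall e, 0 < e ->
    G [set n | `|qn n x.1.1 x.1.2 x.2 - l| < e].
  exact: (@ultra_bounded_cvg G (fun n => qn n x.1.1 x.1.2 x.2) B).
pose q : loop R N := fun t i a => ql (mod2pi t, i, a).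
have T0 := @twopi_gt0 R.
(* Five errors of size [e]: two Hoelder steps between [t] and a grid point, the convergence of index
   [n] at the grid point, and that of an auxiliary index [n'] at the grid point and at [t]. *)
have close e : 0 < e ->
    G [set n | forall t i a, `|qn n t i a - q t i a| <= 5 * e].
  move=> e0.
  (* The mesh is chosen so that its product with [C] is at most [e^2]. *)
  pose M := Num.bound `|twopi R * C / e ^+ 2|.
  have e2 : 0 < e ^+ 2 by rewrite exprn_gt0.
  have hM : twopi R / M.+1%:R * C <= e ^+ 2.
    have : twopi R * C / e ^+ 2 < M.+1%:R.
      apply: (le_lt_trans (ler_norm _)); apply: (lt_trans (archi_boundP _)) => //.
      by rewrite ltr_nat.
    by rewrite ltr_pdivrMr// => /ltW h; rewrite mulrAC ler_pdivrMr ?ltr0n// [leRHS]mulrC.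
  pose grid (m : 'I_M.+1) : R := twopi R * m%:R / M.+1%:R.
  have Ggrid : G [set n | forall x : 'I_M.+1 * 'I_N * 'I_3,
      `|qn n (grid x.1.1) x.1.2 x.2 - ql (grid x.1.1, x.1.2, x.2)| < e].
    apply: filter_forall => x; exact: (qlP (grid x.1.1, x.1.2, x.2)).
  apply: filterS Ggrid => n /= hn t i a.
  rewrite /q -(mod2piE (f := fun t => qn n t i a) t (fun t => qper n t i a)).
  have /andP[t0 t2] := @mod2pi_itv R t; move: (mod2pi t) t0 t2 => {}t t0 t2.
  have [m [mt tm]] : exists m : 'I_M.+1, grid m <= t /\ t - grid m <= twopi R / M.+1%:R.
    have M0 : 0 < M.+1%:R :> R by rewrite ltr0n.
    have x0 : 0 <= t * M.+1%:R / twopi R.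
      by apply: divr_ge0; [exact: mulr_ge0|exact: ltW].
    have /andP[h1 h2] := truncn_itv x0.
    set m := Num.truncn _ in h1 h2.
    have mM : (m < M.+1)%N.
      rewrite -(ltr_nat R); apply: (le_lt_trans h1).
      by rewrite ltr_pdivrMr// mulrC ltr_pM2l.
    exists (Ordinal mM); rewrite /grid/=; split.
      by rewrite ler_pdivrMr// mulrC -ler_pdivlMr.
    move: h2; rewrite ltr_pdivrMr// -(natr1 m) mulrDl mul1r => /ltW h2.
    by rewrite lerBlDr -mulrDl ler_pdivlMr//; lra.
  have gm0 : 0 <= grid m by apply: divr_ge0 => //; apply: mulr_ge0 => //; exact: ltW.
  have hold n' : `|qn n' t i a - qn n' (grid m) i a| <= e.
    rewrite -(ger0_norm (ltW e0)) -ler_sqr ?nnegrE// !real_normK ?num_real//.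
    apply: le_trans hM; have C0 : 0 <= C.
      have := qH n' 0 (twopi R) i a (lexx 0) (ltW T0) (lexx _); rewrite subr0.
      by move=> /(le_trans (sqr_ge0 _)); rewrite pmulr_rge0.
    apply: (le_trans (qH n' _ _ i a gm0 mt (ltW t2))).
    by rewrite ler_wpM2r.
  (* [n'] may depend on [t]: it only carries the Hoelder bound over to the limit function. *)
  have [n' [a1 a2]] : exists n', `|qn n' t i a - ql (t, i, a)| < e /\
      `|qn n' (grid m) i a - ql (grid m, i, a)| < e.
    have /filter_ex[n' [? ?]] : G ([set n | `|qn n t i a - ql (t, i, a)| < e] `&`
        [set n | `|qn n (grid m) i a - ql (grid m, i, a)| < e]).
      by apply: filterI; [exact: (qlP (t, i, a) e e0)|exact: (qlP (grid m, i, a) e e0)].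
    by exists n'.
  have b1 := hold n'; have b2 := hold n; have b3 := hn (m, i, a) => /=.
  move: a1 a2 b1 b2 b3 => /=.
  move: (qn n' t i a) (qn n' (grid m) i a) (qn n t i a) (qn n (grid m) i a)
    (ql (t, i, a)) (ql (grid m, i, a)) => x1 x2 x3 x4 x5 x6.
  rewrite !ltr_norml !ler_norml => /andP[? ?] /andP[? ?] /andP[? ?] /andP[? ?] /andP[? ?].
  by apply/andP; split; lra.
(* [phi] need not be increasing; [j <= phi j] is all that the passage to the limit uses. *)
have /choice[phi phiP] j : exists n, (j <= n)%N /\
    forall t i a, `|qn n t i a - q t i a| <= j.+1%:R^-1.
  have e0 : 0 < j.+1%:R^-1 / 5 :> R by rewrite divr_gt0// invr_gt0 ltr0n.
  have Gj : G [set n | (j <= n)%N] by apply: subG; exists j.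
  have /filter_ex[n [nj nc]] : G ([set n | (j <= n)%N] `&`
      [set n | forall t i a, `|qn n t i a - q t i a| <= 5 * (j.+1%:R^-1 / 5)]).
    by apply: filterI => //; exact: close.
  by exists n; split => // t i a; have := nc t i a; rewrite mulrCA divff ?mulr1.
exists q, phi; split.
- by move=> n; case: (phiP n).
- by move=> t i a; rewrite /q mod2piD.
- by move=> n; case: (phiP n).
Qed.

End extraction.

(** * Existence of a minimizer *)

Section weak_convergence.
Context {R : realType}.
Notation mu := (@lebesgue_measure R).
Notation II := [set` `[0%R, twopi R]].
Notation sqn f := (\int[mu]_(x in II) (f x) ^+ 2).

(** Weak convergence in L^2 over one period. *)
Definition wcv (un : nat -> R -> R) (u : R -> R) := forall v, L2 II v ->
  \int[mu]_(x in II) (un n x * v x) @[n --> \oo] --> \int[mu]_(x in II) (u x * v x).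

Lemma near_inv_lt (e : R) : 0 < e -> \forall n \near \oo, n.+1%:R^-1 < e.
Proof.
move=> e0; exists (Num.bound e^-1) => // n /= ne.
rewrite -[ltRHS]invrK ltf_pV2 ?posrE ?invr_gt0// ?ltr0n//.
apply: (lt_trans (archi_boundP _)); first by rewrite invr_ge0 ltW.
by rewrite ltr_nat ltnS.
Qed.

Lemma uniform_wcv (fn : nat -> R -> R) f : (forall n, L2 II (fn n)) -> L2 II f ->
  (forall n t, II t -> `|fn n t - f t| <= n.+1%:R^-1) -> wcv fn f.
Proof.
move=> fn2 f2 fnf v v2; apply/cvgrPdist_lt => e e0.
have vi := L2_integII v2; pose V := \int[mu]_(x in II) `|v x|.
have V0 : 0 <= V by apply: Rintegral_ge0.
have eV : 0 < e / (V + 1) by rewrite divr_gt0// ltr_wpDl.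
apply: filterS (near_inv_lt eV) => n nV.
have ifn := L2_mul mII (fn2 n) v2; have iff := L2_mul mII f2 v2.
rewrite distrC -RintegralB//; apply: le_lt_trans (le_normr_Rintegral _ _) _ => //.
  exact: integB.
apply: (@le_lt_trans _ _ (n.+1%:R^-1 * V)); last first.
  apply: (@le_lt_trans _ _ (n.+1%:R^-1 * (V + 1))).
    by rewrite ler_wpM2l ?invr_ge0// lerDl.
  by rewrite -ltr_pdivlMr// ltr_wpDl.
rewrite -RintegralZl//; last exact: integ_abs.
apply: le_Rintegral => //.
- by apply: integ_abs => //; exact: integB.
- by apply: integZ => //; exact: integ_abs.
- by move=> x Ix; rewrite -mulrBl normrM ler_wpM2r// fnf.
Qed.

Lemma wcv_lin (c : R) (un wn : nat -> R -> R) u w : (forall n, L2 II (un n)) -> L2 II u ->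
  (forall n, L2 II (wn n)) -> L2 II w -> wcv un u -> wcv wn w ->
  wcv (fun n x => un n x + c * wn n x) (fun x => u x + c * w x).
Proof.
move=> un2 u2 wn2 w2 cu cw v v2.
have E f g : L2 II f -> L2 II g -> \int[mu]_(x in II) ((f x + c * g x) * v x) =
    \int[mu]_(x in II) (f x * v x) + c * \int[mu]_(x in II) (g x * v x).
  move=> f2 g2; have i1 := L2_mul mII f2 v2; have i2 := L2_mul mII g2 v2.
  rewrite -RintegralZl// -RintegralD//; last exact: integZ.
  by apply: eq_Rintegral => x _; ring.
rewrite E//; under eq_fun do rewrite E//.
apply: cvgD; first exact: cu.
by apply: cvgM; [exact: cvg_cst|exact: cw].
Qed.

(** Expanding the nonnegative integral of [(un n - u)^2] and using that the pairing of [un n] with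
    [u] tends to [sqn u]. *)
Lemma wcv_lsc (un : nat -> R -> R) u : (forall n, L2 II (un n)) -> L2 II u ->
  wcv un u -> forall e : R, 0 < e -> \forall n \near \oo, sqn u <= sqn (un n) + e.
Proof.
move=> un2 u2 cu e e0.
have /cvgrPdist_lt /(_ (e / 2)) := cu u u2; rewrite divr_gt0// => /(_ isT).
apply: filterS => n; rewrite ltr_norml => /andP[_ hn].
have : 0 <= sqn (fun x => un n x - u x).
  by apply: Rintegral_ge0 => x _; exact: sqr_ge0.
have i1 := L2_sqr mII (un2 n); have i2 := L2_sqr mII u2.
have i3 := L2_mul mII (un2 n) u2.
have -> : sqn (fun x => un n x - u x) =
    sqn (un n) - 2 * \int[mu]_(x in II) (un n x * u x) + sqn u.
  rewrite -RintegralZl// -RintegralB//; last exact: integZ.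
  rewrite -RintegralD//; last by apply: integB => //; exact: integZ.
  by apply: eq_Rintegral => x _; ring.
have uu : \int[mu]_(x in II) (u x * u x) = sqn u.
  by apply: eq_Rintegral => x _; rewrite expr2.
by rewrite uu in hn; lra.
Qed.

Lemma sqn_add_le (u w : R -> R) (c B : R) : L2 II u -> L2 II w ->
  (forall t, II t -> `|w t| <= B) ->
  sqn (fun x => u x + c * w x) <= 2 * sqn u + 2 * c ^+ 2 * B ^+ 2 * twopi R.
Proof.
move=> u2 w2 wB; have i1 := L2_sqr mII u2.
have i3 : integ II (cst (2 * c ^+ 2 * B ^+ 2)) by apply: integ_cst => //; exact: IIoo.
have -> : 2 * c ^+ 2 * B ^+ 2 * twopi R = \int[mu]_(x in II) (2 * c ^+ 2 * B ^+ 2).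
  by rewrite Rint_cst_itv ?subr0// ltW// twopi_gt0.
rewrite -RintegralZl// -RintegralD//; last exact: integZ.
apply: le_Rintegral => //.
- by apply: L2_sqr => //; apply: L2D => //; exact: L2Z.
- by apply: integD => //; exact: integZ.
move=> x Ix; have h : w x ^+ 2 <= B ^+ 2.
  rewrite -[leLHS]ger0_norm ?sqr_ge0// normrX lerXn2r ?nnegrE// ?wB//.
  by apply: le_trans (wB x Ix).
have := ler_wpM2l (sqr_ge0 c) h; have := sqr_ge0 (u x - c * w x); nra.
Qed.

Lemma invd_cvg (dn : nat -> R) (d : R) : (forall n, 0 <= dn n) -> 0 <= d ->
  dn n @[n --> \oo] --> d -> invd (dn n) @[n --> \oo] --> invd d.
Proof.
move=> dn0 d0 cd; have [dz|dz] := eqVneq d 0.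
  rewrite {2}/invd dz eqxx; apply/cvgeyPge => A.
  have e0 : 0 < (`|A| + 1)^-1 by rewrite invr_gt0 ltr_wpDl.
  move/cvgrPdist_lt: cd => /(_ _ e0); apply: filterS => n.
  rewrite dz sub0r normrN (ger0_norm (dn0 n)) => h; rewrite /invd; case: eqP => [_|/eqP n0].
    by rewrite leey.
  have dp : 0 < dn n by rewrite lt_neqAle eq_sym n0 dn0.
  rewrite lee_fin; apply: (le_trans (ler_norm A)).
  apply: (@le_trans _ _ (`|A| + 1)); first by rewrite lerDl.
  by rewrite -[leLHS]invrK lef_pV2 ?posrE ?invr_gt0 ?ltr_wpDl// ltW.
have dp : 0 < d by rewrite lt_neqAle eq_sym dz.
have -> : invd d = (d^-1)%:E by rewrite /invd (negbTE dz).
apply: (@cvg_trans _ ((dn n)^-1%:E @[n --> \oo])).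
  apply: near_eq_cvg; have /cvgrPdist_lt /(_ _ dp) := cd.
  apply: filterS => n; rewrite ltr_norml => /andP[_ h].
  have : 0 < dn n by lra.
  by rewrite /invd => /gt_eqF ->.
apply: cvg_EFin; first by apply: nearW.
exact: cvgV.
Qed.

Lemma cvg_sumr (I : Type) (s : seq I) (F : I -> nat -> R) (l : I -> R) :
  (forall i, F i n @[n --> \oo] --> l i) ->
  \sum_(i <- s) F i n @[n --> \oo] --> \sum_(i <- s) l i.
Proof.
move=> Fl; elim: s => [|i s IH].
  by rewrite big_nil; under eq_fun do rewrite big_nil; exact: cvg_cst.
rewrite big_cons; under eq_fun do rewrite big_cons.
by apply: cvgD; [exact: Fl|exact: IH].
Qed.

(** The direct method in abstract form: the hypothesis on sequences combines compactness of
    sublevels with lower semicontinuity. *)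
Lemma exists_minimum (T : Type) (F : T -> \bar R) (S : set T) :
  (forall x, (0 <= F x)%E) -> (exists x, S x) ->
  (forall (r : R) (u : nat -> T),
    (forall n, S (u n) /\ (F (u n) <= (r + n.+1%:R^-1)%:E)%E) ->
    exists2 x, S x & (F x <= r%:E)%E) ->
  exists x, S x /\ forall y, S y -> (F x <= F y)%E.
Proof.
move=> F0 [x0 Sx0] lim; set E := [set F x | x in S].
have infE x : S x -> (ereal_inf E <= F x)%E.
  by move=> Sx; apply: ereal_inf_lbound; exists x.
have I0 : (0 <= ereal_inf E)%E by apply: le_ereal_inf_tmp => _ [x _ <-].
have [Ifin|Iy] := boolP (ereal_inf E \is a fin_num); last first.
  have {}Iy : ereal_inf E = +oo%E.
    by apply/eqP; rewrite -leye_eq leNgt -(ge0_fin_numE I0).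
  (* When the infimum is [+oo], every element of [S] is a minimizer. *)
  exists x0; split => // y Sy.
  by apply: le_trans (infE y Sy); rewrite Iy leey.
have rE : ereal_inf E = (fine (ereal_inf E))%:E by rewrite fineK.
move: (fine (ereal_inf E)) rE => r rE.
have /choice[u uP] (n : nat) : exists x, S x /\ (F x <= (r + n.+1%:R^-1)%:E)%E.
  have e0 : 0 < n.+1%:R^-1 :> R by rewrite invr_gt0 ltr0n.
  have [_ [x Sx <-] xr] := lb_ereal_inf_adherent e0 Ifin.
  by exists x; split => //; rewrite EFinD -rE ltW.
have [x Sx xr] := lim r u uP.
by exists x; split => // y Sy; apply: (le_trans xr); rewrite -rE; exact: infE.
Qed.

End weak_convergence.

(** * The direct method for the action *)

Section minimizer.
Context {R : realType}.
Notation mu := (@lebesgue_measure R).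
Notation II := [set` `[0%R, twopi R]].
Notation sqn f := (\int[mu]_(x in II) (f x) ^+ 2).
Variable N : nat.
Hypothesis hN : (2 <= N)%N.
Variable k : nat.
Notation o0 := (o0 hN).
Notation act := (action k%:R (twopi R)).
Implicit Types (q : loop R N).

(** The action controls only the derivatives in the rotating frame; the ordinary ones are recovered
    by adding back [k] times a bounded coordinate. *)
Lemma sqn_prims_le q g (M B : R) : prims q g -> 0 <= M ->
  \int[mu]_(t in II) kin k%:R q g t <= M -> (forall t i a, `|q t i a| <= B) ->
  forall i a, sqn (g i a) <= 4 * M + 2 * k%:R ^+ 2 * B ^+ 2 * twopi R.
Proof.
move=> pg M0 kM qB i a; have := kin_coord_le i pg kM.
set U := Rintegral _ _ _; set V := Rintegral _ _ _; set W := Rintegral _ _ _ => h.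
have U0 : 0 <= U by exact: sqn_ge0.
have V0 : 0 <= V by exact: sqn_ge0.
have W0 : 0 <= W by exact: sqn_ge0.
set P := 2 * _ * _ * _; have P0 : 0 <= P.
  apply: mulr_ge0; last exact: ltW (@twopi_gt0 R).
  by apply: mulr_ge0; [apply: mulr_ge0 => //; exact: sqr_ge0|exact: sqr_ge0].
have [->|->|->] := I3P a; last by apply: (@le_trans _ _ (2 * M)); rewrite -/W; lra.
- have := sqn_add_le k%:R (L2_rotx k%:R i pg) (L2_coord i cy pg) (fun t _ => qB t i cy).
  rewrite -/U -/P (@eq_Rintegral _ _ _ mu _ (fun t => g i cx t ^+ 2)); last first.
    by move=> x _; rewrite subrK.
  lra.
- have := sqn_add_le (- k%:R) (L2_roty k%:R i pg) (L2_coord i cx pg) (fun t _ => qB t i cx).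
  rewrite sqrrN -/V -/P (@eq_Rintegral _ _ _ mu _ (fun t => g i cy t ^+ 2)); last first.
    by move=> x _; rewrite mulNr addrK.
  lra.
Qed.

Section limit.
Variables (xi : Xi N) (pn : nat -> loop R N) (gn : nat -> 'I_N -> 'I_3 -> R -> R).
Variables (q : loop R N) (g : 'I_N -> 'I_3 -> R -> R).
Hypothesis pnA : forall n, admissible xi (pn n).
Hypothesis pgn : forall n, prims (pn n) (gn n).
Hypothesis qper : forall t i a, q (t + 2 * pi) i a = q t i a.
Hypothesis pg : prims q g.
Hypothesis pnq : forall n t i a, `|pn n t i a - q t i a| <= n.+1%:R^-1.
Hypothesis gcv : forall i a, wcv (fun n => gn n i a) (g i a).

Let ql : is_loop q. Proof. exact: prims_loop pg. Qed.
Let pnl n : is_loop (pn n). Proof. by case: (pnA n) => -[[]]. Qed.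

Let coord_cvg t i a : pn n t i a @[n --> \oo] --> q t i a.
Proof.
apply/cvgrPdist_lt => e e0; apply: filterS (near_inv_lt e0) => n.
by rewrite distrC; apply: le_lt_trans.
Qed.

Let coord_wcv i a : wcv (fun n t => pn n t i a) (fun t => q t i a).
Proof.
apply: uniform_wcv => [n||n t _]; [exact: L2_coord (pgn n)|exact: L2_coord pg|].
exact: pnq.
Qed.

Lemma limit_DN : loopsDN q.
Proof.
split => //; split.
- move=> t i a; rewrite body0E; have := @coord_cvg t i a.
  have -> : (fun n => pn n t i a) = fun n => pn n (t + 2 * pi * i%:R / N%:R) o0 a.
    apply/funext => n; have [[[_ [sh _]] _] _] := pnA n.
    by rewrite sh body0E.
  by move=> h; exact: cvg_unique h (@coord_cvg _ _ _).
- move=> t a; rewrite !body0E; have := @coord_cvg (2 * pi - t) o0 a.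
  have -> : (fun n => pn n (2 * pi - t) o0 a) =
      fun n => if a == cy then - pn n t o0 a else pn n t o0 a.
    apply/funext => n; have [[[_ [_ re]] _] _] := pnA n.
    by rewrite -(body0E hN) re !body0E.
  move=> h; apply: cvg_unique h _ => //; case: (a == cy); last exact: coord_cvg.
  by apply: cvgN; exact: coord_cvg.
Qed.

Lemma limit_mean : mean_z0 q = 0.
Proof.
have one : L2 II (fun=> 1) by apply: continuous_L2 => x; exact: cvg_cst.
have E p : mean_z0 p = (2 * pi)^-1 * \int[mu]_(t in II) (p t o0 cz * 1) :> R.
  by rewrite /mean_z0; congr (_ * _); apply: eq_Rintegral => t _; rewrite body0E mulr1.
have := @coord_wcv o0 cz _ one.
have -> : (fun n => \int[mu]_(t in II) (pn n t o0 cz * 1)) = fun=> 0.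
  apply/funext => n; have [_] := pnA n; rewrite E => /eqP.
  by rewrite mulf_eq0 invr_eq0 gt_eqF ?twopi_gt0//= => /eqP.
move=> h; rewrite E; have -> : \int[mu]_(t in II) (q t o0 cz * 1) = 0.
  by apply: cvg_unique h (cvg_cst _).
by rewrite mulr0.
Qed.

Lemma H1inner_limit v : is_loop v ->
  H1inner (fun t => confsub (pn n t) (q t)) v @[n --> \oo] --> 0.
Proof.
move=> vl; have [gv pv] := is_loop_prims vl.
have E n : H1inner (fun t => confsub (pn n t) (q t)) v = \sum_(i < N) \sum_(a < 3)
    ((\int[mu]_(t in II) (pn n t i a * v t i a) - \int[mu]_(t in II) (q t i a * v t i a)) +
     (\int[mu]_(t in II) (gn n i a t * gv i a t) - \int[mu]_(t in II) (g i a t * gv i a t))).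
  rewrite (H1innerE (primsB (pgn n) pg) pv); apply: eq_bigr => i _; apply: eq_bigr => a _.
  have v2 : L2 II (fun t => v t i a) by exact: L2_coord pv.
  have gv2 : L2 II (gv i a) by exact: L2_prim pv.
  rewrite -!RintegralB//; do ?[by apply: L2_mul => //; exact: L2_coord (pgn n)|
    by apply: L2_mul => //; exact: L2_coord pg|
    by apply: L2_mul => //; exact: L2_prim (pgn n)|
    by apply: L2_mul => //; exact: L2_prim pg].
  by congr (_ + _); apply: eq_Rintegral => t _; rewrite /confsub; ring.
under eq_fun do rewrite E.
have Z : \sum_(i < N) \sum_(a < 3) (0 : R) = 0.
  by rewrite big1// => i _; rewrite big1.
suff H : \sum_(i < N) \sum_(a < 3)
    ((\int[mu]_(t in II) (pn n t i a * v t i a) - \int[mu]_(t in II) (q t i a * v t i a)) +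
     (\int[mu]_(t in II) (gn n i a t * gv i a t) - \int[mu]_(t in II) (g i a t * gv i a t)))
    @[n --> \oo] --> \sum_(i < N) \sum_(a < 3) (0 : R) by move: H; rewrite Z.
apply: cvg_sumr => i; apply: cvg_sumr => a.
have v2 : L2 II (fun t => v t i a) by exact: L2_coord pv.
have gv2 : L2 II (gv i a) by exact: L2_prim pv.
have c1 : \int[mu]_(t in II) (pn n t i a * v t i a) - \int[mu]_(t in II) (q t i a * v t i a)
    @[n --> \oo] --> \int[mu]_(t in II) (q t i a * v t i a) -
                    \int[mu]_(t in II) (q t i a * v t i a).
  by apply: cvgB; [exact: (@coord_wcv i a _ v2)|exact: cvg_cst].
have c2 : \int[mu]_(t in II) (gn n i a t * gv i a t) - \int[mu]_(t in II) (g i a t * gv i a t)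
    @[n --> \oo] --> \int[mu]_(t in II) (g i a t * gv i a t) -
                    \int[mu]_(t in II) (g i a t * gv i a t).
  by apply: cvgB; [exact: (@gcv i a _ gv2)|exact: cvg_cst].
by apply: (cvg_trans (cvgD c1 c2)); rewrite !subrr addr0; exact: cvg_id.
Qed.

(** A weak limit of elements of a weak closure is again in it: a neighbourhood involves finitely
    many test loops, so one index [n] serves all of them, with [e / 2] spent on each of the two
    approximations. *)
Lemma limit_admissible : admissible xi q.
Proof.
split; last exact: limit_mean.
split; first exact: limit_DN.
move=> vs e vsl e0.
have e2 : 0 < e / 2 by rewrite divr_gt0.
have : \forall n \near \oo, forall v, v \in vs ->
    `|H1inner (fun t => confsub (pn n t) (q t)) v| < e / 2.
  elim: vs vsl => [|w vs IH] vsl; first by apply: nearW.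
  have h1 : \forall n \near \oo,
      `|H1inner (fun t => confsub (pn n t) (q t)) w| < e / 2.
    have /H1inner_limit /cvgrPdist_lt /(_ _ e2) : is_loop w.
      by apply: vsl; rewrite mem_head.
    by apply: filterS => n; rewrite sub0r normrN.
  have h2 := IH (fun v hv => vsl v (mem_behead (s := w :: vs) hv)).
  apply: filterS2 h1 h2 => n a1 a2 v; rewrite in_cons => /predU1P[->//|].
  exact: a2.
move=> [n _ /(_ n (leqnn n)) hn].
have [[_ pc] _] := pnA n; have [s [Ss hs]] := pc vs (e / 2) vsl e2.
exists s; split => // v vvs; have vl := vsl v vvs.
have [[sl _] _] := Ss; have [gs ps] := is_loop_prims sl; have [gv pv] := is_loop_prims vl.
have -> : H1inner (fun t => confsub (s t) (q t)) v =
    H1inner (fun t => confsub (s t) (pn n t)) v +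
    H1inner (fun t => confsub (pn n t) (q t)) v.
  rewrite (H1innerE (primsB ps pg) pv) (H1innerE (primsB ps (pgn n)) pv).
  rewrite (H1innerE (primsB (pgn n) pg) pv) -big_split/=; apply: eq_bigr => i _.
  rewrite -big_split/=; apply: eq_bigr => a _.
  have v2 : L2 II (fun t => v t i a) by exact: L2_coord pv.
  have gv2 : L2 II (gv i a) by exact: L2_prim pv.
  have A2 p gp p' gp' : prims p gp -> prims p' gp' ->
      integ II (fun t => confsub (p t) (p' t) i a * v t i a).
    by move=> h1 h2; apply: L2_mul => //; exact: L2_coord (primsB h1 h2).
  have B2 p gp p' gp' : prims p gp -> prims p' gp' ->
      integ II (fun t => (gp i a t - gp' i a t) * gv i a t).
    by move=> h1 h2; apply: L2_mul => //; exact: L2_prim (primsB h1 h2).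
  have -> : \int[mu]_(t in II) (confsub (s t) (q t) i a * v t i a) =
      \int[mu]_(t in II) (confsub (s t) (pn n t) i a * v t i a) +
      \int[mu]_(t in II) (confsub (pn n t) (q t) i a * v t i a).
    rewrite -RintegralD//; [|exact: A2 ps (pgn n)|exact: A2 (pgn n) pg].
    by apply: eq_Rintegral => t _; rewrite /confsub; ring.
  have -> : \int[mu]_(t in II) ((gs i a t - g i a t) * gv i a t) =
      \int[mu]_(t in II) ((gs i a t - gn n i a t) * gv i a t) +
      \int[mu]_(t in II) ((gn n i a t - g i a t) * gv i a t).
    rewrite -RintegralD//; [|exact: B2 ps (pgn n)|exact: B2 (pgn n) pg].
    by apply: eq_Rintegral => t _; ring.
  by rewrite addrACA.
rewrite (le_lt_trans (ler_normD _ _))// [ltRHS]splitr.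
by apply: ltrD; [exact: hs|exact: hn].
Qed.

Lemma limit_kin (e : R) : 0 < e -> \forall n \near \oo,
  \int[mu]_(t in II) kin k%:R q g t <= \int[mu]_(t in II) kin k%:R (pn n) (gn n) t + e.
Proof.
move=> e0; have N0 : 0 < N%:R :> R by rewrite ltr0n N_gt0.
(* Three terms for each of the [N] bodies, with the factor 1/2 of the kinetic energy, cost [3 e / 4]
   in total. *)
pose e' := e / (2 * N%:R); have e'0 : 0 < e' by rewrite divr_gt0// mulr_gt0.
have lx i : \forall n \near \oo, sqn (fun t => g i cx t - k%:R * q t i cy) <=
    sqn (fun t => gn n i cx t - k%:R * pn n t i cy) + e'.
  apply: (@wcv_lsc _ (fun n t => gn n i cx t - k%:R * pn n t i cy)) => //.
  - by move=> n; exact: L2_rotx.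
  - exact: L2_rotx.
  have := @wcv_lin _ (- k%:R) (fun n => gn n i cx) (fun n t => pn n t i cy)
    (g i cx) (fun t => q t i cy) (fun n => L2_prim i cx (pgn n)) (L2_prim i cx pg)
    (fun n => L2_coord i cy (pgn n)) (L2_coord i cy pg) (@gcv i cx) (@coord_wcv i cy).
  by congr wcv; [apply/funext => n|]; apply/funext => t; rewrite mulNr.
have ly i : \forall n \near \oo, sqn (fun t => g i cy t + k%:R * q t i cx) <=
    sqn (fun t => gn n i cy t + k%:R * pn n t i cx) + e'.
  apply: (@wcv_lsc _ (fun n t => gn n i cy t + k%:R * pn n t i cx)) => //.
  - by move=> n; exact: L2_roty.
  - exact: L2_roty.
  exact: (@wcv_lin _ k%:R (fun n => gn n i cy) (fun n t => pn n t i cx)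
    (g i cy) (fun t => q t i cx) (fun n => L2_prim i cy (pgn n)) (L2_prim i cy pg)
    (fun n => L2_coord i cx (pgn n)) (L2_coord i cx pg) (@gcv i cy) (@coord_wcv i cx)).
have lz i : \forall n \near \oo, sqn (g i cz) <= sqn (gn n i cz) + e'.
  apply: (@wcv_lsc _ (fun n => gn n i cz) (g i cz)) => //.
  - by move=> n; exact: L2_prim (pgn n).
  - exact: L2_prim pg.
have l3 : \forall n \near \oo, forall i : 'I_N,
    sqn (fun t => g i cx t - k%:R * q t i cy) + sqn (fun t => g i cy t + k%:R * q t i cx) +
      sqn (g i cz) <=
    sqn (fun t => gn n i cx t - k%:R * pn n t i cy) +
      sqn (fun t => gn n i cy t + k%:R * pn n t i cx) + sqn (gn n i cz) + 3 * e'.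
  apply: filter_forall => i; apply: filterS3 (lx i) (ly i) (lz i) => n h1 h2 h3.
  have -> : 3 * e' = e' + e' + e' by ring.
  rewrite [leRHS](_ : _ = (sqn (fun t => gn n i cx t - k%:R * pn n t i cy) + e') +
      (sqn (fun t => gn n i cy t + k%:R * pn n t i cx) + e') + (sqn (gn n i cz) + e')).
    by rewrite !lerD.
  by ring.
apply: filterS l3 => n hn; rewrite !Rint_kin//.
have -> : e = 2^-1 * \sum_(i < N) 2 * e / N%:R.
  by rewrite sumr_const card_ord -[_ *+ N]mulr_natr; field; rewrite gt_eqF.
rewrite -mulrDr ler_pM2l ?invr_gt0// -big_split/=; apply: ler_sum => i _.
apply: (le_trans (hn i)); rewrite lerD2l /e' -subr_ge0.
have -> : 2 * e / N%:R - 3 * (e / (2 * N%:R)) = e / (2 * N%:R).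
  by field; rewrite gt_eqF.
by rewrite ltW.
Qed.

Lemma limit_potU t : potU (pn n t) @[n --> \oo] --> potU (q t).
Proof.
rewrite potUE; under eq_fun do rewrite potUE.
apply: cvg_nnesum => [i _|i _].
  by apply: nearW => n; apply: sume_ge0 => j _; apply: invd_ge0; exact: bdist_ge0.
apply: cvg_nnesum => [j _|j _].
  by apply: nearW => n; apply: invd_ge0; exact: bdist_ge0.
apply: invd_cvg => [n||]; [exact: bdist_ge0|exact: bdist_ge0|].
apply: (@continuous_cvg _ _ _ _ _ _ (@Num.sqrt R)); first exact: sqrt_continuous.
apply: cvg_sumr => a; under eq_fun do rewrite expr2; rewrite expr2.
by apply: cvgM; apply: cvgB; exact: coord_cvg.
Qed.

(** The kinetic integral is finite and can be moved to the other side, so that Fatou's lemma is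
    applied to the potential alone, possible collisions of [q] included. *)
Lemma limit_action (r : R) :
  (forall n, (act (pn n) <= (r + n.+1%:R^-1)%:E)%E) -> (act q <= r%:E)%E.
Proof.
move=> pr; set K := \int[mu]_(t in II) kin k%:R q g t.
suff H (e : R) : 0 < e -> (\int[mu]_(t in II) potU (q t) <= (r - K + e)%:E)%E.
  rewrite (actionE k%:R ql pg); apply/lee_addgt0Pr => e e0; rewrite -EFinD.
  have := H e e0; have -> : r - K + e = (r + e) - K by ring.
  by rewrite EFinB leeBrDl.
move=> e0; have mU n : measurable_fun II (fun t => potU (pn n t)).
  exact: measurable_potU.
have U0 n t : II t -> (0 <= potU (pn n t))%E by move=> _; exact: potU_ge0.
have := fatou mu mII mU U0.
rewrite (@eq_integral _ _ _ mu _ (fun t => potU (q t)) (fun t => limn_einf _)); last first.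
  move=> t _; have h := @limit_potU t.
  by rewrite is_cvg_limn_einfE ?(cvg_lim _ h)//; apply/cvg_ex; eexists; exact: h.
move=> /le_trans; apply.
(* One half of [e] pays for the kinetic semicontinuity, the other for the excess [1 / (n + 1)] of
   the minimizing sequence. *)
have e2 : 0 < e / 2 by rewrite divr_gt0.
have [n0 _ n0P] := filterI (limit_kin e2) (near_inv_lt e2).
apply: (@limn_einf_le_ev _ _ _ n0) => n nn; have [hk hi] := n0P n nn.
have := pr n; rewrite (actionE k%:R (pnl n) (pgn n)) -leeBrDl// -EFinB => /le_trans; apply.
move: hk hi => /=; rewrite lee_fin -/K.
set x := \int[mu]_(t in II) kin k%:R (pn n) (gn n) t.
by move: x (n.+1%:R^-1) => x y; lra.
Qed.

End limit.

Lemma minimizer_exists (xi : Xi N) (hkN : coprime k N) :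
  xi <> @ngon_signs R N k true -> xi <> @ngon_signs R N k false ->
  exists q, is_minimizer act (@admissible R N xi) q.
Proof.
move=> xt xf; apply: exists_minimum.
- by move=> q; exact: action_ge0.
- exact: (@admissible_neq0 R N hN xi).
move=> r qn qnP.
(* Since [1 / (n + 1) <= 1], the whole sequence lies in the sublevel [r + 1], to which [coercive]
   applies. *)
have qnM n : (act (qn n) <= (r + 1)%:E)%E.
  have [_ /le_trans] := qnP n; apply; rewrite lee_fin lerD2l.
  by rewrite invf_le1 ?ltr0n// ler1n.
have M0 : 0 <= r + 1.
  by rewrite -lee_fin; apply: le_trans (qnM 0%N); exact: action_ge0.
have [B qB] := @coercive R N hN k hkN xi (r + 1) xt xf.
have qnl n : is_loop (qn n) by have [[[[]]]] := qnP n.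
have /choice[gn pgn] n : exists g, prims (qn n) g by exact: is_loop_prims.
pose C := 4 * (r + 1) + 2 * k%:R ^+ 2 * B ^+ 2 * twopi R.
have qnB n t i a : `|qn n t i a| <= B by have [qA _] := qnP n; exact: qB.
have gC n i a : sqn (gn n i a) <= C.
  apply: (sqn_prims_le (pgn n)) => //.
  by rewrite -lee_fin; apply: le_trans (qnM n); exact: action_ge_kin.
have [||n s t i a s0 st t2|q [phi [phin qper qc]]] := @uniform_extraction R N qn B C.
- by move=> n t i a; exact: loop_periodic.
- exact: qnB.
- apply: (le_trans (prim_holder (pgn n i a) s0 st t2)).
  by rewrite ler_wpM2l ?subr_ge0.
(* The same [phi] serves all coordinates: [weak_limit] gives weak convergence of the derivatives
   without a further extraction. *)
have /choice[g gP] (x : 'I_N * 'I_3) : exists g, prim (fun t => q t x.1 x.2) g /\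
    wcv (fun n => gn (phi n) x.1 x.2) g.
  have [|||g pg wg] := @weak_limit R (fun n t => qn (phi n) t x.1 x.2)
    (fun n => gn (phi n) x.1 x.2) (fun t => q t x.1 x.2) C.
  - by move=> n; exact: pgn.
  - by move=> n; exact: gC.
  - move=> e e0; have [n0 _ n0P] := near_inv_lt e0; exists n0 => n nn t _.
    by apply: (le_trans (qc n t x.1 x.2)); apply: ltW; exact: n0P.
  exists g; split => // v v2; apply/cvgrPdist_lt => e e0.
  have [n0 n0P] := wg v v2 e e0; exists n0 => // n nn.
  by rewrite distrC; exact: n0P.
have pnA n : admissible xi (qn (phi n)) by case: (qnP (phi n)).
pose g' i a := g (i, a).
have pg : prims q g' by move=> i a; case: (gP (i, a)).
have gcv i a : wcv (fun n => gn (phi n) i a) (g' i a) by case: (gP (i, a)).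
exists q.
  exact: (limit_admissible pnA (fun n => pgn (phi n)) qper pg qc gcv).
apply: (limit_action pnA (fun n => pgn (phi n)) qper pg qc gcv) => n.
have [_ /le_trans] := qnP (phi n); apply; rewrite lee_fin lerD2l.
by rewrite lef_pV2 ?posrE ?ltr0n// ler_nat ltnS.
Qed.

End minimizer.

Unset Implicit Arguments.

Theorem mainTheorem4 (R : realType) (N : nat) (hN : (2 <= N)%N)
    (xi : Xi N) (k : nat) (hk : (0 < k < N)%N) (hkN : coprime k N) :
  (* (a) *)
  ((xi <> @xi_ngon R N k true /\ xi <> @xi_ngon R N k false) ->
     exists q, is_minimizer (action k%:R (twopi R)) (@admissible R N xi) q) /\
  (* (b) *)
  (forall s : bool, xi = @xi_ngon R N k s ->
     (~ exists q, is_minimizer (action k%:R (twopi R)) (@admissible R N xi) q) /\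
     ereal_inf [set action k%:R (twopi R) q | q in @admissible R N xi] = 0%E) /\
  (* (c) *)
  (forall (s : bool) (qn : nat -> loop R N), xi = @xi_ngon R N k s ->
     (forall n, @admissible R N xi (qn n)) ->
     action k%:R (twopi R) (qn n) @[n --> \oo] --> 0%E ->
     (forall M : R, exists n0 : nat, forall n, (n0 <= n)%N ->
        forall (i : 'I_N) (t : R), M < Num.sqrt (\sum_(a < 3) (qn n t i a) ^+ 2)) /\
     exists phi : nat -> nat, (forall m n, (m < n)%N -> (phi m < phi n)%N) /\
       forall e : R, 0 < e -> exists n0 : nat, forall n, (n0 <= n)%N -> forall t : R,
         confnorm (confsub (confscale (confnorm (qn (phi n) t))^-1 (qn (phi n) t))
                     (confscale (confnorm (@Ngon R N k s))^-1
                             (confrot (- (k%:R * t)) (@Ngon R N k s)))) < e).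
Proof.
split; [|split].
- move=> [xt xf]; rewrite !(xi_ngonE hN hkN) in xt xf.
  exact: (minimizer_exists hN hkN xt xf).
- move=> s ->; rewrite (xi_ngonE hN hkN); split.
    exact: (no_minimizer_ngon hN hkN).
  exact: (inf_action_ngon hN hkN).
- move=> s qn xis; rewrite xis (xi_ngonE hN hkN) => qA q0.
  have [h1 h2] := escape_to_infinity hN hkN qA q0.
  (* The normalized configurations converge along the whole sequence, so the identity serves as the
     subsequence. *)
  by split; [exact: h1|exists id; split].
Qed.
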